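(* Let $\mathbb{K}$ be a principal ideal domain. For any two path pairs of sets $\mathcal{S}$ and $\mathcal{S}'$ there is an isomorphism of chain complexes over $\mathbb{K}$ $$\Omega(\mathcal{S}\square\mathcal{S}')\cong\Omega\mathcal{S}\otimes\Omega\mathcal{S}'.$$ Moreover, for every $n$ there is a short exact sequence $$0\to\bigoplus_{i+j=n}H_i(\mathcal{S})\otimes H_j(\mathcal{S}')\to H_n(\mathcal{S}\square\mathcal{S}')\to\bigoplus_{i+j=n-1}\mathsf{Tor}^{\mathbb{K}}_1(H_i(\mathcal{S}),H_j(\mathcal{S}'))\to0.$$
   Context: For a non-negatively graded chain complex $C$ of $\mathbb{K}$-modules with differential $\partial$ and a graded submodule $D\subseteq C$ (not necessarily a subcomplex), $\omega(C,D)$ is the subcomplex with $\omega(C,D)_n=D_n\cap\partial^{-1}(D_{n-1})$. For a simplicial module $A$, $\mathsf{N}A$ is the Moore complex $\mathsf{N}_nA=\bigcap_{i\ne0}\ker(d_i:A_n\to A_{n-1})$, a subcomplex of the unnormalized complex $\mathsf{C}A$ ($\mathsf{C}_nA=A_n$, differential $\sum_i(-1)^id_i$), and $\rho:\mathsf{C}A\to\mathsf{N}A$ is the projection along the degenerate subcomplex $\mathsf{D}_nA=\sum_is_i(A_{n-1})$. A path pair of sets is $\mathcal{S}=(X,Y)$ where $X$ is a simplicial set and $Y=(Y_n\subseteq X_n)_{n\ge0}$ is a sequence of subsets closed under all degeneracy maps and under the exterior face maps $d_0,d_n:X_n\to X_{n-1}$. With $A=\mathbb{K}[X]$ (levelwise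 free module), $B=\mathbb{K}[Y]$ and $\overline{B}_n=\rho(B_n)\subseteq\mathsf{N}_nA$, put $\Omega\mathcal{S}=\omega(\mathsf{N}A,\overline{B})$ and $H_n(\mathcal{S})=H_n(\Omega\mathcal{S})$. A $(k,l)$-shuffle is a pair $(\mu,\nu)$ of strictly increasing sequences $\mu=(\mu_0,\dots,\mu_{k-1})$, $\nu=(\nu_0,\dots,\nu_{l-1})$ with $\{\mu_i\}\cup\{\nu_j\}=\{0,\dots,k+l-1\}$; write $s_\nu=s_{\nu_{l-1}}\cdots s_{\nu_0}$, $s_\mu=s_{\mu_{k-1}}\cdots s_{\mu_0}$. The box product of $\mathcal{S}=(X,Y)$ and $\mathcal{S}'=(X',Y')$ is $\mathcal{S}\square\mathcal{S}'=(X\times X',Y\diamond Y')$ with $$(Y\diamond Y')_n=\bigcup_{k+l=n}\ \bigcup_{(\mu,\nu)\ (k,l)\text{-shuffle}}s_\nu(Y_k)\times s_\mu(Y'_l).$$ *)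

(* Defs.v *)
From HB Require Import structures.
From mathcomp Require Import all_boot all_algebra finmap zify.
From mathcomp Require Import boolp classical_sets.
From mathcomp.multinomials Require Import monalg.

Set Implicit Arguments.
Unset Strict Implicit.
Unset Printing Implicit Defensive.

Import GRing.Theory.
Local Open Scope ring_scope.

Record submodule (K : pzRingType) (V : lmodType K) := Submodule {
  submodule_pred :> {pred V};
  submodule_closed : submod_closed submodule_pred }.

HB.instance Definition _ (K : pzRingType) (V : lmodType K) (S : submodule V) :=
  GRing.isSubmodClosed.Build K V (submodule_pred S) (submodule_closed S).

(* The submodules of K^o are the ideals of K. *)
Definition is_pid (K : idomainType) : Prop :=
  forall I : submodule K^o,
    exists a : K, forall x : K, x \in I <-> exists b : K, x = b * a.

Section Modules.
Context {K : comNzRingType}.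
Implicit Types U V W : lmodType K.

Record submod V (S : submodule V) := Submod {
  submod_val :> V;
  submodP : submod_val \in S }.

HB.instance Definition _ V (S : submodule V) :=
  [isSub for @submod_val V S].
HB.instance Definition _ V (S : submodule V) := [Choice of submod S by <:].
HB.instance Definition _ V (S : submodule V) :=
  [SubChoice_isSubLmodule of submod S by <:].

Definition kern_pred V W (f : {linear V -> W}) : {pred V} := fun x => f x == 0.
Fact kern_closed V W (f : {linear V -> W}) : submod_closed (kern_pred f).
Proof.
split=> [|a x y]; rewrite !unfold_in ?linear0 //.
by rewrite linearP => /eqP -> /eqP ->; rewrite scaler0 addr0.
Qed.
Definition kern V W (f : {linear V -> W}) : submodule V :=
  Submodule (kern_closed f).

Definition span_pred V (P : set V) : {pred V} := fun x =>
  `[< forall S : submodule V, (forall y, P y -> y \in S) -> x \in S >].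
Fact span_closed V (P : set V) : submod_closed (span_pred P).
Proof.
split=> [|a x y]; rewrite !unfold_in.
  by apply/asboolP => S _; exact: rpred0.
move=> /asboolP xS /asboolP yS; apply/asboolP => S PS.
by rewrite rpredD ?rpredZ ?xS ?yS.
Qed.
Definition span V (P : set V) : submodule V := Submodule (span_closed P).

Definition quotmod V (S : submodule V) : Type := Quotient.quot (submodule_pred S).

HB.instance Definition _ V (S : submodule V) :=
  GRing.Zmodule.copy (quotmod S) (Quotient.quot (submodule_pred S)).

Section QuotientModule.
Variables (V : lmodType K) (S : submodule V).
Local Open Scope quotient_scope.

Definition qproj (x : V) : quotmod S := \pi_(Quotient.quot (submodule_pred S)) x.
Definition qrepr (q : quotmod S) : V := repr (q : Quotient.quot (submodule_pred S)).

Lemma qreprK : cancel qrepr qproj.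
Proof. exact: reprK. Qed.

Lemma qproj_eq x y : (qproj x = qproj y) <-> (x - y \in S).
Proof.
rewrite -[x - y \in S]/(x - y \in submodule_pred S) Quotient.idealrBE.
by split=> /eqP.
Qed.

Lemma qprojD x y : qproj (x + y) = qproj x + qproj y.
Proof. by rewrite /qproj !piE. Qed.

Lemma qrepr_qproj x : qrepr (qproj x) - x \in S.
Proof. by apply/qproj_eq; rewrite qreprK. Qed.

Definition qscale (a : K) (q : quotmod S) : quotmod S := qproj (a *: qrepr q).

Lemma qscale_qproj a x : qscale a (qproj x) = qproj (a *: x).
Proof. by apply/qproj_eq; rewrite -scalerBr rpredZ ?qrepr_qproj. Qed.

Fact qscaleA a b q : qscale a (qscale b q) = qscale (a * b) q.
Proof. by rewrite -[q]qreprK !qscale_qproj scalerA. Qed.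
Fact qscale1 : left_id 1 qscale.
Proof. by move=> q; rewrite -[q]qreprK qscale_qproj scale1r. Qed.
Fact qscaleDr : right_distributive qscale +%R.
Proof.
move=> a q r; rewrite -[q]qreprK -[r]qreprK -qprojD !qscale_qproj -qprojD.
by rewrite scalerDr.
Qed.
Fact qscaleDl q : {morph qscale^~ q : a b / a + b}.
Proof.
by move=> a b; rewrite -[q]qreprK !qscale_qproj -qprojD scalerDl.
Qed.
HB.instance Definition _ := GRing.Zmodule_isLmodule.Build K (quotmod S)
  qscaleA qscale1 qscaleDr qscaleDl.

Fact qproj_is_linear : linear qproj.
Proof. by move=> a x y; rewrite qprojD -qscale_qproj. Qed.
HB.instance Definition _ :=
  GRing.isLinear.Build K V (quotmod S) _ qproj qproj_is_linear.

Lemma qproj_eq0 x : (qproj x = 0) <-> (x \in S).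
Proof. by rewrite -[0](linear0 qproj) qproj_eq subr0. Qed.

End QuotientModule.

(* The homology at V of U -> V -> W, that is ker g / im f. *)
Section Homology.
Variables (U V W : lmodType K) (f : {linear U -> V}) (g : {linear V -> W}).

Definition bound_pred : {pred submod (kern g)} :=
  fun z => `[< exists u, f u = submod_val z >].
Fact bound_closed : submod_closed bound_pred.
Proof.
split=> [|a x y]; rewrite !unfold_in.
  by apply/asboolP; exists 0; rewrite linear0.
move=> /asboolP[u ux] /asboolP[v vy]; apply/asboolP; exists (a *: u + v).
by rewrite linearP ux vy.
Qed.
Definition bound : submodule (submod (kern g)) := Submodule bound_closed.

Definition homology_at : lmodType K := quotmod bound.
End Homology.

(* {malg K[X]} is used only as a module: it is free on X, with basis << x >>;
   flift h is the linear extension of h. *)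

Section Free.
Variables (X : choiceType) (V : lmodType K) (h : X -> V).

Definition flift (a : {malg K[X]}) : V := \sum_(x <- msupp a) a@_x *: h x.

Lemma fliftEw (d : {fset X}) (a : {malg K[X]}) : (msupp a `<=` d)%fset ->
  flift a = \sum_(x <- d) a@_x *: h x.
Proof.
move=> le_ad; rewrite /flift [LHS](big_fset_incl _ le_ad) //.
by move=> x _ /mcoeff_outdom ->; rewrite scale0r.
Qed.

Fact flift_is_linear : linear flift.
Proof.
move=> c a b; set d := (msupp a `|` msupp b)%fset.
have le_ad : (msupp a `<=` d)%fset by exact: fsubsetUl.
have le_bd : (msupp b `<=` d)%fset by exact: fsubsetUr.
rewrite (fliftEw le_ad) (fliftEw le_bd) (@fliftEw d); last first.
  apply: fsubset_trans (msuppD_le _ _) _; apply: fsetSU; exact: msuppZ_le.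
rewrite scaler_sumr -big_split; apply: eq_bigr => x _ /=.
by rewrite mcoeffD mcoeffZ scalerDl scalerA.
Qed.
HB.instance Definition _ :=
  GRing.isLinear.Build K {malg K[X]} V _ flift flift_is_linear.

Lemma fliftU x : flift << x >> = h x.
Proof. by rewrite /flift msuppU oner_eq0 big_seq_fset1 mcoeffUU scale1r. Qed.

End Free.

Lemma free_ext (X : choiceType) V (f g : {linear {malg K[X]} -> V}) :
  (forall x, f << x >> = g << x >>) -> f =1 g.
Proof.
move=> fg a; rewrite [a]monalgE !linear_sum; apply: eq_bigr => x _.
have -> : << a@_x *g x >> = a@_x *: << x >> :> {malg K[X]}.
  by apply/malgP => y; rewrite mcoeffZ !mcoeffU mulrnAr mulr1.
by rewrite !linearZ fg.
Qed.

Definition fmapf (X Y : choiceType) (f : X -> Y) :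
  {linear {malg K[X]} -> {malg K[Y]}} := flift (fun x => << f x >>).

Lemma fmapfU (X Y : choiceType) (f : X -> Y) x :
  fmapf f << x >> = << f x >>.
Proof. exact: fliftU. Qed.

Definition tensor_rel V W (g : {malg K[(V * W)%type]}) : Prop :=
  [\/ exists v v' w, g = << (v + v', w) >> - << (v, w) >> - << (v', w) >>,
      exists v w w', g = << (v, w + w') >> - << (v, w) >> - << (v, w') >>,
      exists a v w, g = << (a *: v, w) >> - a *: << (v, w) >>
    | exists a v w, g = << (v, a *: w) >> - a *: << (v, w) >> ].

Definition tensor V W : lmodType K := quotmod (span (@tensor_rel V W)).

Definition tens V W (v : V) (w : W) : tensor V W := qproj _ << (v, w) >>.

Section TensorMap.
Variables (V W V' W' : lmodType K).
Variables (f : {linear V -> V'}) (g : {linear W -> W'}).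

Let pre : {linear {malg K[(V * W)%type]} -> tensor V' W'} :=
  flift (fun p => tens (f p.1) (g p.2)).

Lemma pre_rel r : r \in span (@tensor_rel V W) -> pre r = 0.
Proof.
move=> /asboolP /(_ (kern pre)) rk; apply/eqP/rk => {r rk} r rel.
have preU v w : pre << (v, w) >> = qproj _ << (f v, g w) >>.
  exact: fliftU.
apply/eqP; case: rel => -[x [y [z ->]]];
  rewrite !linearB ?linearZ /= !preU -?linearZ -!linearB;
  apply/qproj_eq0/asboolP => S; apply.
- by apply: Or41; exists (f x), (f y), (g z); rewrite linearD.
- by apply: Or42; exists (f x), (g y), (g z); rewrite linearD.
- by apply: Or43; exists x, (f y), (g z); rewrite linearZ.
- by apply: Or44; exists x, (f y), (g z); rewrite linearZ.
Qed.

Definition tensor_map_fun (t : tensor V W) : tensor V' W' := pre (qrepr t).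

Lemma tensor_map_proj r : tensor_map_fun (qproj _ r) = pre r.
Proof.
by apply/eqP; rewrite -subr_eq0 -linearB; apply/eqP/pre_rel/qrepr_qproj.
Qed.

Fact tensor_map_is_linear : linear tensor_map_fun.
Proof.
move=> a x y; rewrite -[x]qreprK -[y]qreprK -linearP !tensor_map_proj.
exact: linearP.
Qed.
HB.instance Definition _ := GRing.isLinear.Build K (tensor V W) (tensor V' W') _
  tensor_map_fun tensor_map_is_linear.

Definition tensor_map : {linear tensor V W -> tensor V' W'} := tensor_map_fun.

Lemma tensor_map_tens v w : tensor_map (tens v w) = tens (f v) (g w).
Proof. by rewrite [LHS]tensor_map_proj [LHS]fliftU. Qed.

End TensorMap.

Lemma tensor_ext V W U (f g : {linear tensor V W -> U}) :
  (forall v w, f (tens v w) = g (tens v w)) -> f =1 g.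
Proof.
move=> fg t; rewrite -[t]qreprK; set a := qrepr t.
apply: (free_ext (f := f \o @qproj _ _) (g := g \o @qproj _ _)) => -[v w].
exact: fg.
Qed.

Lemma tens0l V W (w : W) : tens (0 : V) w = 0.
Proof.
apply/qproj_eq0/asboolP => S; apply; apply: Or43; exists 0, 0, w.
by rewrite !scale0r subr0.
Qed.

Lemma tens0r V W (v : V) : tens v (0 : W) = 0.
Proof.
apply/qproj_eq0/asboolP => S; apply; apply: Or44; exists 0, v, 0.
by rewrite !scale0r subr0.
Qed.

Lemma tensor_map_comp0 V W V' W' V'' W'' (f : {linear V -> V'})
    (g : {linear W -> W'}) (f' : {linear V' -> V''}) (g' : {linear W' -> W''}) t :
  (forall v w, tens (f' (f v)) (g' (g w)) = 0) ->
  tensor_map f' g' (tensor_map f g t) = 0.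
Proof.
move=> fg0; apply: (@tensor_ext _ _ _ (tensor_map f' g' \o tensor_map f g) \0).
by move=> v w; rewrite /= !tensor_map_tens fg0.
Qed.

Lemma tensor_map_swap V W V' W' (f : {linear V -> V'}) (g : {linear W -> W'}) t :
  tensor_map idfun g (tensor_map f idfun t) =
  tensor_map f idfun (tensor_map idfun g t).
Proof.
apply: (@tensor_ext _ _ _ (tensor_map idfun g \o tensor_map f idfun)
  (tensor_map f idfun \o tensor_map idfun g)).
by move=> v w; rewrite /= !tensor_map_tens.
Qed.

(* The homology at F1 (x) W of F2 (x) W -> F1 (x) W -> F0 (x) W, for the
   standard free resolution ... -> F2 -> F1 -> F0 -> V: F0 = K[V], and F_(i+1)
   is free on the underlying set of the preceding kernel. *)

Section Tor.
Variables V W : lmodType K.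

Definition res_aug : {linear {malg K[V]} -> V} := flift id.
Definition res_diff1 : {linear {malg K[submod (kern res_aug)]} -> {malg K[V]}} :=
  flift (@submod_val _ _).
Definition res_diff2 : {linear {malg K[submod (kern res_diff1)]} ->
                               {malg K[submod (kern res_aug)]}} :=
  flift (@submod_val _ _).

Definition Tor1 : lmodType K :=
  homology_at (tensor_map res_diff2 (idfun : {linear W -> W}))
              (tensor_map res_diff1 (idfun : {linear W -> W})).
End Tor.

(* The product of the family, which is its direct sum because I is only ever
   instantiated with the finite types of bidegrees. *)

Section DirectSum.
Variables (I : Type) (T : I -> lmodType K).

Definition dsum : Type := forall i, T i.
HB.instance Definition _ := gen_eqMixin dsum.
HB.instance Definition _ := gen_choiceMixin dsum.

Definition dsum0 : dsum := fun i => 0.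
Definition dsum_add (x y : dsum) : dsum := fun i => x i + y i.
Definition dsum_opp (x : dsum) : dsum := fun i => - x i.
Definition dsum_scale (a : K) (x : dsum) : dsum := fun i => a *: x i.

Fact dsum_addA : associative dsum_add.
Proof. by move=> x y z; apply: functional_extensionality_dep => i; exact: addrA. Qed.
Fact dsum_addC : commutative dsum_add.
Proof. by move=> x y; apply: functional_extensionality_dep => i; exact: addrC. Qed.
Fact dsum_add0 : left_id dsum0 dsum_add.
Proof. by move=> x; apply: functional_extensionality_dep => i; exact: add0r. Qed.
Fact dsum_addN : left_inverse dsum0 dsum_opp dsum_add.
Proof. by move=> x; apply: functional_extensionality_dep => i; exact: addNr. Qed.
HB.instance Definition _ :=
  GRing.isZmodule.Build dsum dsum_addA dsum_addC dsum_add0 dsum_addN.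

Fact dsum_scaleA a b x : dsum_scale a (dsum_scale b x) = dsum_scale (a * b) x.
Proof. by apply: functional_extensionality_dep => i; exact: scalerA. Qed.
Fact dsum_scale1 : left_id 1 dsum_scale.
Proof. by move=> x; apply: functional_extensionality_dep => i; exact: scale1r. Qed.
Fact dsum_scaleDr : right_distributive dsum_scale +%R.
Proof. by move=> a x y; apply: functional_extensionality_dep => i; exact: scalerDr. Qed.
Fact dsum_scaleDl x : {morph dsum_scale^~ x : a b / a + b}.
Proof. by move=> a b; apply: functional_extensionality_dep => i; exact: scalerDl. Qed.
HB.instance Definition _ := GRing.Zmodule_isLmodule.Build K dsum
  dsum_scaleA dsum_scale1 dsum_scaleDr dsum_scaleDl.

Lemma dsum_linE a (x y : dsum) i : (a *: x + y) i = a *: x i + y i.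
Proof. by []. Qed.
End DirectSum.

Definition short_exact U V W (f : {linear U -> V}) (g : {linear V -> W}) : Prop :=
  [/\ injective f, forall y, g y = 0 <-> exists x, f x = y
    & forall z, exists y, g y = z].

End Modules.

Arguments submod {K V} S.
Arguments quotmod {K V} S.

(* Pairs of naturals whose sum satisfies P. *)
Record bideg (P : pred nat) := Bideg {
  bi : nat; bj : nat; bidegP : P (bi + bj)%N }.

Lemma bideg_irrelevance (P : pred nat) (T : nat -> nat -> Type)
    (x : forall p : bideg P, T (bi p) (bj p)) i j (p q : P (i + j)%N) :
  x (Bideg p) = x (Bideg q) :> T i j.
Proof. by rewrite (bool_irrelevance p q). Qed.

Definition summing_to (n : nat) : pred nat := fun m => m == n.
(* i + j = n - 1, with no solution for n = 0 *)
Definition summing_to_pred (n : nat) : pred nat := fun m => m.+1 == n.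

Section Complexes.
Variable K : comNzRingType.

Record complex := Complex {
  obj :> nat -> lmodType K;
  diff : forall n, {linear obj n.+1 -> obj n};
  diffK : forall n x, diff n (diff n.+1 x) = 0 }.

(* The differential leaving degree n; it is zero for n = 0. *)
Definition dout (C : complex) (n : nat) : {linear C n -> C n.-1} :=
  match n return {linear C n -> C n.-1} with
  | 0 => \0
  | m.+1 => diff C m
  end.

Definition homology (C : complex) (n : nat) : lmodType K :=
  homology_at (diff C n) (dout C n).

Definition complex_iso (C D : complex) : Prop :=
  exists phi : forall n, {linear C n -> D n},
    (forall n, bijective (phi n)) /\
    (forall n x, phi n (diff C n x) = diff D n (phi n.+1 x)).

Section Subcomplex.
Variables (C : complex) (S : forall n, submodule (C n)).
Hypothesis Sdiff : forall n x, x \in S n.+1 -> diff C n x \in S n.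

Definition subdiff_fun n (x : submod (S n.+1)) : submod (S n) :=
  Submod (Sdiff (submodP x)).
Fact subdiff_is_linear n : linear (@subdiff_fun n).
Proof. by move=> a x y; apply: val_inj; rewrite /= linearP. Qed.
HB.instance Definition _ n := GRing.isLinear.Build K (submod (S n.+1))
  (submod (S n)) _ (@subdiff_fun n) (@subdiff_is_linear n).

Fact subdiffK n x : @subdiff_fun n (subdiff_fun x) = 0.
Proof. by apply: val_inj; rewrite /= diffK. Qed.

Definition subcomplex : complex :=
  @Complex (fun n => submod (S n)) (fun n => @subdiff_fun n) subdiffK.
End Subcomplex.

Section Omega.
Variables (C : complex) (D : forall n, submodule (C n)).

Definition omega_pred (n : nat) : {pred C n} :=
  match n return {pred C n} with
  | 0 => fun x => x \in D 0
  | m.+1 => fun x => (x \in D m.+1) && (diff C m x \in D m)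
  end.

Fact omega_closed n : submod_closed (@omega_pred n).
Proof.
case: n => [|n]; first exact: (submodule_closed (D 0)).
split=> [|a x y]; first by apply/andP; rewrite linear0 !rpred0.
move=> /andP[xD dxD] /andP[yD dyD]; apply/andP.
by rewrite linearP !rpredD ?rpredZ.
Qed.
Definition omega_sub n : submodule (C n) := Submodule (@omega_closed n).

Fact omega_diff n x : x \in omega_sub n.+1 -> diff C n x \in omega_sub n.
Proof.
case: n x => [|n] x /andP[_ dx]; first exact: dx.
by apply/andP; rewrite dx diffK rpred0.
Qed.

Definition omega : complex :=
  @subcomplex C omega_sub omega_diff.
End Omega.

Section TensorComplex.
Variables C D : complex.

Definition tensor_obj (n : nat) : lmodType K :=
  dsum (fun p : bideg (summing_to n) => tensor (C (bi p)) (D (bj p))).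

Definition bisl n (p : bideg (summing_to n)) : bideg (summing_to n.+1) :=
  @Bideg (summing_to n.+1) (bi p).+1 (bj p) (bidegP p).

Fact bisr_subproof n (p : bideg (summing_to n)) :
  summing_to n.+1 (bi p + (bj p).+1)%N.
Proof. by rewrite addnS; exact: (bidegP p). Qed.
Definition bisr n (p : bideg (summing_to n)) : bideg (summing_to n.+1) :=
  @Bideg (summing_to n.+1) (bi p) (bj p).+1 (bisr_subproof p).

(* The component of bidegree (i, j) of the differential gathers d (x) 1 from
   bidegree (i + 1, j) and (-1)^i (1 (x) d) from bidegree (i, j + 1). *)
Definition tensor_diff_fun n (z : tensor_obj n.+1) : tensor_obj n := fun p =>
  tensor_map (diff C (bi p)) idfun (z (bisl p)) +
  (-1) ^+ bi p *: tensor_map idfun (diff D (bj p)) (z (bisr p)).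

Fact tensor_diff_is_linear n : linear (@tensor_diff_fun n).
Proof.
move=> a x y; apply: functional_extensionality_dep => p.
rewrite /tensor_diff_fun !dsum_linE !linearP /= !scalerDr !scalerA.
by rewrite addrACA.
Qed.
HB.instance Definition _ n := GRing.isLinear.Build K (tensor_obj n.+1)
  (tensor_obj n) _ (@tensor_diff_fun n) (@tensor_diff_is_linear n).

Fact tensor_diffK n x : @tensor_diff_fun n (tensor_diff_fun x) = 0.
Proof.
apply: functional_extensionality_dep => p; rewrite /tensor_diff_fun.
have -> : x (bisr (bisl p)) = x (bisl (bisr p)) :>
    tensor (C (bi p).+1) (D (bj p).+1).
  exact: (bideg_irrelevance (T := fun i j => tensor (C i) (D j))).
rewrite [bi (bisl p)]/= [bi (bisr p)]/= [bj (bisl p)]/= [bj (bisr p)]/=.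
rewrite !linearD !linearZ /= ?scalerDr.
have dC v (w : D (bj p)) : tens (diff C _ (diff C (bi p).+1 v)) w = 0.
  by rewrite diffK tens0l.
have dD (v : C (bi p)) w : tens v (diff D _ (diff D (bj p).+1 w)) = 0.
  by rewrite diffK tens0r.
have /= -> := tensor_map_comp0 (g := idfun) (g' := idfun) (x (bisl (bisl p))) dC.
have /= -> := tensor_map_comp0 (f := idfun) (f' := idfun) (x (bisr (bisr p))) dD.
have /= -> := tensor_map_swap (diff C (bi p)) (diff D (bj p)) (x (bisl (bisr p))).
by rewrite !scaler0 addr0 add0r exprS mulN1r scaleNr addNr.
Qed.

Definition tensor_complex : complex :=
  @Complex tensor_obj (fun n => @tensor_diff_fun n) tensor_diffK.
End TensorComplex.

End Complexes.

(* Every argument of inord below is in range, so that inord never takes its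
   default value. *)

Definition simplicial_identities (X : nat -> Type)
    (d : forall n, 'I_n.+2 -> X n.+1 -> X n)
    (s : forall n, 'I_n.+1 -> X n -> X n.+1) : Prop :=
  [/\ forall n i j (x : X n.+2), (i <= j <= n.+1)%N ->
        d n (inord i) (d n.+1 (inord j.+1) x) =
        d n (inord j) (d n.+1 (inord i) x),
      forall n i j (x : X n.+1), (i <= j <= n)%N ->
        d n.+1 (inord i) (s n.+1 (inord j.+1) x) =
        s n (inord j) (d n (inord i) x),
      forall n j (x : X n), (j <= n)%N ->
        d n (inord j) (s n (inord j) x) = x /\
        d n (inord j.+1) (s n (inord j) x) = x,
      forall n i j (x : X n.+1), (j < i <= n.+1)%N ->
        d n.+1 (inord i.+1) (s n.+1 (inord j) x) =
        s n (inord j) (d n (inord i) x)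
    & forall n i j (x : X n), (i <= j <= n)%N ->
        s n.+1 (inord i) (s n (inord j) x) =
        s n.+1 (inord j.+1) (s n (inord i) x)].

Record sset := SSet {
  simp :> nat -> choiceType;
  sface : forall n, 'I_n.+2 -> simp n.+1 -> simp n;
  sdegen : forall n, 'I_n.+1 -> simp n -> simp n.+1;
  sset_identities : simplicial_identities sface sdegen }.

Section SimplicialModules.
Context {K : comNzRingType}.

Record smodule := SModule {
  smod :> nat -> lmodType K;
  mface : forall n, 'I_n.+2 -> {linear smod n.+1 -> smod n};
  mdegen : forall n, 'I_n.+1 -> {linear smod n -> smod n.+1};
  smodule_identities : simplicial_identities mface mdegen }.

Arguments mface {s n} i.
Arguments mdegen {s n} i.

Section FreeSimplicialModule.
Variable X : sset.

Definition free_face n (i : 'I_n.+2) :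
  {linear {malg K[X n.+1]} -> {malg K[X n]}} := fmapf (@sface X n i).
Definition free_degen n (i : 'I_n.+1) :
  {linear {malg K[X n]} -> {malg K[X n.+1]}} := fmapf (@sdegen X n i).

Fact free_identities : simplicial_identities free_face free_degen.
Proof.
have [dd ds1 ds2 ds3 ss] := sset_identities X.
have ext m n (f g : {linear {malg K[X m]} -> {malg K[X n]}}) a :
  (forall x, f << x >> = g << x >>) -> f a = g a by move=> /free_ext.
split.
- move=> n i j a le_ij.
  apply: (ext _ _ (free_face (inord i) \o free_face (inord j.+1))
                  (free_face (inord j) \o free_face (inord i))) => x.
  by rewrite /= !fmapfU dd.
- move=> n i j a le_ij.
  apply: (ext _ _ (free_face (inord i) \o free_degen (inord j.+1))
                  (free_degen (inord j) \o free_face (inord i))) => x.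
  by rewrite /= !fmapfU ds1.
- move=> n j a le_jn; split.
    apply: (ext _ _ (free_face (inord j) \o free_degen (inord j)) idfun) => x.
    by rewrite /= !fmapfU; case: (ds2 n j x le_jn) => ->.
  apply: (ext _ _ (free_face (inord j.+1) \o free_degen (inord j)) idfun) => x.
  by rewrite /= !fmapfU; case: (ds2 n j x le_jn) => _ ->.
- move=> n i j a le_ij.
  apply: (ext _ _ (free_face (inord i.+1) \o free_degen (inord j))
                  (free_degen (inord j) \o free_face (inord i))) => x.
  by rewrite /= !fmapfU ds3.
- move=> n i j a le_ij.
  apply: (ext _ _ (free_degen (inord i) \o free_degen (inord j))
                  (free_degen (inord j.+1) \o free_degen (inord i))) => x.
  by rewrite /= !fmapfU ss.
Qed.

Definition free_smodule : smodule := SModule free_identities.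
End FreeSimplicialModule.

Section Moore.
Variable A : smodule.

Definition unnorm_diff_fun n (a : A n.+1) : A n :=
  \sum_(i < n.+2) (-1) ^+ i *: mface i a.
Fact unnorm_diff_is_linear n : linear (@unnorm_diff_fun n).
Proof.
move=> c a b; rewrite /unnorm_diff_fun scaler_sumr -big_split.
apply: eq_bigr => i _ /=.
by rewrite linearP scalerDr !scalerA mulrC.
Qed.
HB.instance Definition _ n := GRing.isLinear.Build K (A n.+1) (A n) _
  (@unnorm_diff_fun n) (@unnorm_diff_is_linear n).

Fact unnorm_diffK n a : @unnorm_diff_fun n (unnorm_diff_fun a) = 0.
Proof.
have [dd _ _ _ _] := smodule_identities A.
pose F i j := (-1) ^+ (i + j) *: mface (inord i : 'I_n.+2) (mface (inord j : 'I_n.+3) a).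
have -> : unnorm_diff_fun (unnorm_diff_fun a) =
    \sum_(0 <= i < n.+2) \sum_(0 <= j < n.+3) F i j.
  rewrite big_mkord; apply: eq_bigr => i _.
  rewrite big_mkord linear_sum scaler_sumr; apply: eq_bigr => j _.
  by rewrite linearZ scalerA /= -exprD /F !inord_val.
have -> : \sum_(0 <= i < n.+2) \sum_(0 <= j < n.+3) F i j =
    \sum_(0 <= i < n.+2) (\sum_(0 <= j < i.+1) F i j +
                          \sum_(i <= j < n.+2) F i j.+1).
  apply: eq_big_nat => i /andP[_ lt_i].
  rewrite (big_cat_nat (n := i.+1)) //=; last by apply: leq_trans lt_i _.
  by rewrite big_add1.
rewrite big_split /= [X in _ + X](_ : _ =
   \sum_(0 <= j < n.+2) \sum_(0 <= i < j.+1) F i j.+1); last first.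
  under eq_bigr do rewrite (big_nat_widenl _ 0) //= big_mkcond.
  rewrite exchange_big_nat; apply: eq_big_nat => j /andP[_ lt_j] /=.
  by rewrite -big_mkcond [RHS](big_nat_widen _ _ n.+2).
rewrite -big_split big_nat big1 // => i /andP[_ lt_i].
rewrite -big_split big_nat big1 // => j /andP[_ lt_j].
have le_ji : (j <= i <= n.+1)%N by rewrite -ltnS lt_j -ltnS.
by rewrite /F /= (dd _ _ _ _ le_ji) addnS exprS mulN1r scaleNr [(j + i)%N]addnC subrr.
Qed.

Definition unnorm : complex K :=
  @Complex K A (fun n => @unnorm_diff_fun n) unnorm_diffK.

Definition moore_pred (n : nat) : {pred A n} :=
  match n return {pred A n} with
  | 0 => predT
  | m.+1 => fun a => [forall i : 'I_m.+2, (i != ord0) ==> (mface i a == 0)]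
  end.
Fact moore_closed n : submod_closed (@moore_pred n).
Proof.
case: n => [|n]; first by split.
split=> [|c a b]; first by apply/forallP => i; rewrite linear0 eqxx implybT.
move=> /forallP aN /forallP bN; apply/forallP => i; apply/implyP => i0.
rewrite linearP; move: (aN i) (bN i); rewrite i0 /= => /eqP -> /eqP ->.
by rewrite scaler0 addr0.
Qed.
Definition moore_sub n : submodule (unnorm n) := Submodule (@moore_closed n).

Fact moore_diff n a :
  a \in moore_sub n.+1 -> diff unnorm n a \in moore_sub n.
Proof.
case: n a => [//|n] a /forallP aN; apply/forallP => i; apply/implyP => i0.
have [dd _ _ _ _] := smodule_identities A.
have d0 j : j != ord0 -> mface j a = 0.
  by move=> j0; apply/eqP/(implyP (aN j)).
have -> : diff unnorm n.+1 a = mface ord0 a.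
  rewrite [LHS]/= /unnorm_diff_fun big_ord_recl expr0 scale1r big1 ?addr0 //.
  by move=> j _; rewrite d0 ?scaler0.
have := dd n 0 i a; rewrite leq0n -ltnS ltn_ord inord_val => /(_ isT) /esym.
have -> : inord 0 = ord0 :> 'I_n.+3 by apply: val_inj; rewrite /= inordK.
by move=> ->; rewrite d0 ?linear0 // -val_eqE /= inordK // ltnS ltn_ord.
Qed.

Definition moore : complex K := subcomplex moore_diff.

Definition degenerate_pred (n : nat) : {pred A n} :=
  match n return {pred A n} with
  | 0 => fun a => a == 0
  | m.+1 => fun a =>
      `[< exists b : 'I_m.+1 -> A m, a = \sum_(i < m.+1) mdegen i (b i) >]
  end.
Fact degenerate_closed n : submod_closed (@degenerate_pred n).
Proof.
case: n => [|n].
  split=> [|c a b]; first exact/eqP.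
  by move=> /eqP -> /eqP ->; apply/eqP; rewrite scaler0 addr0.
split=> [|c a b].
  by apply/asboolP; exists (fun=> 0); rewrite big1 // => i _; rewrite linear0.
move=> /asboolP[u ->] /asboolP[v ->]; apply/asboolP.
exists (fun i => c *: u i + v i); rewrite scaler_sumr -big_split.
by apply: eq_bigr => i _; rewrite linearP.
Qed.
Definition degenerate n : submodule (A n) := Submodule (@degenerate_closed n).

(* rho : A n -> N_n A is the projection along D_n A for the decomposition
   A n = N_n A (+) D_n A; this is its graph. *)
Definition moore_proj_graph n (b : A n) (z : moore n) : Prop :=
  b - submod_val z \in degenerate n.

Section Image.
Variables (n : nat) (B : submodule (A n)).

Definition moore_image_pred : {pred moore n} :=
  fun z => `[< exists b, b \in B /\ moore_proj_graph b z >].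
Fact moore_image_closed : submod_closed moore_image_pred.
Proof.
split=> [|c y z].
  by apply/asboolP; exists 0; split; rewrite ?rpred0 // /moore_proj_graph subr0 rpred0.
move=> /asboolP[u [uB uy]] /asboolP[v [vB vz]]; apply/asboolP.
exists (c *: u + v); split; first by rewrite rpredD ?rpredZ.
rewrite /moore_proj_graph.
have -> : c *: u + v - submod_val (c *: y + z) =
    c *: (u - submod_val y) + (v - submod_val z).
  by rewrite scalerBr addrACA -opprD.
by rewrite rpredD ?rpredZ.
Qed.
Definition moore_image : submodule (moore n) := Submodule moore_image_closed.
End Image.

End Moore.

Section FreeSubset.
Variables (X : choiceType) (Y : set X).

Definition free_on_pred : {pred {malg K[X]}} :=
  fun a => `[< forall x, x \in msupp a -> Y x >].
Fact free_on_closed : submod_closed free_on_pred.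
Proof.
split=> [|c a b]; first by apply/asboolP => x; rewrite msupp0 in_fset0.
move=> /asboolP aY /asboolP bY; apply/asboolP => x.
move=> /(fsubsetP (msuppD_le _ _)); rewrite in_fsetU => /orP[|/bY//].
by move=> /(fsubsetP (msuppZ_le _ _)) /aY.
Qed.
Definition free_on : submodule {malg K[X]} := Submodule free_on_closed.
End FreeSubset.

End SimplicialModules.

Arguments smodule K : clear implicits.
Arguments free_smodule K X : clear implicits.
Arguments free_on K {X} Y.

Record path_pair := PathPair {
  pp_sset :> sset;
  pp_sub : forall n, set (pp_sset n);
  pp_degen : forall n (i : 'I_n.+1) x, pp_sub x -> pp_sub (sdegen i x);
  pp_face0 : forall n (x : pp_sset n.+1), pp_sub x -> pp_sub (sface ord0 x);
  pp_face_max : forall n (x : pp_sset n.+1),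
    pp_sub x -> pp_sub (sface ord_max x) }.

Definition Omega (K : comNzRingType) (S : path_pair) : complex K :=
  omega (C := moore (free_smodule K S))
    (fun n => moore_image (A := free_smodule K S) (free_on K (@pp_sub S n))).

Definition Hpp (K : comNzRingType) (S : path_pair) (n : nat) : lmodType K :=
  homology (Omega K S) n.

Section ProductSset.
Variables X X' : sset.

Definition prod_face n (i : 'I_n.+2) (x : (X n.+1 * X' n.+1)%type) :
  (X n * X' n)%type := (sface i x.1, sface i x.2).
Definition prod_degen n (i : 'I_n.+1) (x : (X n * X' n)%type) :
  (X n.+1 * X' n.+1)%type := (sdegen i x.1, sdegen i x.2).

Fact prod_identities : @simplicial_identities
  (fun n => (X n * X' n)%type) prod_face prod_degen.
Proof.
have [dd ds1 ds2 ds3 ss] := sset_identities X.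
have [dd' ds1' ds2' ds3' ss'] := sset_identities X'.
split.
- by move=> n i j x le_ij; congr pair; [apply: dd | apply: dd'].
- by move=> n i j x le_ij; congr pair; [apply: ds1 | apply: ds1'].
- move=> n j [x x'] le_jn.
  have [e1 e2] := ds2 n j x le_jn; have [e1' e2'] := ds2' n j x' le_jn.
  by split; congr pair.
- by move=> n i j x le_ij; congr pair; [apply: ds3 | apply: ds3'].
- by move=> n i j x le_ij; congr pair; [apply: ss | apply: ss'].
Qed.

Definition prod_sset : sset :=
  @SSet (fun n => (X n * X' n)%type) prod_face prod_degen prod_identities.
End ProductSset.

Definition shuffle (k l : nat) (mu nu : seq nat) : Prop :=
  [/\ size mu = k, size nu = l, sorted ltn mu, sorted ltn nu
    & mu ++ nu =i iota 0 (k + l)].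

Lemma shuffleC k l mu nu : shuffle k l mu nu -> shuffle l k nu mu.
Proof.
move=> [szm szn smu snu e]; split=> // m.
by rewrite mem_cat orbC -mem_cat e addnC.
Qed.

(* Iterated degeneracies act on {n & X n}, which avoids casts between
   X (k + l) and X (l + k). *)
Section Words.
Variable X : sset.
Implicit Types (x : {n : nat & X n}) (nu : seq nat).

Definition tdegen (i : nat) x : {n : nat & X n} :=
  Tagged (fun n => X n) (sdegen (inord i) (tagged x)).

(* The head nu_0 of nu is applied first. *)
Definition degen_word nu x : {n : nat & X n} := foldl (fun y i => tdegen i y) x nu.

Definition tface (i : nat) x : {n : nat & X n} :=
  match x with
  | existT n.+1 y => Tagged (fun n => X n) (sface (inord i) y)
  | existT 0 y => existT _ 0 y
  end.

Lemma tag_word nu x : tag (degen_word nu x) = (tag x + size nu)%N.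
Proof.
by elim: nu x => [|m nu IH] x /=; rewrite ?addn0 // IH addnS.
Qed.

Lemma degen_word_rcons nu m x :
  degen_word (rcons nu m) x = tdegen m (degen_word nu x).
Proof. by rewrite /degen_word foldl_rcons. Qed.

Lemma tdegenC i j x : (i <= j <= tag x)%N ->
  tdegen i (tdegen j x) = tdegen j.+1 (tdegen i x).
Proof.
case: x => n x /= le_ij; rewrite /tdegen /=; have [_ _ _ _ ss] := sset_identities X.
by rewrite ss.
Qed.

Lemma tface_degen_lt i j x : (i <= j)%N -> (j.+1 <= tag x)%N ->
  tface i (tdegen j.+1 x) = tdegen j (tface i x).
Proof.
case: x => [[|n] x] //= le_ij le_jn; rewrite /tdegen /=.
have [_ ds _ _ _] := sset_identities X.
by rewrite ds ?le_ij.
Qed.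

Lemma tface_degen_eq j x : (j <= tag x)%N -> tface j (tdegen j x) = x.
Proof.
case: x => n x /= le_jn; have [_ _ ds _ _] := sset_identities X.
by rewrite /= (ds n j x le_jn).1.
Qed.

Lemma tface_degen_eqS j x : (j <= tag x)%N -> tface j.+1 (tdegen j x) = x.
Proof.
case: x => n x /= le_jn; have [_ _ ds _ _] := sset_identities X.
by rewrite /= (ds n j x le_jn).2.
Qed.

Lemma tface_degen_gt i j x : (j < i <= tag x)%N ->
  tface i.+1 (tdegen j x) = tdegen j (tface i x).
Proof.
case: x => [[|n] x] /= /andP[lt_ji le_in]; first by case: i lt_ji le_in.
rewrite /tdegen /=; have [_ _ _ ds _] := sset_identities X.
by rewrite ds ?lt_ji.
Qed.

Lemma sorted_rcons_ltn nu m :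
  sorted ltn (rcons nu m) = sorted ltn nu && all (fun i => i < m)%N nu.
Proof.
rewrite !(sorted_pairwise ltn_trans) pairwise_rcons.
by rewrite /allrel andbC; congr andb; apply: eq_all => i /=; rewrite andbT.
Qed.

Definition word_ok k nu := sorted ltn nu /\ all (fun m => m < k + size nu)%N nu.

Lemma word_ok_rcons k nu m : word_ok k (rcons nu m) ->
  [/\ word_ok k nu, all (fun i => i < m)%N nu & (m <= k + size nu)%N].
Proof.
move=> [+ +]; rewrite sorted_rcons_ltn size_rcons all_rcons.
move=> /andP[snu lt_m] /andP[le_m _]; rewrite addnS ltnS in le_m; split=> //.
split=> //; apply/allP => i /(allP lt_m) lt_i; exact: leq_trans lt_i le_m.
Qed.

Lemma bump_lt i m : (m < i)%N -> bump i m = m.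
Proof. by move=> lt_mi; rewrite /bump leqNgt lt_mi. Qed.

Lemma degen_word_shift i nu x : word_ok (tag x) nu -> (i <= tag x + size nu)%N ->
  exists2 a, (a <= tag x)%N &
    tdegen i (degen_word nu x) = degen_word (map (bump i) nu) (tdegen a x).
Proof.
elim/last_ind: nu i => [|nu m IH] i; first by rewrite addn0 => _; exists i.
move=> /word_ok_rcons[ok_nu lt_m le_m]; rewrite size_rcons addnS => le_i.
rewrite map_rcons degen_word_rcons.
have [lt_mi|le_im] := ltnP m i.
  case: i lt_mi le_i => // i lt_mi le_i.
  have [a le_a e] := IH i ok_nu le_i; exists a => //.
  rewrite -tdegenC; last by rewrite tag_word -ltnS lt_mi.
  rewrite e degen_word_rcons; congr tdegen.
    by rewrite bump_lt.
  congr degen_word; apply/eq_in_map => j /(allP lt_m) lt_j.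
  have lt_ji : (j < i)%N by exact: leq_trans lt_j lt_mi.
  by rewrite !bump_lt // ltnW.
have [|a le_a e] := IH i ok_nu; first exact: leq_trans le_im le_m.
exists a => //; rewrite tdegenC; last by rewrite tag_word le_im.
by rewrite e degen_word_rcons /bump le_im add1n.
Qed.

Definition word_insert i nu :=
  [seq m <- nu | (m < i)%N] ++ i :: [seq m.+1 | m <- nu & (i <= m)%N].

Lemma degen_word_insert i nu x : word_ok (tag x) nu -> (i <= tag x + size nu)%N ->
  tdegen i (degen_word nu x) = degen_word (word_insert i nu) x.
Proof.
elim/last_ind: nu => [|nu m IH] // /word_ok_rcons[ok_nu lt_m le_m].
rewrite size_rcons addnS => le_i.
have [lt_mi|le_im] := ltnP m i.
  have lt_i j : j \in rcons nu m -> (j < i)%N.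
    by rewrite mem_rcons inE => /orP[/eqP->//|/(allP lt_m)/ltn_trans]; apply.
  rewrite /word_insert (all_filterP _); last exact/allP.
  rewrite (@eq_in_filter _ _ pred0) ?filter_pred0 /=; last first.
    by move=> j /lt_i; rewrite ltnNge => /negbTE.
  by rewrite cats1 [in RHS]degen_word_rcons.
rewrite degen_word_rcons tdegenC; last by rewrite tag_word le_im.
rewrite IH //; last exact: leq_trans le_im le_m.
rewrite /word_insert !filter_rcons ltnNge le_im /= map_rcons -!rcons_cons.
by rewrite -rcons_cat degen_word_rcons.
Qed.

Lemma face0_word nu x : word_ok (tag x) nu -> (0 < tag x)%N ->
  all (leq 1) nu ->
  tface 0 (degen_word nu x) = degen_word (map predn nu) (tface 0 x).
Proof.
move=> + x_gt0; elim/last_ind: nu => [|nu m IH] //.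
move=> /word_ok_rcons[ok_nu lt_m le_m]; rewrite all_rcons => /andP[m_gt0 nu_gt0].
rewrite map_rcons !degen_word_rcons -IH //.
case: m m_gt0 le_m {lt_m} => // m _ le_m.
by rewrite tface_degen_lt ?tag_word.
Qed.

Lemma face0_tail nu x : word_ok (tag x) (0 :: nu) -> all (leq 1) nu ->
  tface 0 (degen_word (0 :: nu) x) = degen_word (map predn nu) x.
Proof.
move=> [snu le_nu] nu_gt0; rewrite /= face0_word //; last split.
- by rewrite tface_degen_eq.
- exact: path_sorted snu.
- by case/andP: le_nu => _; rewrite /= addnS.
Qed.

Lemma face_max_word nu x : (0 < tag x)%N -> word_ok (tag x).-1 nu ->
  tface (tag x + size nu) (degen_word nu x) = degen_word nu (tface (tag x) x).
Proof.
move=> x_gt0; elim/last_ind: nu => [|nu m IH]; first by rewrite addn0.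
move=> /word_ok_rcons[ok_nu lt_m le_m].
rewrite size_rcons !degen_word_rcons -IH // addnS tface_degen_gt //.
by rewrite tag_word leqnn andbT; move: x_gt0 le_m; case: (tag x).
Qed.

End Words.

Lemma shuffle_ok k l mu nu : shuffle k l mu nu -> word_ok l mu /\ word_ok k nu.
Proof.
move=> [szm szn smu snu e]; rewrite /word_ok szm szn [(l + k)%N]addnC.
by split; split=> //; apply/allP => m m_in; have := e m;
  rewrite mem_cat m_in ?orbT mem_iota => /esym/andP[].
Qed.

Lemma shuffle_disjoint k l mu nu m :
  shuffle k l mu nu -> m \in mu -> m \notin nu.
Proof.
move=> [szm szn smu snu e] m_mu; apply/negP => m_nu.
have : uniq (mu ++ nu).
  apply: (leq_size_uniq (iota_uniq 0 (k + l))) => [i|]; first by rewrite e.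
  by rewrite size_cat size_iota szm szn.
by rewrite cat_uniq => /and3P[_ /hasPn/(_ m m_nu)/negP[]].
Qed.

Lemma mem_word_insert i nu m :
  (m \in word_insert i nu) = (m == i) || (m \in map (bump i) nu).
Proof.
rewrite mem_cat inE mem_filter orbCA; congr orb.
apply/orP/mapP => [[/andP[lt_mi m_nu]|/mapP[j]]|[j j_nu ->]].
- by exists m; rewrite // bump_lt.
- by rewrite mem_filter => /andP[le_ij j_nu] ->; exists j; rewrite // /bump le_ij.
- have [lt_ji|le_ij] := ltnP j i; first by left; rewrite bump_lt ?lt_ji.
  by right; rewrite /bump le_ij add1n map_f // mem_filter le_ij.
Qed.

Lemma shuffle_insert k l mu nu i : (i <= k + l)%N -> shuffle k l mu nu ->
  shuffle k.+1 l (word_insert i mu) (map (bump i) nu).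
Proof.
move=> le_i [szm szn smu snu e]; split.
- rewrite size_cat /= size_map addnS !size_filter -szm.
  rewrite -(count_predC (fun m => m < i)%N mu); congr (_ + _).+1.
  by apply: eq_count => m /=; rewrite -leqNgt.
- by rewrite size_map.
- move: smu; rewrite /word_insert !(sorted_pairwise ltn_trans) => smu.
  rewrite pairwise_cat /= (pairwise_filter _ smu) /=; apply/and3P; split.
  + apply/allrelP => a b; rewrite mem_filter inE => /andP[lt_ai _].
    move=> /orP[/eqP->//|/mapP[j]]; rewrite mem_filter => /andP[le_ij _] ->.
    exact: leq_trans lt_ai (leqW le_ij).
  + by apply/allP => b /mapP[j]; rewrite mem_filter => /andP[le_ij _] ->.
  + rewrite pairwise_map (@sub_pairwise _ ltn) ?pairwise_filter // => a b /=.
- apply: homo_sorted snu => a b /=; rewrite /bump; lia.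
- move=> m; rewrite mem_cat mem_word_insert -orbA -mem_cat -map_cat mem_iota.
  have [->|m_i] := eqVneq m i; first by rewrite /= add0n addSn ltnS le_i.
  rewrite /= -{1}[m](@unbumpK i) ?inE // (mem_map (can_inj (bumpK i))) e mem_iota.
  by rewrite /unbump; lia.
Qed.

Lemma shuffle_head k l mu nu : shuffle k l mu nu -> 0 \in mu ->
  exists k0 mu1, [/\ k = k0.+1, mu = 0 :: mu1, all (leq 1) mu1, all (leq 1) nu
    & shuffle k0 l (map predn mu1) (map predn nu)].
Proof.
move=> sh mu0; have nu0 := shuffle_disjoint sh mu0.
case: sh => szm szn smu snu e.
case: mu szm smu e mu0 => [//|m mu1] szm smu e mu0.
have lt_m := order_path_min ltn_trans smu.
have m0 : m = 0%N.
  by move: mu0; rewrite inE => /orP[/eqP//|/(allP lt_m)].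
subst m; case: k szm e => // k [szm] e; exists k, mu1.
have nu_gt0 : all (leq 1) nu.
  by apply/allP => -[|j] // j_nu; rewrite j_nu in nu0.
have sp s : all (leq 1) s -> sorted ltn s -> sorted ltn (map predn s).
  move=> s_gt0 ss; rewrite sorted_map; apply: (sub_in_sorted _ s_gt0 ss).
  by move=> [|a] [|b].
split=> //; split; rewrite ?size_map //.
- exact/sp/(path_sorted smu).
- exact: sp.
- move=> i; rewrite -map_cat; rewrite mem_iota /= add0n.
  have := e i.+1; rewrite mem_iota add0n addSn ltnS /= inE /=.
  move=> <-.
  have gt0 : all (leq 1) (mu1 ++ nu) by rewrite all_cat lt_m.
  apply/mapP/idP => [[j j_s ->]|i_s]; last by exists i.+1.
  by rewrite prednK // (allP gt0).
Qed.

Lemma shuffle_last k l mu nu n : shuffle k l mu nu -> (k + l)%N = n.+1 ->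
  n \in mu -> exists k0 mu1, [/\ k = k0.+1, mu = rcons mu1 n & shuffle k0 l mu1 nu].
Proof.
move=> sh kl mun; have nun := shuffle_disjoint sh mun.
case: sh => szm szn smu snu e.
case/lastP: mu szm smu e mun => [//|mu1 m] szm smu e mun.
move: szm; rewrite size_rcons => szm; case: k szm e kl => // k [szm] e [kl].
move: smu; rewrite sorted_rcons_ltn => /andP[smu lt_m].
have le_mn i : i \in rcons mu1 m ++ nu -> (i <= n)%N.
  by rewrite e mem_iota add0n addSn kl ltnS.
have mn : m = n.
  move: mun; rewrite mem_rcons inE => /orP[/eqP//|/(allP lt_m) lt_nm].
  have := le_mn m; rewrite mem_cat mem_rcons inE eqxx => /(_ isT).
  by rewrite leqNgt lt_nm.
subst m; exists k, mu1; split=> //; split=> // i.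
have := e i; rewrite !mem_cat mem_rcons inE !mem_iota !add0n addSn kl ltnS (leq_eqVlt i n).
have [->|//] := eqVneq i n.
rewrite (negbTE nun) ltnn orbF => _; apply: contraFF (ltnn n) => n_mu1.
by move: n_mu1; rewrite orbF => /(allP lt_m).
Qed.

Section Box.
Variables S S' : path_pair.

Definition box_sub n : set (prod_sset S S' n) := fun x =>
  exists k l (mu nu : seq nat) (y : S k) (y' : S' l),
    [/\ (k + l = n)%N, shuffle k l mu nu, pp_sub y /\ pp_sub y',
        Tagged (fun n => S n) x.1 = degen_word nu (Tagged (fun n => S n) y)
      & Tagged (fun n => S' n) x.2 = degen_word mu (Tagged (fun n => S' n) y')].

Fact box_degen n (i : 'I_n.+1) (x : prod_sset S S' n) :
  box_sub x -> box_sub (sdegen i x).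
Proof.
move=> [k [l [mu [nu [y [y' [kl sh [Yy Yy'] ex ex']]]]]]].
have [ok_mu ok_nu] := shuffle_ok sh; have [szm szn _ _ _] := sh.
have le_i : (i <= k + l)%N by rewrite kl -ltnS.
have [||a le_a ea] := @degen_word_shift S i nu (Tagged (fun n => S n) y) => //=.
  by rewrite szn.
exists k.+1, l, (word_insert i mu), (map (bump i) nu),
  (sdegen (inord a) y), y'; split.
- by rewrite addSn kl.
- exact: shuffle_insert.
- by split=> //; exact: pp_degen.
- by rewrite -[RHS]ea -ex /tdegen /= inord_val.
- rewrite -degen_word_insert //= ?szm 1?addnC // -ex'.
  by rewrite /tdegen /= inord_val.
Qed.

Let inord0 n : inord 0 = ord0 :> 'I_n.+1.
Proof. by apply: val_inj; rewrite /= inordK. Qed.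
Let inord_last n : inord n = ord_max :> 'I_n.+1.
Proof. by apply: val_inj; rewrite /= inordK. Qed.

Fact box_face0 n (x : prod_sset S S' n.+1) : box_sub x -> box_sub (sface ord0 x).
Proof.
move=> [k [l [mu [nu [y [y' [kl sh [Yy Yy'] ex ex']]]]]]].
have [ok_mu ok_nu] := shuffle_ok sh.
have ef : Tagged (fun n => S n) (sface ord0 x.1) =
    tface 0 (Tagged (fun n => S n) x.1) by rewrite /= inord0.
have ef' : Tagged (fun n => S' n) (sface ord0 x.2) =
    tface 0 (Tagged (fun n => S' n) x.2) by rewrite /= inord0.
have [_ _ _ _ e] := sh; have : 0 \in mu ++ nu by rewrite e kl.
rewrite mem_cat => /orP[mu0|nu0].
  have [k0 [mu1 [? ? mu1_gt0 nu_gt0 sh0]]] := shuffle_head sh mu0; subst k mu.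
  exists k0, l, (map predn mu1), (map predn nu), (sface ord0 y), y'; split=> //.
  - by case: kl.
  - by split=> //; exact: pp_face0.
  - by rewrite [LHS]ef ex face0_word //= inord0.
  - rewrite [LHS]ef' ex' face0_tail //.
have [l0 [nu1 [? ? nu1_gt0 mu_gt0 sh0]]] := shuffle_head (shuffleC sh) nu0.
subst l nu.
exists k, l0, (map predn mu), (map predn nu1), y, (sface ord0 y'); split=> //.
- by move: kl; rewrite addnS => -[].
- exact: shuffleC.
- by split=> //; exact: pp_face0.
- rewrite [LHS]ef ex face0_tail //.
- by rewrite [LHS]ef' ex' face0_word //= inord0.
Qed.

Fact box_face_max n (x : prod_sset S S' n.+1) :
  box_sub x -> box_sub (sface ord_max x).
Proof.
move=> [k [l [mu [nu [y [y' [kl sh [Yy Yy'] ex ex']]]]]]].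
have [ok_mu ok_nu] := shuffle_ok sh; have [_ _ _ _ e] := sh.
have ef : Tagged (fun n => S n) (sface ord_max x.1) =
    tface n.+1 (Tagged (fun n => S n) x.1) by rewrite /= inord_last.
have ef' : Tagged (fun n => S' n) (sface ord_max x.2) =
    tface n.+1 (Tagged (fun n => S' n) x.2) by rewrite /= inord_last.
have : n \in mu ++ nu by rewrite e kl mem_iota /=.
rewrite mem_cat => /orP[mun|nun].
  have [k0 [mu1 [? ? sh0]]] := shuffle_last sh kl mun; subst k mu.
  have [ok_mu1 ok_nu0] := shuffle_ok sh0; have [szm1 szn _ _ _] := sh0.
  have kl0 : (k0 + l)%N = n by case: kl.
  exists k0, l, mu1, nu, (sface ord_max y), y'; split=> //.
  - by split=> //; exact: pp_face_max.
  - rewrite [LHS]ef ex -kl -{1}szn.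
    by rewrite (@face_max_word S nu (Tagged (fun n => S n) y)) //= inord_last.
  - rewrite [LHS]ef' ex' degen_word_rcons tface_degen_eqS // tag_word /=.
    by rewrite szm1 addnC kl0.
have kl' : (l + k)%N = n.+1 by rewrite addnC.
have [l0 [nu1 [? ? sh0]]] := shuffle_last (shuffleC sh) kl' nun; subst l nu.
have [ok_nu1 ok_mu0] := shuffle_ok sh0; have [szn1 szm _ _ _] := sh0.
have kl0 : (l0 + k)%N = n by case: kl'.
exists k, l0, mu, nu1, y, (sface ord_max y'); split=> //.
- by rewrite addnC.
- exact: shuffleC.
- by split=> //; exact: pp_face_max.
- rewrite [LHS]ef ex degen_word_rcons tface_degen_eqS // tag_word /=.
  by rewrite szn1 addnC kl0.
- rewrite [LHS]ef' ex' -kl' -{1}szm.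
  by rewrite (@face_max_word S' mu (Tagged (fun n => S' n) y')) //= inord_last.
Qed.

Definition box : path_pair := PathPair box_degen box_face0 box_face_max.

End Box.

(* Main.v *)
(* The isomorphism is the shuffle map nabla(a (x) b) = sum +-s_nu a x s_mu b. In a
   pair (s_nu y, s_mu y') with y and y' nondegenerate, exactly one component is
   degenerate in each direction; hence the pair determines the shuffle and (y, y'),
   and the coefficient of nabla c at it is +-c(y, y'). This gives injectivity, and
   shows that nabla maps into Omega(S [] S').

   Conversely let u be in Omega(S [] S'). Modulo degenerate pairs it is supported
   on pairs (s_nu y, s_mu y'). Two shuffles which differ by a transposition of
   adjacent letters yield pairs with a common inner face, both components of which
   are nondegenerate in the same direction; such a face occurs in no other pair of
   the support, and it cannot occur in the boundary d_0 u of u. So the coefficients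
   of u are alternating in the shuffle, and u = nabla c for a Moore chain c. Reading
   d_0 u = nabla (d c) in the same way shows that all the rows and the columns of c
   are in Omega S' and Omega S. Over a principal ideal domain Omega S is free, being
   a submodule of a free module, and Omega S' is cut out by linear functionals;
   therefore such a c is in Omega S (x) Omega S'.

   The exact sequence is then the Kunneth formula for complexes of free modules. *)

From HB Require Import structures.
From mathcomp Require Import all_boot all_algebra finmap zify.
From mathcomp Require Import boolp classical_sets wochoice.
From mathcomp.multinomials Require Import monalg.
Require Import Defs.

Set Implicit Arguments.
Unset Strict Implicit.
Unset Printing Implicit Defensive.

Import GRing.Theory.
Local Open Scope ring_scope.

(** * Modules over a principal ideal domain *)

(** That K is a principal ideal domain enters through [proj_of_inj], which makes the submodules of
    free modules that occur below projective. A section of K[V] -> V then does the work of a basis,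
    both in the analysis of Omega S (x) Omega S' and in the Kunneth formula. Degrees shape the rest.
    Faces, degeneracies and shuffles of all degrees act on a single module, K[tot S] or
    K[tot S x tot S'], in which the chains of a given degree form a submodule; chains of degrees k +
    l and l + k are compared without casts. Degenerate simplices can be ignored for two reasons. A
    chain and its image under rho have the same coefficients at nondegenerate simplices, so these
    coefficients decide membership in Omega; and a Moore chain that vanishes at all nondegenerate
    simplices is zero ([moore_degenerate0]). Hence u = nabla c is obtained by matching coefficients
    at nondegenerate pairs and then projecting c to Moore chains, which alters none of them. *)

Section FreeModules.
Context {K : comNzRingType}.

Lemma malg_sum (X : choiceType) (a : {malg K[X]}) :
  a = \sum_(x <- msupp a) a@_x *: << x >>.
Proof.
rewrite [LHS]monalgE; apply: eq_bigr => x _; apply/malgP => y.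
by rewrite mcoeffZ !mcoeffU mulrnAr mulr1.
Qed.

Lemma msupp_fset0 (X : choiceType) (a : {malg K[X]}) : msupp a = fset0 -> a = 0.
Proof. by move=> a0; rewrite [a]malg_sum a0 big_seq_fset0. Qed.

Lemma linear_fliftE (X : choiceType) (V : lmodType K)
    (f : {linear {malg K[X]} -> V}) a :
  f a = \sum_(x <- msupp a) a@_x *: f << x >>.
Proof. by rewrite [in LHS](malg_sum a) linear_sum; apply: eq_bigr => x _; rewrite linearZ. Qed.

Lemma malg_mem (X : choiceType) (S : submodule {malg K[X]}) (a : {malg K[X]}) :
  (forall x, x \in msupp a -> << x >> \in S) -> a \in S.
Proof.
move=> aS; rewrite [a]malg_sum big_seq; apply: rpred_sum => x xa.
by apply: rpredZ; exact: aS.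
Qed.

Lemma linear_supp_eq (X : choiceType) (V : lmodType K)
    (f g : {linear {malg K[X]} -> V}) (a : {malg K[X]}) :
  (forall x, x \in msupp a -> f << x >> = g << x >>) -> f a = g a.
Proof.
move=> fg; rewrite [a]malg_sum !linear_sum; apply: eq_big_seq => x xa.
by rewrite !linearZ fg.
Qed.

Definition coef_fun (X : choiceType) (x : X) (a : {malg K[X]}) : K^o := a@_x.
Fact coef_is_linear (X : choiceType) (x : X) : linear (coef_fun x).
Proof. by move=> c a b; rewrite /coef_fun mcoeffD mcoeffZ. Qed.
HB.instance Definition _ (X : choiceType) (x : X) :=
  GRing.isLinear.Build K {malg K[X]} K^o _ (coef_fun x) (coef_is_linear x).
Definition coef (X : choiceType) (x : X) : {linear {malg K[X]} -> K^o} := coef_fun x.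

Lemma coefE (X : choiceType) (x : X) (a : {malg K[X]}) : coef x a = a@_x.
Proof. by []. Qed.

Definition restr (X : choiceType) (P : pred X) :
    {linear {malg K[X]} -> {malg K[X]}} :=
  flift (fun x => if P x then << x >> else 0).

Lemma restrU (X : choiceType) (P : pred X) x :
  restr P << x >> = if P x then << x >> else 0.
Proof. exact: fliftU. Qed.

Lemma mcoeff_restr (X : choiceType) (P : pred X) (a : {malg K[X]}) x :
  (restr P a)@_x = if P x then a@_x else 0.
Proof.
pose f : {linear {malg K[X]} -> K^o} := coef x \o restr P.
pose g : {linear {malg K[X]} -> K^o} := if P x then coef x else \0.
have -> : (if P x then a@_x else 0) = g a by rewrite /g; case: (P x).
apply: (free_ext (f := f) (g := g)) => y.
rewrite /f /g /= fliftU.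
have [->|yx] := eqVneq y x; first by case: (P x); rewrite /= ?coefE ?mcoeffUU ?mcoeff0.
by case: (P x); case: (P y); rewrite /= ?coefE ?mcoeff0 // mcoeffU (negbTE yx).
Qed.

(** Elements of K[X] have finite support, so prescribing coefficients does not yet define one. Here
    the element is the image of [b] under the linear map sending a basis element y to its only
    preimage in [D], or to 0 if there is none. *)
Lemma mcoeff_pullback (X Y : choiceType) (D : {pred X}) (g : X -> Y) (b : {malg K[Y]}) :
  {in D &, injective g} ->
  exists a : {malg K[X]}, forall x, a@_x = if x \in D then b@_(g x) else 0.
Proof.
move=> g_inj.
pose h y : {malg K[X]} :=
  if pselect (exists2 x, x \in D & g x = y) is left e then << projT1 (cid2 e) >> else 0.
exists (flift h b) => x; rewrite -coefE.
pose u : {linear {malg K[Y]} -> K^o} := coef x \o flift h.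
pose v : {linear {malg K[Y]} -> K^o} := if x \in D then coef (g x) else \0.
have -> : (if x \in D then b@_(g x) else 0) = v b by rewrite /v; case: (x \in D).
apply: (free_ext (f := u) (g := v)) => y.
rewrite /u /v /= fliftU /h; case: pselect => [e|ne].
  case: (cid2 e) => /= x' x'D gx'; rewrite coefE.
  have [<-|x'x] := eqVneq x' x; first by rewrite x'D coefE gx' !mcoeffUU.
  rewrite mcoeffU (negbTE x'x); case: ifP => xD; rewrite // coefE mcoeffU.
  by case: eqVneq => // ygx; case/eqP: x'x; apply: g_inj; rewrite // gx'.
rewrite coefE mcoeff0; case: ifP => xD; rewrite // coefE mcoeffU.
by case: eqVneq => // ygx; case: ne; exists x.
Qed.

(** The canonical presentation K[V] -> V splits. The section [s] acts as a dual basis: v is the sum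
    of the (s v)@_x *: x. *)
Definition projective (V : lmodType K) : Prop :=
  exists s : {linear V -> {malg K[V]}}, forall v, flift id (s v) = v.

Lemma proj_lift (P V W : lmodType K) (f : {linear P -> V}) (g : {linear W -> V}) :
  projective P -> (forall p, exists w, g w = f p) ->
  exists h : {linear P -> W}, forall p, g (h p) = f p.
Proof.
move=> [s sK] /choice[c gc]; exists (flift c \o s) => p /=.
rewrite -[in RHS](sK p).
apply: (free_ext (f := g \o flift c) (g := f \o flift id)) => x /=.
by rewrite !fliftU gc.
Qed.

Lemma proj_retract (X : choiceType) (V : lmodType K)
    (r : {linear V -> {malg K[X]}}) (e : {linear {malg K[X]} -> V}) :
  (forall v, e (r v) = v) -> projective V.
Proof.
move=> er; pose s0 := @flift K X {malg K[V]} (fun x => << e << x >> >>).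
exists (s0 \o r) => v /=; rewrite -[RHS]er.
apply: (free_ext (f := flift id \o s0) (g := e)) => x /=.
by rewrite /s0 !fliftU.
Qed.

Lemma proj_free (X : choiceType) : projective {malg K[X]}.
Proof. exact: (@proj_retract X _ idfun idfun). Qed.

End FreeModules.

(* The leading terms of [V], for a well-order on [X], show that [V] is free: over
   each [x] the leading coefficients form a principal ideal, and elements of [V]
   realising the nonzero generators form a basis. *)
Lemma proj_of_inj (K : idomainType) (X : choiceType) (V : lmodType K)
    (i : {linear V -> {malg K[X]}}) :
  is_pid K -> injective i -> projective V.
Proof.
move=> K_pid i_inj; have [R Rwo] := well_ordering_principle X.
have minP (A : {pred X}) x : x \in A -> exists2 z, z \in A & {in A, forall y, R z y}.
  by move=> xA; have [|z [[zA lb] _]] := Rwo A; [exists x | exists z].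
have Rchain : wo_chain R predT by move=> C _; exact: Rwo.
have Rtot x y : R x y || R y x by apply: (wo_chainW Rchain).
have Ranti x y : R x y -> R y x -> x = y.
  by move=> xy yx; apply: (wo_chain_antisymmetric Rchain); rewrite // xy.
(* Transitivity is read off the least element of {x, y, z}. *)
have Rtr y x z : R x y -> R y z -> R x z.
  move=> xy yz; have [|w wA lb] := minP (mem [:: x; y; z]) x; first exact: mem_head.
  have wx : R w x by apply: lb; rewrite mem_head.
  have wy : R w y by apply: lb; rewrite !inE eqxx orbT.
  have wz : R w z by apply: lb; rewrite !inE eqxx !orbT.
  move: wA; rewrite !inE => /or3P[] /eqP e; subst w => //.
    by rewrite -(Ranti _ _ wx xy) in yz *.
  by rewrite (Ranti _ _ wy yz) in xy *.
have Rrefl x : R x x by have := Rtot x x; rewrite orbb.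
pose below x v := forall y, y \in msupp (i v) -> R y x.
have belowP x c u v : below x u -> below x v -> below x (c *: u + v).
  move=> ux vx y; rewrite linearP => /(fsubsetP (msuppD_le _ _)).
  by rewrite in_fsetU => /orP[/(fsubsetP (msuppZ_le _ _))/ux|/vx].
have lead x : exists e, exists a, [/\ below x e, (i e)@_x = a
    & forall v, below x v -> exists b, (i v)@_x = b * a].
  pose I : {pred K^o} := fun a => `[< exists2 v, below x v & (i v)@_x = a >].
  have I_sub : submod_closed I.
    split=> [|c a b]; rewrite !unfold_in.
      by apply/asboolP; exists 0; rewrite ?linear0 ?mcoeff0 // /below linear0 => y; rewrite msupp0.
    move=> /asboolP[u ux <-] /asboolP[v vx <-]; apply/asboolP.
    by exists (c *: u + v); [exact: belowP | rewrite linearP mcoeffD mcoeffZ].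
  have [a aP] := K_pid (Submodule I_sub).
  have : a \in (Submodule I_sub : {pred K^o}) by apply/aP; exists 1; rewrite mul1r.
  move=> /asboolP[e ex ea]; exists e, a; split=> // v vx.
  by apply/aP/asboolP; exists v.
have [e eP] := choice lead; have [a {}eP] := choice eP => {lead}.
pose X1 := {x : X | a x != 0}.
pose eps : {linear {malg K[X1]} -> V} := flift (fun x => e (val x)).
have maxP (A : {fset X}) : A != fset0 -> exists2 z, z \in A & forall y, y \in A -> R y z.
  elim/finSet_rect: A => A IH /fset0Pn[x xA].
  have [A0|/IH] := eqVneq (A `\ x)%fset fset0.
    exists x => // y yA; have [->|yx] := eqVneq y x; first exact: Rrefl.
    have : y \in (A `\ x)%fset by rewrite !inE yx.
    by rewrite A0 inE.
  case; first by rewrite fproperD1.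
  move=> z; rewrite !inE => /andP[_ zA] zmax.
  have [xz|zx] := orP (Rtot x z).
    exists z => // y yA; have [->//|yx] := eqVneq y x.
    by apply: zmax; rewrite !inE yx.
  exists x => // y yA; have [->|yx] := eqVneq y x; first exact: Rrefl.
  by apply: (Rtr z) => //; apply: zmax; rewrite !inE yx.
have eps_inj c : eps c = 0 -> c = 0.
  (* At the greatest index x of c no other basis element has a coefficient, so the coefficient of
     [eps c] at x is c@_x * a x, and K is a domain. *)
  move=> c0; apply/msupp_fset0/eqP/negPn/negP => cn0.
  have [|z] := maxP [fset val x | x in msupp c]%fset.
    by have /fset0Pn[x xc] := cn0; apply/fset0Pn; exists (val x); apply: in_imfset.
  move=> /imfsetP[x /= xc zE] zmax; subst z.
  have := congr1 (fun v => (i v)@_(val x)) c0.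
  rewrite linear0 mcoeff0 /eps /= /flift linear_sum raddf_sum /=.
  rewrite (big_fsetD1 x) //= big1_seq ?addr0 => [|y /andP[_]].
    rewrite linearZ mcoeffZ; have [_ -> _] := eP (val x).
    move/eqP; rewrite mulf_eq0 (negbTE (valP x)) orbF.
    by rewrite mcoeff_eq0 xc.
  rewrite !inE => /andP[yx yc]; rewrite linearZ mcoeffZ.
  have [ey _ _] := eP (val y).
  rewrite [(i _)@_ _](_ : _ = 0) ?mulr0 //; apply/mcoeff_outdom/negP => /ey xy.
  have yx' : R (val y) (val x) by apply: zmax; apply: in_imfset.
  by case/eqP: yx; apply: val_inj; apply: Ranti.
have eps_surj v : exists c, eps c = v.
  suff below_surj x : forall u, below x u -> exists c, eps c = u.
    have [iv0|/maxP[x _ xmax]] := eqVneq (msupp (i v)) fset0.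
      by exists 0; rewrite linear0; apply: i_inj; rewrite linear0; apply/esym/msupp_fset0.
    exact: below_surj xmax.
  (* Take z least among the counterexamples. Subtracting a multiple of [e z] removes the coefficient
     at z, and what remains has its leading term strictly below z. If a z = 0, that coefficient is
     zero from the start. *)
  apply: contrapT => nx.
  pose A : {pred X} := fun x => `[< ~ forall u, below x u -> exists c, eps c = u >].
  have [|z zA zmin] := minP A x; first exact/asboolP.
  move/asboolP: zA; apply => u uz.
  have sub_lt w : below z w -> (i w)@_z = 0 -> exists c, eps c = w.
    move=> wz iwz; have [iw0|/maxP[y yw ymax]] := eqVneq (msupp (i w)) fset0.
      by exists 0; rewrite linear0; apply: i_inj; rewrite linear0; apply/esym/msupp_fset0.
    have [Ay|/asboolPn/contrapT] := boolP (y \in A); last exact.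
    have yz : y = z by apply: Ranti; [exact: wz | exact: zmin].
    by move: yw; rewrite yz -mcoeff_neq0 iwz eqxx.
  have [ez ea eb] := eP z; have [b ub] := eb u uz.
  have [az|az] := eqVneq (a z) 0.
    by apply: sub_lt; rewrite // ub az mulr0.
  have [c cE] : exists c, eps c = (- b) *: e z + u.
    apply: sub_lt; first exact: belowP.
    by rewrite linearP mcoeffD mcoeffZ ea ub mulNr addNr.
  exists (b *: << exist _ z az : X1 >> + c); rewrite linearP cE.
  by rewrite /eps /= fliftU /= scaleNr addrA subrr add0r.
have [r rK] := choice eps_surj.
have r_lin : linear r.
  move=> c u v; apply/eqP; rewrite -subr_eq0; apply/eqP/eps_inj.
  by rewrite linearB linearP !rK subrr.
pose rM := GRing.isLinear.Build K V {malg K[X1]} _ r r_lin.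
pose rl : {linear V -> {malg K[X1]}} := HB.pack r rM.
exact: (@proj_retract _ _ _ rl eps rK).
Qed.

Lemma opprD_cancel (V : zmodType) (a b c d : V) :
  a - (b + c) = (a - d - c) + (d - b).
Proof. by rewrite addrA (addrAC (a - d)) subrK opprD addrA addrAC. Qed.

(** * Tensor products: universal property, functoriality, exactness *)

Section Tensors.
Context {K : comNzRingType}.
Implicit Types U V W : lmodType K.

Lemma tens_linl V W (w : W) : linear (fun v : V => tens v w).
Proof.
move=> a u v; rewrite /tens -linearP; apply/qproj_eq/asboolP => S Sr.
have -> : << (a *: u + v, w) >> - (a *: << (u, w) >> + << (v, w) >>) =
   (<< (a *: u + v, w) >> - << (a *: u, w) >> - << (v, w) >>) +
   (<< (a *: u, w) >> - a *: << (u, w) >>) :> {malg K[(V * W)%type]}.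
  exact: opprD_cancel.
apply: rpredD; apply: Sr; first by apply: Or41; exists (a *: u), v, w.
by apply: Or43; exists a, u, w.
Qed.

Lemma tens_linr V W (v : V) : linear (fun w : W => tens v w).
Proof.
move=> a u w; rewrite /tens -linearP; apply/qproj_eq/asboolP => S Sr.
have -> : << (v, a *: u + w) >> - (a *: << (v, u) >> + << (v, w) >>) =
   (<< (v, a *: u + w) >> - << (v, a *: u) >> - << (v, w) >>) +
   (<< (v, a *: u) >> - a *: << (v, u) >>) :> {malg K[(V * W)%type]}.
  exact: opprD_cancel.
apply: rpredD; apply: Sr; first by apply: Or42; exists v, (a *: u), w.
by apply: Or44; exists a, v, u.
Qed.

Definition tensl V W (w : W) (v : V) : tensor V W := tens v w.
HB.instance Definition _ V W (w : W) :=
  GRing.isLinear.Build K V (tensor V W) _ (@tensl V W w) (tens_linl w).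
HB.instance Definition _ V W (v : V) :=
  GRing.isLinear.Build K W (tensor V W) _ (@tens K V W v) (tens_linr v).

Lemma tensl_sum V W (I : Type) (r : seq I) (F : I -> V) (w : W) :
  tens (\sum_(x <- r) F x) w = \sum_(x <- r) tens (F x) w.
Proof. by rewrite -[LHS]/(tensl w _) linear_sum. Qed.

Lemma tensDl V W (u v : V) (w : W) : tens (u + v) w = tens u w + tens v w.
Proof. by have := tens_linl w 1 u v; rewrite !scale1r. Qed.

Lemma tensZl V W a (v : V) (w : W) : tens (a *: v) w = a *: tens v w.
Proof. by rewrite -[LHS]/(tensl w _) linearZ. Qed.

Lemma tensZr V W a (v : V) (w : W) : tens v (a *: w) = a *: tens v w.
Proof. by rewrite linearZ. Qed.

Lemma tensor_mem V W (S : submodule (tensor V W)) (t : tensor V W) :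
  (forall v w, tens v w \in S) -> t \in S.
Proof.
move=> St; apply/qproj_eq0.
apply: (@tensor_ext _ _ _ _ (qproj S) \0) => v w /=.
exact/qproj_eq0.
Qed.

Section Lift.
Variables (V W U : lmodType K) (f : V -> W -> U).
Hypothesis fl : forall w, linear (f^~ w).
Hypothesis fr : forall v, linear (f v).

Let pre : {linear {malg K[(V * W)%type]} -> U} := flift (fun p => f p.1 p.2).

Lemma tensor_lift_rel r : r \in span (@tensor_rel K V W) -> pre r = 0.
Proof.
have flD u v w : f (u + v) w = f u w + f v w.
  by have := fl w 1 u v; rewrite !scale1r.
have frD u v w : f u (v + w) = f u v + f u w.
  by have := fr u 1 v w; rewrite !scale1r.
have fl0 w : f 0 w = 0 by apply/(addrI (f 0 w)); rewrite -flD !addr0.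
have fr0 v : f v 0 = 0 by apply/(addrI (f v 0)); rewrite -frD !addr0.
move=> /asboolP/(_ (kern pre)) rk; apply/eqP/rk => {r rk} r rel.
have preU v w : pre << (v, w) >> = f v w by exact: fliftU.
apply/eqP; case: rel => -[x [y [z ->]]]; rewrite !linearB ?linearZ /= !preU.
- by rewrite flD addrAC addrK subrr.
- by rewrite frD addrAC addrK subrr.
- by have := fl z x y 0; rewrite addr0 fl0 addr0 => ->; rewrite scalerN subrr.
- have e : f y (x *: z) = x *: f y z by have := fr y x z 0; rewrite addr0 fr0 addr0.
  by rewrite e scalerN subrr.
Qed.

Definition tensor_lift_fun (t : tensor V W) : U := pre (qrepr t).

Lemma tensor_lift_proj r : tensor_lift_fun (qproj _ r) = pre r.
Proof.
by apply/eqP; rewrite -subr_eq0 -linearB; apply/eqP/tensor_lift_rel/qrepr_qproj.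
Qed.

Fact tensor_lift_is_linear : linear tensor_lift_fun.
Proof.
move=> a x y; rewrite -[x]qreprK -[y]qreprK -linearP !tensor_lift_proj.
exact: linearP.
Qed.
HB.instance Definition _ := GRing.isLinear.Build K (tensor V W) U _
  tensor_lift_fun tensor_lift_is_linear.

Definition tensor_lift : {linear tensor V W -> U} := tensor_lift_fun.

Lemma tensor_lift_tens v w : tensor_lift (tens v w) = f v w.
Proof. by rewrite [LHS]tensor_lift_proj [LHS]fliftU. Qed.
End Lift.

Lemma tensor_map_comp V W V' W' V'' W'' (f : {linear V -> V'})
    (g : {linear W -> W'}) (f' : {linear V' -> V''}) (g' : {linear W' -> W''})
    (f'' : {linear V -> V''}) (g'' : {linear W -> W''}) t :
  (forall v, f' (f v) = f'' v) -> (forall w, g' (g w) = g'' w) ->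
  tensor_map f' g' (tensor_map f g t) = tensor_map f'' g'' t.
Proof.
move=> ff gg.
apply: (@tensor_ext _ _ _ _ (tensor_map f' g' \o tensor_map f g) (tensor_map f'' g'')).
by move=> v w; rewrite /= !tensor_map_tens ff gg.
Qed.

Lemma tensor_map_id V W (t : tensor V W) : tensor_map idfun idfun t = t.
Proof.
by apply: (@tensor_ext _ _ _ _ (tensor_map idfun idfun) idfun) => v w; rewrite tensor_map_tens.
Qed.

Lemma tensor_map0l V W V' W' (f : {linear V -> V'}) (g : {linear W -> W'}) t :
  (forall v, f v = 0) -> tensor_map f g t = 0.
Proof.
move=> f0; apply: (@tensor_ext _ _ _ _ (tensor_map f g) \0) => v w.
by rewrite tensor_map_tens f0 tens0l.
Qed.

Lemma tensor_map0r V W V' W' (f : {linear V -> V'}) (g : {linear W -> W'}) t :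
  (forall w, g w = 0) -> tensor_map f g t = 0.
Proof.
move=> g0; apply: (@tensor_ext _ _ _ _ (tensor_map f g) \0) => v w.
by rewrite tensor_map_tens g0 tens0r.
Qed.

Lemma tensor_map_surj V W V' W' (f : {linear V -> V'}) (g : {linear W -> W'}) t :
  (forall v', exists v, f v = v') -> (forall w', exists w, g w = w') ->
  exists s, tensor_map f g s = t.
Proof.
move=> /choice[f' f'K] /choice[g' g'K].
pose im : {pred tensor V' W'} := fun t => `[< exists s, tensor_map f g s = t >].
have im_sub : submod_closed im.
  split=> [|a x y]; rewrite !unfold_in; first by apply/asboolP; exists 0; rewrite linear0.
  move=> /asboolP[u <-] /asboolP[v <-]; apply/asboolP.
  by exists (a *: u + v); rewrite linearP.
suff : t \in Submodule im_sub by move/asboolP.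
apply: tensor_mem => v w; apply/asboolP.
by exists (tens (f' v) (g' w)); rewrite tensor_map_tens f'K g'K.
Qed.

(* A section [s] of [K[P] -> P] provides coordinates on [P (x) W] with values
   in [W]; they make [P (x) -] exact. *)
Section Coordinates.
Variables (P : lmodType K) (s : {linear P -> {malg K[P]}}).
Hypothesis sK : forall v, flift id (s v) = v.

Let cfun W (x : P) (p : P) (w : W) : W := (s p)@_x *: w.
Let cfunl W x (w : W) : linear ((@cfun W x)^~ w).
Proof. by move=> a u v; rewrite /cfun linearP mcoeffD mcoeffZ scalerDl scalerA. Qed.
Let cfunr W x (p : P) : linear (@cfun W x p).
Proof. by move=> a u v; rewrite /cfun scalerDr !scalerA mulrC. Qed.

Definition coord W (x : P) : {linear tensor P W -> W} :=
  tensor_lift (@cfunl W x) (@cfunr W x).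

Lemma coord_tens W x p (w : W) : coord W x (tens p w) = (s p)@_x *: w.
Proof. exact: tensor_lift_tens. Qed.

Lemma coord_map W W' (g : {linear W -> W'}) x t :
  coord W' x (tensor_map idfun g t) = g (coord W x t).
Proof.
apply: (@tensor_ext _ _ _ _ (coord W' x \o tensor_map idfun g) (g \o coord W x)).
by move=> p w /=; rewrite tensor_map_tens !coord_tens linearZ.
Qed.

(** Claiming the formula for all larger index sets makes it stable under sums, so that it defines a
    submodule and may be checked on pure tensors. *)
Lemma coord_sum W (t : tensor P W) : exists d : {fset P},
  forall d' : {fset P}, (d `<=` d')%fset -> t = \sum_(x <- d') tens x (coord W x t).
Proof.
pose S : {pred tensor P W} := fun t => `[< exists d : {fset P},
  forall d' : {fset P}, (d `<=` d')%fset -> t = \sum_(x <- d') tens x (coord W x t) >].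
have S_sub : submod_closed S.
  split=> [|a u v]; rewrite !unfold_in.
    apply/asboolP; exists fset0 => d' _; rewrite big1 // => x _.
    by rewrite linear0 linear0.
  move=> /asboolP[d dP] /asboolP[e eP]; apply/asboolP; exists (d `|` e)%fset => d'.
  rewrite fsubUset => /andP[/dP dd' /eP ed'].
  rewrite [in LHS]dd' [in LHS]ed' scaler_sumr -big_split; apply: eq_bigr => x _ /=.
  by rewrite linearP linearP.
suff : t \in Submodule S_sub by move/asboolP.
apply: tensor_mem => p w; apply/asboolP; exists (msupp (s p)) => d' pd'.
rewrite -[in LHS](sK p) (fliftEw _ pd') tensl_sum; apply: eq_bigr => x _.
by rewrite coord_tens tensZl tensZr.
Qed.

Lemma coord_inj W (t : tensor P W) : (forall x, coord W x t = 0) -> t = 0.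
Proof.
move=> t0; have [d /(_ d)->//] := coord_sum t.
by rewrite big1 // => x _; rewrite t0 tens0r.
Qed.

Lemma coord_im W' W (f : {linear W' -> W}) (t : tensor P W) :
  (forall x, exists w', f w' = coord W x t) -> exists t', tensor_map idfun f t' = t.
Proof.
move=> /choice[c cf]; have [d /(_ d)tE] := coord_sum t.
exists (\sum_(x <- d) tens x (c x)); rewrite linear_sum [RHS]tE //.
by apply: eq_bigr => x _; rewrite tensor_map_tens cf.
Qed.
End Coordinates.

(** Flatness of a projective module, for a joint kernel: in the Kunneth formula the boundaries of D
    are characterised as the chains killed by both the differential and the map [etaD]. For a single
    condition, [g1] and [g2] are taken equal. *)
Lemma proj_tensor_exact (P W' W W1 W2 : lmodType K) (f : {linear W' -> W})
    (g1 : {linear W -> W1}) (g2 : {linear W -> W2}) (t : tensor P W) :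
  projective P -> (forall w, g1 w = 0 -> g2 w = 0 -> exists w', f w' = w) ->
  tensor_map idfun g1 t = 0 -> tensor_map idfun g2 t = 0 ->
  exists t', tensor_map idfun f t' = t.
Proof.
move=> [s sK] fg t1 t2; apply: (coord_im sK) => x; apply: fg.
  by rewrite -(coord_map s) t1 linear0.
by rewrite -(coord_map s) t2 linear0.
Qed.

End Tensors.

(** * The external product K[X] x K[X'] -> K[X x X'], rows and columns *)

Section ExternalProduct.
Context {K : comNzRingType}.
Variables (X X' : choiceType).
Implicit Types (a : {malg K[X]}) (b : {malg K[X']}) (c : {malg K[(X * X')%type]}).

Definition mext a b : {malg K[(X * X')%type]} :=
  flift (fun x => flift (fun x' => << (x, x') >>) b) a.

Lemma mextUU x x' : mext << x >> << x' >> = << (x, x') >>.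
Proof. by rewrite /mext !fliftU. Qed.

Lemma mext_linl b : linear (mext^~ b).
Proof. by move=> u v w; exact: (linearP (flift _)). Qed.

Lemma mext_linr a : linear (mext a).
Proof.
have F (h : X -> {malg K[(X * X')%type]}) :
  flift h a = \sum_(x <- msupp a) a@_x *: h x by [].
move=> u v w; rewrite /mext !F scaler_sumr -big_split; apply: eq_bigr => x _ /=.
by rewrite linearP scalerDr !scalerA mulrC.
Qed.

HB.instance Definition _ a := GRing.isLinear.Build K {malg K[X']}
  {malg K[(X * X')%type]} _ (mext a) (mext_linr a).

Definition mextl b a := mext a b.
HB.instance Definition _ b := GRing.isLinear.Build K {malg K[X]}
  {malg K[(X * X')%type]} _ (mextl b) (mext_linl b).

Lemma mextl_suml (I : Type) (r : seq I) (F : I -> {malg K[X]}) b :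
  mext (\sum_(x <- r) F x) b = \sum_(x <- r) mext (F x) b.
Proof. exact: (linear_sum (mextl b)). Qed.

Lemma mextZl k a b : mext (k *: a) b = k *: mext a b.
Proof. by rewrite -[LHS]/(mextl b _) linearZ. Qed.

Lemma mext0l b : mext 0 b = 0.
Proof. exact: (linear0 (mextl b)). Qed.

Definition colslice (x' : X') : {linear {malg K[(X * X')%type]} -> {malg K[X]}} :=
  flift (fun p => if p.2 == x' then << p.1 >> else 0).
Definition rowslice (x : X) : {linear {malg K[(X * X')%type]} -> {malg K[X']}} :=
  flift (fun p => if p.1 == x then << p.2 >> else 0).

Arguments colslice : simpl never.
Arguments rowslice : simpl never.

Lemma mcoeff_colslice x' c x : (colslice x' c)@_x = c@_(x, x').
Proof.
apply: (free_ext (f := coef x \o colslice x') (g := coef (x, x'))) => -[y y'].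
rewrite /= fliftU /= [RHS]coefE mcoeffU xpair_eqE.
by case: (y' == x'); rewrite /= ?coefE ?mcoeffU ?andbT ?andbF ?mcoeff0.
Qed.

Lemma mcoeff_rowslice x c x' : (rowslice x c)@_x' = c@_(x, x').
Proof.
apply: (free_ext (f := coef x' \o rowslice x) (g := coef (x, x'))) => -[y y'].
rewrite /= fliftU /= [RHS]coefE mcoeffU xpair_eqE.
by case: (y == x); rewrite /= ?coefE ?mcoeffU ?mcoeff0.
Qed.

Lemma mcoeff_mext a b x x' : (mext a b)@_(x, x') = a@_x * b@_x'.
Proof.
have -> : a@_x * b@_x' = (b@_x' *: coef x a : K^o) by exact: mulrC.
apply: (free_ext (f := coef (x, x') \o mextl b) (g := b@_x' \*: coef x)) => y.
rewrite /= coefE /mextl.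
have -> : b@_x' *: coef_fun x << y >> = ((y == x)%:R *: coef x' b : K^o).
  by rewrite /coef_fun mcoeffU; exact: mulrC.
apply: (free_ext (f := coef (x, x') \o mext << y >>) (g := (y == x)%:R \*: coef x')) => y'.
by rewrite /= mextUU /coef_fun !mcoeffU xpair_eqE -mulnb natrM.
Qed.

Lemma colslice_mext x' a b : colslice x' (mext a b) = b@_x' *: a.
Proof. by apply/malgP => x; rewrite mcoeff_colslice mcoeff_mext mcoeffZ mulrC. Qed.

Lemma rowslice_mext x a b : rowslice x (mext a b) = a@_x *: b.
Proof. by apply/malgP => x'; rewrite mcoeff_rowslice mcoeff_mext mcoeffZ. Qed.

Definition snds c : {fset X'} := [fset p.2 | p in msupp c]%fset.

Lemma colslice_out x' c : x' \notin snds c -> colslice x' c = 0.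
Proof.
move=> x'c; apply/malgP => x; rewrite mcoeff_colslice mcoeff0.
apply: mcoeff_outdom; apply: contra x'c => xc.
by apply/imfsetP; exists (x, x').
Qed.

Lemma colslice_sum c :
  c = \sum_(x' <- snds c) mext (colslice x' c) << x' >>.
Proof.
apply/malgP => -[x x']; rewrite raddf_sum /=.
have F y' : (mext (colslice y' c) << y' >>)@_(x, x') = c@_(x, y') * (y' == x')%:R.
  by rewrite mcoeff_mext mcoeff_colslice mcoeffU.
under eq_bigr do rewrite F.
have [x'c|x'c] := boolP (x' \in snds c).
  rewrite (big_fsetD1 x') //= eqxx mulr1 big1_seq ?addr0 // => y' /andP[_].
  by rewrite !inE => /andP[/negbTE -> _]; rewrite mulr0.
rewrite -mcoeff_colslice colslice_out // mcoeff0 big1_seq // => y' /andP[_ y'c].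
by case: eqVneq y'c => [->|_ _]; rewrite ?(negbTE x'c) ?mulr0.
Qed.

(** Applying [psi] to every row of [c] amounts to forming one linear combination of its columns.
    Thus a condition on the rows becomes a relation between columns, which can be pulled back along
    [i] in [tmul_im]. *)
Lemma functional_rowslice (psi : {linear {malg K[X']} -> K^o}) c x :
  (\sum_(x' <- snds c) psi << x' >> *: colslice x' c)@_x = psi (rowslice x c).
Proof.
rewrite raddf_sum [in RHS](colslice_sum c) (linear_sum (rowslice x)).
rewrite (linear_sum psi); apply: eq_bigr => x' _.
rewrite rowslice_mext linearZ /= mcoeffZ; exact: mulrC.
Qed.

End ExternalProduct.

Arguments colslice {K X X'} x' : simpl never.
Arguments rowslice {K X X'} x : simpl never.

Section TensorInFree.
Context {K : comNzRingType}.
Variables (X X' : choiceType) (V V' : lmodType K).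
Variables (i : {linear V -> {malg K[X]}}) (i' : {linear V' -> {malg K[X']}}).

Let muf (v : V) (v' : V') := mext (i v) (i' v').
Let muf_linl v' : linear (muf^~ v').
Proof. by move=> a u v; rewrite /muf linearP mext_linl. Qed.
Let muf_linr v : linear (muf v).
Proof. by move=> a u w; rewrite /muf linearP mext_linr. Qed.

Definition tmul : {linear tensor V V' -> {malg K[(X * X')%type]}} :=
  tensor_lift muf_linl muf_linr.

Lemma tmul_tens v v' : tmul (tens v v') = mext (i v) (i' v').
Proof. exact: tensor_lift_tens. Qed.

Hypothesis V_proj : projective V.

(** The x'-coefficient of i', tensored with V, sends t to an element of V whose image under i is the
    column x' of [tmul t]; hence that element is 0. Its s-coordinate at x is also the x'-coefficient
    of i' at [coord s V' x t], so all the coordinates of t vanish. *)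
Lemma tmul_inj t : (forall v, i v = 0 -> v = 0) -> (forall v, i' v = 0 -> v = 0) ->
  tmul t = 0 -> t = 0.
Proof.
move=> i_inj i'_inj t0; have [s sK] := V_proj.
pose tf x' (v : V) (v' : V') := (i' v')@_x' *: v.
have tfl x' v' : linear ((tf x')^~ v').
  by move=> a u v; rewrite /tf scalerDr !scalerA mulrC.
have tfr x' v : linear (tf x' v).
  by move=> a u w; rewrite /tf linearP mcoeffD mcoeffZ scalerDl scalerA.
have tau0 x' : tensor_lift (tfl x') (tfr x') t = 0.
  apply: i_inj; rewrite -(linear0 (colslice x')) -t0.
  apply: (@tensor_ext _ _ _ _ (i \o tensor_lift (tfl x') (tfr x')) (colslice x' \o tmul)).
  move=> v v'; apply: etrans (congr1 i (tensor_lift_tens _ _ v v')) _.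
  apply: etrans (congr1 (colslice x') (esym (tmul_tens v v'))).
  by rewrite colslice_mext -linearZ.
apply: (coord_inj sK) => x; apply: i'_inj; apply/malgP => x'; rewrite mcoeff0.
have <- : (s (tensor_lift (tfl x') (tfr x') t))@_x = 0 by rewrite tau0 linear0 mcoeff0.
apply: (@tensor_ext _ _ _ _ (coef x' \o i' \o coord s V' x)
   (coef x \o s \o tensor_lift (tfl x') (tfr x'))) => v v' /=.
rewrite coord_tens tensor_lift_tens // /tf (linearZ_LR i') (linearZ_LR s).
by rewrite /coef_fun !mcoeffZ mulrC.
Qed.

(* [Psi] cuts out the image of [i'], so that the cokernel of [i'] is flat; without
   this [V (x) V'] is smaller than the intersection of the two conditions. *)
Lemma tmul_im (Psi : set {linear {malg K[X']} -> K^o}) c :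
  (forall v, i v = 0 -> v = 0) ->
  (forall b, (forall psi, Psi psi -> psi b = 0) -> exists v', i' v' = b) ->
  (forall x', exists v, i v = colslice x' c) ->
  (forall x psi, Psi psi -> psi (rowslice x c) = 0) ->
  exists t, tmul t = c.
Proof.
move=> i_inj im' /choice[u uc] row; have [s sK] := V_proj.
pose D := snds c.
(* The s-coordinates at p of the preimages of all columns, gathered into one element of K[X']. Once
   [g p] is lifted to [v' p] in V', the sum of the p (x) v' p is the required tensor. *)
pose g p : {malg K[X']} := \sum_(x' <- D) (s (u x'))@_p *: << x' >>.
have g_im p : exists v', i' v' = g p.
  apply: im' => psi Ppsi; rewrite /g linear_sum /=.
  (* All rows of c are killed by psi, so this combination of columns is zero; injectivity of i
     brings the relation back to V. *)
  have u0 : \sum_(x' <- D) psi << x' >> *: u x' = 0.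
    apply: i_inj; rewrite linear_sum; apply/malgP => x; rewrite mcoeff0.
    rewrite -(row x psi Ppsi) -functional_rowslice; congr (mcoeff x _).
    by apply: eq_bigr => x' _; rewrite linearZ /= uc.
  transitivity ((s (\sum_(x' <- D) psi << x' >> *: u x'))@_p : K^o); last first.
    by rewrite u0 linear0 mcoeff0.
  rewrite linear_sum raddf_sum; apply: eq_bigr => x' _.
  by rewrite /= (linearZ_LR psi) (linearZ_LR s) mcoeffZ; exact: mulrC.
have [v' v'g] := choice g_im.
pose E := (\bigcup_(x' <- D) msupp (s (u x')))%fset.
exists (\sum_(p <- E) tens p (v' p)); rewrite linear_sum [RHS](colslice_sum c).
transitivity (\sum_(p <- E) \sum_(x' <- D) (s (u x'))@_p *: mext (i p) << x' >>).
  apply: eq_bigr => p _; rewrite tmul_tens v'g /g linear_sum.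
  by apply: eq_bigr => x' _; rewrite linearZ.
rewrite exchange_big /=; apply: eq_big_seq => x' x'D.
have /(fliftEw id) uE : (msupp (s (u x')) `<=` E)%fset by exact: bigfcup_sup.
rewrite -uc -[in RHS](sK (u x')) uE linear_sum mextl_suml; apply: eq_bigr => p _.
by rewrite linearZ mextZl.
Qed.

End TensorInFree.

Opaque tensor tensor_map tensor_lift tens.

Section LinearMaps.
Context {K : comNzRingType}.
Implicit Types U V W : lmodType K.

Fact submod_val_is_linear V (S : submodule V) : linear (@submod_val K V S).
Proof. by []. Qed.
HB.instance Definition _ V (S : submodule V) :=
  GRing.isLinear.Build K (submod S) V _ (@submod_val K V S) (@submod_val_is_linear V S).
Definition incl V (S : submodule V) : {linear submod S -> V} := @submod_val K V S.

Lemma linear_inj V W (f : {linear V -> W}) : (forall v, f v = 0 -> v = 0) -> injective f.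
Proof.
move=> f0 x y /eqP; rewrite -subr_eq0 -linearB => /eqP/f0/eqP.
by rewrite subr_eq0 => /eqP.
Qed.

Lemma incl_inj V (S : submodule V) : injective (incl S).
Proof. exact: val_inj. Qed.

Lemma incl_eq0 V (S : submodule V) x : incl S x = 0 -> x = 0.
Proof. by move=> x0; apply: incl_inj; rewrite linear0. Qed.

Section Corestriction.
Variables (V W : lmodType K) (f : {linear V -> W}) (S : submodule W).
Hypothesis fS : forall v, f v \in S.
Definition corestr_fun v : submod S := Submod (fS v).
Fact corestr_is_linear : linear corestr_fun.
Proof. by move=> a x y; apply: val_inj; rewrite /= linearP. Qed.
HB.instance Definition _ := GRing.isLinear.Build K V (submod S) _
  corestr_fun corestr_is_linear.
Definition corestr : {linear V -> submod S} := corestr_fun.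
Lemma corestrE v : incl S (corestr v) = f v. Proof. by []. Qed.
End Corestriction.

Definition range_pred V W (f : {linear V -> W}) : {pred W} :=
  fun w => `[< exists v, f v = w >].
Fact range_closed V W (f : {linear V -> W}) : submod_closed (range_pred f).
Proof.
split=> [|a x y]; rewrite !unfold_in; first by apply/asboolP; exists 0; rewrite linear0.
move=> /asboolP[u <-] /asboolP[v <-]; apply/asboolP; exists (a *: u + v).
by rewrite linearP.
Qed.
Definition range V W (f : {linear V -> W}) : submodule W := Submodule (range_closed f).

Lemma rangeP V W (f : {linear V -> W}) w : (w \in range f) <-> exists v, f v = w.
Proof. by split=> [/asboolP|?]; last exact/asboolP. Qed.

Lemma kernP V W (f : {linear V -> W}) v : (v \in kern f) <-> f v = 0.
Proof. by split=> /eqP. Qed.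

Lemma linear_of_graph V W (R : V -> W -> Prop) :
  (forall v, exists w, R v w) -> (forall v w w', R v w -> R v w' -> w = w') ->
  (forall a v v' w w', R v w -> R v' w' -> R (a *: v + v') (a *: w + w')) ->
  exists f : {linear V -> W}, forall v, R v (f v).
Proof.
move=> /choice[f fR] R_fun R_lin.
have f_lin : linear f by move=> a u v; apply: R_fun (fR _) _; exact: R_lin.
by exists (HB.pack_for {linear V -> W} f (GRing.isLinear.Build K V W _ f f_lin)).
Qed.

Lemma linear_factor U V W (q : {linear U -> V}) (j : {linear U -> W}) :
  (forall v, exists u, q u = v) -> (forall u, q u = 0 -> j u = 0) ->
  exists f : {linear V -> W}, forall u, f (q u) = j u.
Proof.
move=> q_surj qj.
have qj2 u v : q u = q v -> j u = j v.
  by move=> quv; apply/eqP; rewrite -subr_eq0 -linearB; apply/eqP/qj; rewrite linearB quv subrr.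
have [|||f fR] := @linear_of_graph V W (fun v w => exists2 u, q u = v & j u = w).
- by move=> v; have [u uv] := q_surj v; exists (j u), u.
- by move=> v w w' [u <- <-] [u' uu' <-]; apply: qj2.
- by move=> a v v' w w' [u <- <-] [u' <- <-]; exists (a *: u + u'); rewrite linearP.
by exists f => u; have [u' uu' <-] := fR (q u); apply: qj2.
Qed.

Lemma linear_inv V W (f : {linear V -> W}) :
  (forall v, f v = 0 -> v = 0) -> (forall w, exists v, f v = w) ->
  exists g : {linear W -> V}, (forall v, g (f v) = v) /\ (forall w, f (g w) = w).
Proof.
move=> f_inj f_surj; have [//|g gf] := @linear_factor V W V f idfun f_surj.
by exists g; split=> // w; have [v <-] := f_surj w; rewrite gf.
Qed.

Lemma tensor_map_addl U V W W' (f f' f'' : {linear U -> V}) (g : {linear W -> W'}) t :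
  (forall u, f'' u = f u + f' u) ->
  tensor_map f'' g t = tensor_map f g t + tensor_map f' g t.
Proof.
move=> fE; apply: (@tensor_ext _ _ _ _ (tensor_map f'' g) (tensor_map f g \+ tensor_map f' g)).
by move=> u w; rewrite /= !tensor_map_tens fE tensDl.
Qed.

Definition qlift V W (S : submodule V) (f : {linear V -> W}) :
  (forall v, v \in S -> f v = 0) -> {g : {linear quotmod S -> W} | forall v, g (qproj S v) = f v}.
Proof.
move=> fS; apply: cid; apply: (@linear_factor V (quotmod S) W (qproj S) f).
  by move=> v; exists (qrepr v); exact: qreprK.
by move=> u /qproj_eq0; exact: fS.
Qed.

(** Right exactness. The inverse of (B (x) W) / im f -> C (x) W is built from arbitrary preimages
    [p c]: two choices differ by an element of the image of f. *)
Lemma tensor_rexact (A B C W : lmodType K) (f : {linear A -> B}) (g : {linear B -> C})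
    (t : tensor B W) :
  (forall c, exists b, g b = c) -> (forall b, g b = 0 -> exists a, f a = b) ->
  tensor_map g idfun t = 0 -> exists s, tensor_map f (idfun : {linear W -> W}) s = t.
Proof.
move=> /choice[p pK] fg t0.
pose I := range (tensor_map f (idfun : {linear W -> W})).
pose L (c : C) (w : W) : quotmod I := qproj I (tens (p c) w).
have Lp b b' w : g b = g b' -> qproj I (tens b w) = qproj I (tens b' w).
  move=> gbb'; apply/qproj_eq/rangeP.
  have [|a fa] := fg (b - b'); first by rewrite linearB gbb' subrr.
  exists (tens a w); rewrite tensor_map_tens /= fa.
  by rewrite -[LHS]/(tensl w _) linearB.
have Ll w : linear (L^~ w).
  move=> a u v; rewrite /L.
  rewrite (Lp _ (a *: p u + p v)); last by rewrite pK linearP !pK.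
  have -> : tens (a *: p u + p v) w = a *: tens (p u) w + tens (p v) w by exact: tens_linl.
  by rewrite linearP.
have Lr c : linear (L c) by move=> a u v; exact: (linearP (qproj I \o tens (p c))).
apply/rangeP/qproj_eq0; rewrite -(linear0 (tensor_lift Ll Lr)) -t0.
apply: (@tensor_ext _ _ _ _ (qproj I) (tensor_lift Ll Lr \o tensor_map g idfun)) => b w.
apply: etrans (congr1 (tensor_lift Ll Lr) (esym (tensor_map_tens g idfun b w))).
by rewrite tensor_lift_tens /L; apply: Lp; rewrite pK.
Qed.

End LinearMaps.

(** * Tor from a two-term projective resolution *)

Section TorComparison.
Context {K : comNzRingType}.
Variables (B Z V W : lmodType K) (j : {linear B -> Z}) (q : {linear Z -> V}).
Hypotheses (B_proj : projective B) (Z_proj : projective Z).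
Hypothesis j_inj : forall b, j b = 0 -> b = 0.
Hypothesis qj0 : forall b, q (j b) = 0.
Hypothesis jq : forall z, q z = 0 -> exists b, j b = z.
Hypothesis q_surj : forall v, exists z, q z = v.

Let F0 := {malg K[V]}.
Let F1 := {malg K[submod (kern (res_aug V))]}.
Let F2 := {malg K[submod (kern (res_diff1 V))]}.

Let aug_surj v : exists x : F0, res_aug V x = v.
Proof. by exists << v >>; exact: fliftU. Qed.

Let exact0 (x : F0) : res_aug V x = 0 -> exists y : F1, res_diff1 V y = x.
Proof. by move=> /kernP xk; exists << Submod xk >>; exact: fliftU. Qed.

Let exact1 (x : F1) : res_diff1 V x = 0 -> exists y : F2, res_diff2 V y = x.
Proof. by move=> /kernP xk; exists << Submod xk >>; exact: fliftU. Qed.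

Let d1K (y : F1) : res_aug V (res_diff1 V y) = 0.
Proof.
apply: (free_ext (f := res_aug V \o res_diff1 V) (g := \0)) => x.
apply: etrans (congr1 (res_aug V) (fliftU _ x)) _.
by apply/kernP; exact: submodP.
Qed.

Let d2K (y : F2) : res_diff1 V (res_diff2 V y) = 0.
Proof.
apply: (free_ext (f := res_diff1 V \o res_diff2 V) (g := \0)) => x.
apply: etrans (congr1 (res_diff1 V) (fliftU _ x)) _.
by apply/kernP; exact: submodP.
Qed.

Let oW : {linear W -> W} := idfun.

(** The resolution 0 -> B -> Z -> V is compared with the standard one. The chain maps b and a lift
    the identity of V, and the homotopies h' and h0, h1 show that they are mutually inverse up to
    homotopy; all these identities survive tensoring with W. *)
Lemma Tor1_comparison :
  exists th : {linear submod (kern (tensor_map j oW)) -> Tor1 V W},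
    (forall x, th x = 0 -> x = 0) /\ (forall y, exists x, th x = y).
Proof.
have [b0 b0P] : exists b0 : {linear Z -> F0}, forall z, res_aug V (b0 z) = q z.
  by apply: proj_lift.
have [b1 b1P] : exists b1 : {linear B -> F1}, forall b, res_diff1 V (b1 b) = b0 (j b).
  apply: (@proj_lift _ _ _ _ (b0 \o j)) => // b; apply: exact0.
  by rewrite /= b0P qj0.
have [a0 a0P] : exists a0 : {linear F0 -> Z}, forall x, q (a0 x) = res_aug V x.
  by apply: proj_lift; first exact: proj_free.
have [a1 a1P] : exists a1 : {linear F1 -> B}, forall x, j (a1 x) = a0 (res_diff1 V x).
  apply: (@proj_lift _ _ _ _ (a0 \o res_diff1 V)); first exact: proj_free.
  by move=> x; apply: jq; rewrite [LHS]a0P d1K.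
have [h' h'P] : exists h' : {linear Z -> B}, forall z, j (h' z) = a0 (b0 z) - z.
  apply: (@proj_lift _ _ _ _ ((a0 \o b0) \- idfun)) => // z; apply: jq.
  by rewrite linearB /= a0P b0P subrr.
have [h0 h0P] : exists h0 : {linear F0 -> F1}, forall x, res_diff1 V (h0 x) = b0 (a0 x) - x.
  apply: (@proj_lift _ _ _ _ ((b0 \o a0) \- idfun)); first exact: proj_free.
  by move=> x; apply: exact0; rewrite linearB /= b0P a0P subrr.
have [h1 h1P] : exists h1 : {linear F1 -> F2},
    forall x, res_diff2 V (h1 x) = b1 (a1 x) - x - h0 (res_diff1 V x).
  apply: (@proj_lift _ _ _ _ ((b1 \o a1) \- idfun \- (h0 \o res_diff1 V))).
    exact: proj_free.
  move=> x; apply: exact1.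
  by rewrite !linearB /= b1P a1P h0P subrr.
pose d1W := tensor_map (res_diff1 V) oW; pose d2W := tensor_map (res_diff2 V) oW.
pose jW := tensor_map j oW; pose b1W := tensor_map b1 oW; pose a1W := tensor_map a1 oW.
have b1k0 (x : submod (kern jW)) : b1W (incl _ x) \in kern d1W.
  apply/kernP; rewrite /d1W /b1W (tensor_map_comp (f'' := b0 \o j) (g'' := oW)) //.
  rewrite -(tensor_map_comp (f := j) (g := oW) (f' := b0) (g' := oW)) //.
  by have /kernP -> := submodP x; rewrite linear0.
pose th : {linear submod (kern jW) -> Tor1 V W} :=
  qproj _ \o corestr (f := b1W \o incl (kern jW)) b1k0.
exists th; split=> [x /qproj_eq0/asboolP[y yE]|y].
  have a1d2 : a1W (d2W y) = 0.
    rewrite /a1W /d2W (tensor_map_comp (f'' := \0) (g'' := oW)) ?tensor_map0l // => u.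
    by apply: j_inj; rewrite a1P d2K linear0.
  (* On B the homotopy relation reads a1 b1 = 1 + h' j, and its last term vanishes on the kernel of
     j (x) W. *)
  have xE : a1W (b1W (incl _ x)) = incl _ x + tensor_map h' oW (jW (incl _ x)).
    rewrite /a1W /b1W (tensor_map_comp (f'' := a1 \o b1) (g'' := oW)) //.
    apply: etrans (@tensor_map_addl _ _ _ _ _ idfun (h' \o j) _ _ _ _) _; last first.
      by rewrite tensor_map_id; congr (_ + _); apply/esym/tensor_map_comp.
    move=> b; apply/eqP; rewrite -subr_eq0; apply/eqP/j_inj.
    by rewrite linearB linearD /= a1P b1P h'P [j b + _]addrC subrK subrr.
  apply: incl_eq0; have /kernP jx0 := submodP x.
  by move: xE; rewrite -[b1W (incl _ x)]yE a1d2 [jW _]jx0 linear0 addr0.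
rewrite -[y]qreprK; move: (qrepr y) => z {y}.
pose c := incl _ z; have /kernP c0 : c \in kern d1W by exact: submodP.
have xk : a1W c \in kern jW.
  apply/kernP; rewrite /jW /a1W (tensor_map_comp (f'' := a0 \o res_diff1 V) (g'' := oW)) //.
  rewrite -(tensor_map_comp (f := res_diff1 V) (g := oW) (f' := a0) (g' := oW)) //.
  by rewrite [tensor_map _ _ c]c0 linear0.
exists (Submod xk); apply/qproj_eq/asboolP; exists (tensor_map h1 oW c).
have : b1W (a1W c) = c + (d2W (tensor_map h1 oW c) + tensor_map h0 oW (d1W c)).
  rewrite /b1W /a1W (tensor_map_comp (f'' := b1 \o a1) (g'' := oW)) //.
  apply: etrans (@tensor_map_addl _ _ _ _ _ idfun
    ((res_diff2 V \o h1) \+ (h0 \o res_diff1 V)) _ _ _ _) _; last first.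
    rewrite tensor_map_id; congr (_ + _).
    apply: etrans (@tensor_map_addl _ _ _ _ _ (res_diff2 V \o h1) (h0 \o res_diff1 V) _ _ _ _) _ => //.
    by congr (_ + _); apply/esym/tensor_map_comp.
  by move=> x; rewrite /= h1P subrK addrC subrK.
by rewrite c0 linear0 addr0 => e; rewrite /= [X in X - _]e addrC addKr.
Qed.
End TorComparison.

Opaque tensor tensor_map tensor_lift tens.

(** * The Kunneth formula *)

Section DirectSums.
Context {K : comNzRingType}.
Variables (I : Type) (T : I -> lmodType K).

Lemma dsum_ext (x y : dsum T) : (forall i, x i = y i) -> x = y.
Proof. by move=> xy; apply: functional_extensionality_dep. Qed.

Definition dproj_fun i (x : dsum T) : T i := x i.
Fact dproj_is_linear i : linear (dproj_fun i).
Proof. by []. Qed.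
HB.instance Definition _ i :=
  GRing.isLinear.Build K (dsum T) (T i) _ (dproj_fun i) (dproj_is_linear i).
Definition dproj i : {linear dsum T -> T i} := dproj_fun i.

Variables (V : lmodType K) (f : forall i, {linear V -> T i}).
Definition dtuple_fun (v : V) : dsum T := fun i => f i v.
Fact dtuple_is_linear : linear dtuple_fun.
Proof. by move=> a u v; apply: dsum_ext => i; rewrite /dtuple_fun linearP. Qed.
HB.instance Definition _ :=
  GRing.isLinear.Build K V (dsum T) _ dtuple_fun dtuple_is_linear.
Definition dtuple : {linear V -> dsum T} := dtuple_fun.
End DirectSums.

Arguments dproj {K I T} i.

Section Splitting.
Context {K : comNzRingType}.
Variables (V W : lmodType K) (f : {linear V -> W}).

Fact corange_subproof v : f v \in range f.
Proof. by apply/rangeP; exists v. Qed.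
Definition corange : {linear V -> submod (range f)} := corestr corange_subproof.

Lemma corange_surj b : exists v, corange v = b.
Proof. by have /rangeP[v vb] := submodP b; exists v; apply: val_inj. Qed.

Lemma corange_eq0 v : corange v = 0 <-> f v = 0.
Proof.
split=> [|fv0]; first by move/(congr1 (incl _)); rewrite linear0.
exact: val_inj.
Qed.

(** Applied to the differential leaving a degree: chains split into cycles, with projection [pi],
    and a copy [r] of the boundaries below. *)
Lemma split_range : projective (submod (range f)) ->
  exists (pi : {linear V -> submod (kern f)}) (r : {linear submod (range f) -> V}),
    [/\ forall z, pi (incl _ z) = z, forall b, corange (r b) = b
      & forall v, v = incl _ (pi v) + r (corange v)].
Proof.
move=> f_proj.
have [r rK] : exists r : {linear submod (range f) -> V}, forall b, corange (r b) = b.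
  by apply: (@proj_lift _ _ _ _ idfun) => // b; exact: corange_surj.
have pik v : v - r (corange v) \in kern f.
  by apply/kernP/corange_eq0; rewrite linearB rK subrr.
pose pi := corestr (f := idfun \- (r \o corange)) pik.
exists pi, r; split=> // [z|v]; last by rewrite corestrE /= subrK.
apply: incl_inj; rewrite corestrE /=.
have /kernP/corange_eq0 -> : incl _ z \in kern f by exact: submodP.
by rewrite linear0 subr0.
Qed.
End Splitting.

Section Bidegrees.
Context {K : comNzRingType}.

Definition bl n (p : bideg (summing_to_pred n)) : bideg (summing_to n) :=
  @Bideg (summing_to n) (bi p).+1 (bj p) (bidegP p).

Fact br_subproof n (p : bideg (summing_to_pred n)) : summing_to n (bi p + (bj p).+1)%N.
Proof. by rewrite addnS; exact: (bidegP p). Qed.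
Definition br n (p : bideg (summing_to_pred n)) : bideg (summing_to n) :=
  @Bideg (summing_to n) (bi p) (bj p).+1 (br_subproof p).

Lemma bideg_eq P (p q : bideg P) : bi p = bi q -> bj p = bj q -> p = q.
Proof.
case: p q => [i j e] [i' j' e'] /= ii' jj'; subst i' j'.
by rewrite (bool_irrelevance e e').
Qed.

Fact dn_subproof n (p : bideg (summing_to_pred n.+1)) : summing_to n (bi p + bj p)%N.
Proof. by have := bidegP p; rewrite /summing_to_pred eqSS. Qed.
Definition dn n (p : bideg (summing_to_pred n.+1)) : bideg (summing_to n) :=
  @Bideg (summing_to n) (bi p) (bj p) (dn_subproof p).

Lemma dn_surj n (q : bideg (summing_to n)) : exists p, q = dn p.
Proof.
case: q => i j e; have e' : summing_to_pred n.+1 (i + j) by rewrite /summing_to_pred eqSS.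
by exists (Bideg e'); exact: bideg_eq.
Qed.

Variable T : nat -> nat -> lmodType K.

(** Extension by zero: a family on the bidegrees (i + 1, j) is completed by 0 at i = 0. Likewise
    [rshift] completes at j = 0. *)
Definition lshift n (a : forall p : bideg (summing_to_pred n), T (bi p).+1 (bj p))
    (p : bideg (summing_to n)) : T (bi p) (bj p) :=
  match p with
  | Bideg i j e =>
    match i return summing_to n (i + j)%N -> T i j with
    | 0 => fun=> 0
    | i'.+1 => fun e' => a (@Bideg (summing_to_pred n) i' j e')
    end e
  end.

Lemma lshift_bl n a (p : bideg (summing_to_pred n)) : lshift a (bl p) = a p.
Proof. by case: p. Qed.

Fact rshift_subproof n i j : summing_to n (i + j.+1)%N -> summing_to_pred n (i + j)%N.
Proof. by rewrite addnS. Qed.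

Definition rshift n (b : forall p : bideg (summing_to_pred n), T (bi p) (bj p).+1)
    (p : bideg (summing_to n)) : T (bi p) (bj p) :=
  match p with
  | Bideg i j e =>
    match j return summing_to n (i + j)%N -> T i j with
    | 0 => fun=> 0
    | j'.+1 => fun e' => b (Bideg (rshift_subproof e'))
    end e
  end.

Lemma rshift_br n b (p : bideg (summing_to_pred n)) : rshift b (br p) = b p.
Proof.
case: p => i j e /=.
exact: (bideg_irrelevance (T := fun i j => T i j.+1) b).
Qed.

End Bidegrees.

Lemma tensor_map_square (K : comNzRingType) (U V V' V2 W X X' X2 : lmodType K)
    (f : {linear U -> V}) (f' : {linear V -> V2}) (h : {linear U -> V'}) (h' : {linear V' -> V2})
    (g : {linear W -> X}) (g' : {linear X -> X2}) (k : {linear W -> X'}) (k' : {linear X' -> X2}) t :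
  (forall u, f' (f u) = h' (h u)) -> (forall w, g' (g w) = k' (k w)) ->
  tensor_map f' g' (tensor_map f g t) = tensor_map h' k' (tensor_map h k t).
Proof.
move=> fh gk; rewrite [RHS](tensor_map_comp (f'' := h' \o h) (g'' := k' \o k)) //.
exact: tensor_map_comp.
Qed.

Section Cycles.
Context {K : comNzRingType}.
Variable C : complex K.

Definition cyc n := submod (kern (dout C n)).
Definition bnd n := submod (range (dout C n.+1)).

Lemma dout_diff n (x : C n.+1) : dout C n (diff C n x) = 0.
Proof. by case: n x => // n x; exact: diffK. Qed.

Fact diff_cyc_subproof n x : diff C n x \in kern (dout C n).
Proof. exact/kernP/dout_diff. Qed.
Definition dcyc n : {linear C n.+1 -> cyc n} := corestr (@diff_cyc_subproof n).

Fact bnd_cyc_subproof n (b : bnd n) : incl _ b \in kern (dout C n).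
Proof.
have /rangeP[x xb] := submodP b; apply/kernP.
by rewrite -[incl _ b]xb; exact: dout_diff.
Qed.
Definition bcyc n : {linear bnd n -> cyc n} := corestr (@bnd_cyc_subproof n).

Definition hcls n : {linear cyc n -> homology C n} := qproj _.

Lemma dout_cyc n (z : cyc n) : dout C n (incl _ z) = 0.
Proof. exact/kernP/submodP. Qed.

Lemma diff_cyc n (z : cyc n.+1) : diff C n (incl _ z) = 0.
Proof. exact: (dout_cyc z). Qed.

Lemma hcls_surj n h : exists z, hcls n z = h.
Proof. by exists (qrepr h); exact: qreprK. Qed.

Lemma hcls_eq0 n z : hcls n z = 0 <-> exists x, dcyc n x = z.
Proof.
split=> [/qproj_eq0/asboolP[x xz]|[x <-]]; first by exists x; exact: val_inj.
by apply/qproj_eq0/asboolP; exists x.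
Qed.

Lemma bcyc_inj n b : bcyc n b = 0 -> b = 0.
Proof. by move/(congr1 (incl _)) => b0; apply: incl_inj; apply: etrans b0 _; rewrite !linear0. Qed.

Lemma bcyc_corange n x : bcyc n (corange (dout C n.+1) x) = dcyc n x.
Proof. exact: val_inj. Qed.

Lemma hcls_bcyc n b : hcls n (bcyc n b) = 0.
Proof.
have [x <-] := corange_surj b.
by rewrite bcyc_corange; apply/hcls_eq0; exists x.
Qed.

Lemma hcls_eq0_bnd n z : hcls n z = 0 -> exists b, bcyc n b = z.
Proof. by move=> /hcls_eq0[x <-]; exists (corange (dout C n.+1) x); exact: bcyc_corange. Qed.

End Cycles.

(** * The Kunneth sequence, for complexes with split differentials *)

Section Kunneth.
Context {K : comNzRingType}.
Variables C D : complex K.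
Let E := tensor_complex C D.

Lemma tensor_diff_dn n (t : E n.+1) (p : bideg (summing_to_pred n.+1)) :
  (diff E n t : tensor_obj C D n) (dn p) =
    tensor_map (diff C (bi p)) idfun (t (bl p)) +
    (-1) ^+ bi p *: tensor_map idfun (diff D (bj p)) (t (br p)).
Proof.
pose F (i j : nat) (x : tensor (C i.+1) (D j)) (y : tensor (C i) (D j.+1)) : tensor (C i) (D j) :=
  tensor_map (diff C i) idfun x + (-1) ^+ i *: tensor_map idfun (diff D j) y.
have irr i j := bideg_irrelevance (T := fun i j => tensor (C i) (D j)) t (i := i) (j := j).
case: p => i j e.
have e1 : t (bisl (dn (Bideg e))) = t (bl (Bideg e)) :> tensor (C i.+1) (D j).
  exact: (irr i.+1 j).
have e2 : t (bisr (dn (Bideg e))) = t (br (Bideg e)) :> tensor (C i) (D j.+1).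
  exact: (irr i j.+1).
exact: (congr2 (@F i j) e1 e2).
Qed.

(** The index type [summing_to_pred n] covers degree 0 uniformly: it is empty there, in agreement
    with the zero map [dout E 0]. *)
Lemma tensor_cycle n (t : E n) : dout E n t = 0 <->
  forall p : bideg (summing_to_pred n),
    tensor_map (diff C (bi p)) idfun (t (bl p)) +
    (-1) ^+ bi p *: tensor_map idfun (diff D (bj p)) (t (br p)) = 0.
Proof.
case: n t => [|n] t; first by split=> // _ [i j] /=; rewrite /summing_to_pred.
split=> [t0 p|t0].
  by rewrite -tensor_diff_dn -[diff E n t]/(dout E n.+1 t) t0.
apply: dsum_ext => q; have [p ->] := dn_surj q; rewrite -[LHS]/(diff E n t _).
rewrite tensor_diff_dn.
rewrite t0.
by [].
Qed.

(** The right factors of [a] and the left factors of [b] are cycles, so that of the four terms of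
    the differential only d (x) 1 on [a] and 1 (x) d on [b] remain. *)
Lemma tensor_cycle_asm n
   (a : forall p : bideg (summing_to_pred n), tensor (C (bi p).+1) (D (bj p)))
   (b : forall p : bideg (summing_to_pred n), tensor (C (bi p)) (D (bj p).+1))
   (p : bideg (summing_to_pred n)) :
  let t := (fun q => lshift (T := fun i j => tensor (C i) (D j)) a q +
                     rshift (T := fun i j => tensor (C i) (D j)) b q) : E n in
  (forall p, tensor_map idfun (dout D (bj p)) (a p) = 0) ->
  (forall p, tensor_map (dout C (bi p)) idfun (b p) = 0) ->
  tensor_map (diff C (bi p)) idfun (t (bl p)) +
    (-1) ^+ bi p *: tensor_map idfun (diff D (bj p)) (t (br p)) =
  tensor_map (diff C (bi p)) idfun (a p) +
    (-1) ^+ bi p *: tensor_map idfun (diff D (bj p)) (b p).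
Proof.
move=> t a0 b0; rewrite /t.
rewrite (lshift_bl (T := fun i j => tensor (C i) (D j))).
rewrite (rshift_br (T := fun i j => tensor (C i) (D j))).
rewrite !linearD /=.
have -> : tensor_map (diff C (bi p)) idfun
    (rshift (T := fun i j => tensor (C i) (D j)) b (bl p)) = 0.
  case: p => i [|j] e /=; first by rewrite linear0.
  exact: (b0 (@Bideg (summing_to_pred n) i.+1 j _)).
have -> : tensor_map idfun (diff D (bj p))
    (lshift (T := fun i j => tensor (C i) (D j)) a (br p)) = 0.
  case: p => [[|i]] j e /=; first by rewrite linear0.
  exact: (a0 (@Bideg (summing_to_pred n) i j.+1 _)).
by rewrite scaler0 addr0 add0r.
Qed.

Variables (piC : forall n, {linear C n -> cyc C n}).
Variables (rC : forall n, {linear submod (range (dout C n)) -> C n}).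
Variables (piD : forall n, {linear D n -> cyc D n}).
Hypothesis piCK : forall n z, piC n (incl _ z) = z.
Hypothesis rCK : forall n b, corange (dout C n) (rC n b) = b.
Hypothesis splitC : forall n x, x = incl _ (piC n x) + rC n (corange (dout C n) x).
Hypothesis piDK : forall n z, piD n (incl _ z) = z.
Hypothesis cycC_proj : forall n, projective (cyc C n).
Hypothesis bndC_proj : forall n, projective (bnd C n).

Let H2 n := dsum (fun p : bideg (summing_to n) =>
  tensor (homology C (bi p)) (homology D (bj p))).
Let Z2 n := dsum (fun p : bideg (summing_to n) => tensor (cyc C (bi p)) (cyc D (bj p))).

(** Composing with the projection to cycles extends the class map to all chains, with value 0 on
    boundaries. It is a chain map to the homology with zero differential, and so can be applied to
    boundaries of the tensor complex. *)
Let etaD n : {linear D n -> homology D n} := hcls D n \o piD n.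
Let etaC n : {linear C n -> homology C n} := hcls C n \o piC n.

Let diff_rC n (b : bnd C n) : diff C n (rC n.+1 b) = incl _ (bcyc C n b).
Proof. exact: (congr1 (incl _) (@rCK n.+1 b)). Qed.

Let etaD_incl n z : etaD n (incl _ z) = hcls D n z.
Proof. by rewrite /etaD /= piDK. Qed.
Let etaC_incl n z : etaC n (incl _ z) = hcls C n z.
Proof. by rewrite /etaC /= piCK. Qed.
Let etaD_diff n x : etaD n (diff D n x) = 0.
Proof. by rewrite -[diff D n x]/(incl _ (dcyc D n x)) etaD_incl; apply/hcls_eq0; exists x. Qed.
Let etaC_diff n x : etaC n (diff C n x) = 0.
Proof. by rewrite -[diff C n x]/(incl _ (dcyc C n x)) etaC_incl; apply/hcls_eq0; exists x. Qed.

Let Jfun n : {linear Z2 n -> E n} :=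
  dtuple (fun p => tensor_map (incl _) (incl _) \o dproj p).
Let Qfun n : {linear Z2 n -> H2 n} :=
  dtuple (fun p => tensor_map (hcls C (bi p)) (hcls D (bj p)) \o dproj p).

Let Jfun_cyc n u : Jfun n u \in kern (dout E n).
Proof.
apply/kernP/tensor_cycle => p.
have J_E q : (Jfun n u : tensor_obj C D n) q = tensor_map (incl _) (incl _) (u q) by [].
rewrite !J_E tensor_map_comp0 => [|v w]; last by rewrite diff_cyc tens0l.
by rewrite tensor_map_comp0 => [|v w]; rewrite ?scaler0 ?addr0 // diff_cyc tens0r.
Qed.

Let Jcls n : {linear Z2 n -> homology E n} := hcls E n \o corestr (@Jfun_cyc n).

Let Qfun_surj n h : exists u, Qfun n u = h.
Proof.
have Qp p : exists u, tensor_map (hcls C (bi p)) (hcls D (bj p)) u = h p.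
  by apply: tensor_map_surj; exact: hcls_surj.
exists (fun p => projT1 (cid (Qp p))); apply: dsum_ext => p.
exact: (projT2 (cid (Qp p))).
Qed.

Let etaQ n u p : tensor_map (etaC (bi p)) (etaD (bj p)) ((Jfun n u : tensor_obj C D n) p) = Qfun n u p.
Proof. by apply: tensor_map_comp => z; [exact: etaC_incl | exact: etaD_incl]. Qed.

Let map_diff0 n (s : E n.+1) (q : bideg (summing_to n)) (X Y : lmodType K)
    (f : {linear C (bi q) -> X}) (g : {linear D (bj q) -> Y}) :
  (forall x, f (diff C _ x) = 0) -> (forall y, g (diff D _ y) = 0) ->
  tensor_map f g ((diff E n s : tensor_obj C D n) q) = 0.
Proof.
move=> f0 g0.
rewrite [X in tensor_map _ _ X]/(tensor_map (diff C (bi q)) idfun (s (bisl q)) +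
  (-1) ^+ bi q *: tensor_map idfun (diff D (bj q)) (s (bisr q))).
rewrite linearD linearZ /= tensor_map_comp0 => [|v w]; last by rewrite f0 tens0l.
by rewrite tensor_map_comp0 => [|v w]; rewrite ?scaler0 ?addr0 // g0 tens0r.
Qed.

(** The map etaC (x) etaD kills the boundaries of the tensor complex and restricts to [Qfun] on
    tensor products of cycles. *)
Let Jcls_eq0 n u : Jcls n u = 0 -> Qfun n u = 0.
Proof.
move=> /hcls_eq0[s /(congr1 (incl _)) su]; apply: dsum_ext => p.
rewrite -etaQ; have <- : diff E n s = Jfun n u by exact: su.
by apply: map_diff0; [exact: etaC_diff | exact: etaD_diff].
Qed.

Let asmE (n : nat) a b : E n := fun q => lshift (T := fun i j => tensor (C i) (D j)) a q +
                     rshift (T := fun i j => tensor (C i) (D j)) b q.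

Let Qfun_eq0 n u : Qfun n u = 0 -> Jcls n u = 0.
Proof.
move=> Qu0; apply/hcls_eq0.
(* The kernel of Z (x) Z -> H (x) H is the sum of the images of B (x) Z and Z (x) D: right exactness
   in the left factor produces [a], flatness of the cycles of C produces [b]. *)
have rep p : exists (a : tensor (bnd C (bi p)) (cyc D (bj p)))
    (b : tensor (cyc C (bi p)) (D (bj p).+1)),
    u p = tensor_map (bcyc C (bi p)) idfun a + tensor_map idfun (dcyc D (bj p)) b.
  have Qp0 : tensor_map (hcls C (bi p)) (hcls D (bj p)) (u p) = 0.
    exact: (congr1 (fun f : H2 n => f p) Qu0).
  have [|||b0 b0E] := @tensor_rexact _ _ _ _ _ (bcyc C (bi p)) (hcls C (bi p))
     (tensor_map idfun (hcls D (bj p)) (u p)).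
  - exact: hcls_surj.
  - exact: hcls_eq0_bnd.
  - by rewrite (tensor_map_comp (f'' := hcls C (bi p)) (g'' := hcls D (bj p))).
  have [||a a0] := @tensor_map_surj _ _ _ _ _ idfun (hcls D (bj p)) b0.
  - by move=> v; exists v.
  - exact: hcls_surj.
  have [||||b bE] := @proj_tensor_exact _ _ _ _ _ _ (dcyc D (bj p)) (hcls D (bj p)) (hcls D (bj p))
     (u p - tensor_map (bcyc C (bi p)) idfun a).
  - exact: cycC_proj.
  - by move=> z /hcls_eq0.
  - rewrite linearB /= (tensor_map_comp (f'' := bcyc C (bi p)) (g'' := hcls D (bj p))) //.
    rewrite -b0E -a0 (tensor_map_comp (f'' := bcyc C (bi p)) (g'' := hcls D (bj p))) //.
    by rewrite subrr.
  - rewrite linearB /= (tensor_map_comp (f'' := bcyc C (bi p)) (g'' := hcls D (bj p))) //.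
    rewrite -b0E -a0 (tensor_map_comp (f'' := bcyc C (bi p)) (g'' := hcls D (bj p))) //.
    by rewrite subrr.
  by exists a, b; rewrite bE addrC subrK.
pose a q := projT1 (cid (rep q)); pose b q := projT1 (cid (projT2 (cid (rep q)))).
have uE q : u q = tensor_map (bcyc C (bi q)) idfun (a q) + tensor_map idfun (dcyc D (bj q)) (b q).
  exact: (projT2 (cid (projT2 (cid (rep q))))).
(* The part [a] is lifted through the left differential by [rC]; the part [b] already lies over the
   right one, and its sign cancels that of the tensor differential. *)
exists (@asmE n.+1 (fun p => tensor_map (rC (bi p).+1) (incl _) (a (dn p)))
                (fun p => (-1) ^+ bi p *: tensor_map (incl _) idfun (b (dn p)))).
apply: incl_inj; apply: dsum_ext => q; have [p ->] := dn_surj q.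
rewrite -[LHS]/(diff E n _ (dn p)) tensor_diff_dn tensor_cycle_asm => [|{}p|{}p]; last first.
- rewrite linearZ /= tensor_map_comp0 ?scaler0 // => v w.
  by rewrite dout_cyc tens0l.
- by rewrite tensor_map_comp0 // => v w; rewrite dout_cyc tens0r.
rewrite -[RHS]/(tensor_map (incl _) (incl _) (u (dn p))) uE linearD /=.
rewrite linearZ scalerA -exprD addnn -mul2n exprM sqrrN !expr1n scale1r.
by congr (_ + _); apply: tensor_map_square.
Qed.

Let F_ex n : exists F : {linear H2 n -> homology E n},
  (forall u, F (Qfun n u) = Jcls n u) /\ injective F.
Proof.
have [F FQ] := @linear_factor _ _ _ _ (Qfun n) (Jcls n) (@Qfun_surj n) (@Qfun_eq0 n).
exists F; split=> //; apply: linear_inj => h.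
by have [u <-] := Qfun_surj h; rewrite FQ => /Jcls_eq0.
Qed.

(** Since 0 -> B_i -> Z_i -> H_i is a projective resolution, the kernel of this map is Tor_1 of
    H_i(C) and H_j(D). *)
Let Tp i j := tensor_map (bcyc C i) (idfun : {linear homology D j -> homology D j}).

Let th_ex i j : exists th : {linear submod (kern (Tp i j)) -> Tor1 (homology C i) (homology D j)},
    (forall x, th x = 0 -> x = 0) /\ (forall y, exists x, th x = y).
Proof.
apply: Tor1_comparison.
- exact: bndC_proj.
- exact: cycC_proj.
- exact: bcyc_inj.
- exact: hcls_bcyc.
- exact: hcls_eq0_bnd.
- exact: hcls_surj.
Qed.
Let th i j := projT1 (cid (th_ex i j)).
Let th_eq0 i j x : th i j x = 0 -> x = 0.
Proof. exact: (projT2 (cid (th_ex i j))).1. Qed.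
Let th_surj i j y : exists x, th i j x = y.
Proof. exact: (projT2 (cid (th_ex i j))).2. Qed.

Let delta i : {linear C i.+1 -> bnd C i} := corange (dout C i.+1).

Let G0 n (p : bideg (summing_to_pred n)) :
    {linear cyc E n -> tensor (bnd C (bi p)) (homology D (bj p))} :=
  tensor_map (delta (bi p)) (etaD (bj p)) \o dproj (bl p) \o incl _.

Let G0E n (p : bideg (summing_to_pred n)) z :
  G0 p z = tensor_map (delta (bi p)) (etaD (bj p)) ((incl _ z : tensor_obj C D n) (bl p)).
Proof. by []. Qed.

(** The cycle condition replaces d (x) eta on the component of bidegree (i + 1, j) by 1 (x) eta d,
    up to sign, on the one of bidegree (i, j + 1), and eta d = 0. This takes place in C_i (x) H_j,
    which contains Z_i (x) H_j because [piC] retracts C_i onto Z_i. *)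
Let G0_kern n (p : bideg (summing_to_pred n)) z : G0 p z \in kern (Tp (bi p) (bj p)).
Proof.
apply/kernP; rewrite G0E; set t := incl _ z.
have inc_inj (x : tensor (cyc C (bi p)) (homology D (bj p))) :
    tensor_map (incl _) idfun x = 0 -> x = 0.
  move=> x0; rewrite -[x]tensor_map_id.
  rewrite -(tensor_map_comp (f := incl _) (g := idfun) (f' := piC (bi p)) (g' := idfun)) => [|v|//].
    by rewrite x0 linear0.
  exact: piCK.
apply: inc_inj; rewrite (tensor_map_comp (f'' := dcyc C (bi p)) (g'' := etaD (bj p))) //; last first.
  by move=> v; exact: bcyc_corange.
rewrite (tensor_map_comp (f'' := diff C (bi p)) (g'' := etaD (bj p))) //.
rewrite -(tensor_map_comp (f := diff C (bi p)) (g := idfun) (f' := idfun) (g' := etaD (bj p))) //.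
have /tensor_cycle/(_ p)/eqP := dout_cyc z; rewrite -/t addr_eq0 => /eqP ->.
rewrite linearN linearZ /= tensor_map_comp0 ?scaler0 ?oppr0 // => v w.
by rewrite etaD_diff tens0r.
Qed.

Let G1 n : {linear cyc E n -> dsum (fun p : bideg (summing_to_pred n) =>
                           Tor1 (homology C (bi p)) (homology D (bj p)))} :=
  dtuple (fun p => th (bi p) (bj p) \o corestr (@G0_kern n p)).

Let G1_eq0 n z : G1 n z = 0 <-> forall p, G0 p z = 0.
Proof.
split=> [z0 p|z0].
  have : th (bi p) (bj p) (corestr (@G0_kern n p) z) = 0.
    by rewrite -[LHS]/((G1 n z) p) z0.
  by move=> /th_eq0/(congr1 (incl _)) z1; apply: etrans z1 _; rewrite linear0.
apply: dsum_ext => p; rewrite -[LHS]/(th (bi p) (bj p) (corestr (@G0_kern n p) z)).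
have -> : corestr (@G0_kern n p) z = 0 by apply: incl_inj; rewrite corestrE z0 linear0.
by rewrite linear0.
Qed.

Let delta_diff i x : delta i (diff C i.+1 x) = 0.
Proof. by apply/corange_eq0; exact: (@dout_diff _ C i.+1). Qed.

Let delta_incl i (z : cyc C i.+1) : delta i (incl _ z) = 0.
Proof. by apply/corange_eq0; exact: dout_cyc. Qed.

Let G1_bound n z : z \in bound (diff E n) (dout E n) -> G1 n z = 0.
Proof.
move=> /asboolP[s sz]; apply/G1_eq0 => p; rewrite G0E.
have <- : diff E n s = incl _ z by exact: sz.
apply: (@map_diff0 n s (bl p) _ _ (delta (bi p)) (etaD (bj p))).
  exact: delta_diff.
exact: etaD_diff.
Qed.

Let G n := sval (qlift (@G1_bound n)).
Let GE n z : G n (hcls E n z) = G1 n z.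
Proof. exact: (svalP (qlift (@G1_bound n))). Qed.

Let Jcls_G n u : G n (Jcls n u) = 0.
Proof.
rewrite [Jcls n u]/(hcls E n _) GE; apply/G1_eq0 => p; rewrite G0E corestrE.
rewrite -[X in tensor_map _ _ X]/(tensor_map (incl _) (incl _) (u (bl p))).
by rewrite tensor_map_comp0 // => v w; rewrite delta_incl tens0l.
Qed.

Let delta_total i j (x : tensor (C i.+2) (D j)) (y : tensor (C i.+1) (D j.+1)) :
  tensor_map (delta i) idfun (tensor_map (diff C i.+1) idfun x +
    (-1) ^+ i.+1 *: tensor_map idfun (diff D j) y) =
  (-1) ^+ i.+1 *: tensor_map (delta i) (diff D j) y.
Proof.
rewrite linearD linearZ tensor_map_comp0 => [|v w]; last by rewrite delta_diff tens0l.
by rewrite add0r; congr (_ *: _); apply: tensor_map_comp.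
Qed.

Let piC_diff0 i j (x : tensor (C i) (D j.+1)) :
  tensor_map idfun (diff D j) x = 0 ->
  tensor_map idfun (dout D j.+1) (tensor_map (piC i) idfun x) = 0.
Proof.
move=> x0; rewrite -[RHS](linear0 (tensor_map (piC i) idfun)) -x0.
by apply: tensor_map_square.
Qed.

(** A cycle z without Tor part is homologous to a sum of products of cycles. Its left differential
    [v] is killed by the differential and the classes of D, hence v = (1 (x) d) s by flatness of the
    boundaries. Subtracting the boundary of a lift [sigma] of s moves z into Z (x) D, and being a
    cycle it then lies in Z (x) Z. *)
Let exactness n (z : cyc E n) : G1 n z = 0 -> exists u, Jcls n u = hcls E n z.
Proof.
move=> /G1_eq0 z0; set t := incl _ z.
have t_cyc := (tensor_cycle t).1 (dout_cyc z).
pose v p := tensor_map (delta (bi p)) idfun ((t : tensor_obj C D n) (bl p)).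
have v1 p : tensor_map idfun (dout D (bj p)) (v p) = 0.
  case: p => i [|j] e; first exact: tensor_map0r.
  have e' : summing_to_pred n (i.+1 + j) by move: e; rewrite addnS.
  have tE : (t : tensor_obj C D n) (br (Bideg e')) =
            (t : tensor_obj C D n) (bl (Bideg e)) :> tensor (C i.+1) (D j.+1).
    exact: (bideg_irrelevance (T := fun i j => tensor (C i) (D j)) t (i := i.+1) (j := j.+1)).
  have := delta_total ((t : tensor_obj C D n) (bl (Bideg e'))) ((t : tensor_obj C D n) (br (Bideg e'))).
  rewrite (t_cyc (Bideg e')) linear0 tE => /(congr1 (fun x => (-1) ^+ i.+1 *: x)).
  rewrite scalerA -exprD addnn -mul2n exprM sqrrN !expr1n scale1r scaler0 => v0.
  by rewrite [RHS]v0; apply: tensor_map_comp.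
have v2 p : tensor_map idfun (etaD (bj p)) (v p) = 0.
  by rewrite -[RHS](z0 p) G0E; apply: tensor_map_comp.
have s_ex p : exists s : tensor (bnd C (bi p)) (D (bj p).+1),
    tensor_map idfun (diff D (bj p)) s = v p.
  apply: proj_tensor_exact (v1 p) (v2 p); first exact: bndC_proj.
  move=> w /kernP wk; rewrite -[w]/(incl _ (Submod wk)) etaD_incl => /hcls_eq0[w' w'E].
  by exists w'; rewrite -w'E.
pose s p := projT1 (cid (s_ex p)).
have sE p : tensor_map idfun (diff D (bj p)) (s p) = v p by exact: (projT2 (cid (s_ex p))).
(* The sign cancels the one which the differential attaches to 1 (x) d in left degree i + 1. *)
pose sigma : E n.+1 := lshift (T := fun i j => tensor (C i) (D j)) (fun p =>
  (-1) ^+ (bi p).+1 *: tensor_map (rC (bi p).+1) idfun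
     (rshift (T := fun i j => tensor (bnd C i) (D j)) s (dn p))).
have sigmaE p : tensor_map (delta (bi p)) idfun ((diff E n sigma : tensor_obj C D n) (bl p)) = v p.
  case: p => i j e.
  apply: etrans (delta_total (sigma (bisl (bl (Bideg e)))) (sigma (bisr (bl (Bideg e))))) _.
  have -> : sigma (bisr (bl (Bideg e))) =
      (-1) ^+ i.+1 *: tensor_map (rC i.+1) idfun (s (Bideg e)) :> tensor (C i.+1) (D j.+1).
    exact: (congr1 (fun x => (-1) ^+ i.+1 *: tensor_map (rC i.+1) idfun x)
      (@bideg_irrelevance (summing_to_pred n) (fun i j => tensor (bnd C i) (D j.+1)) s i j _ _)).
  rewrite linearZ scalerA -exprD addnn -mul2n exprM sqrrN !expr1n scale1r -sE.
  by apply: tensor_map_comp => // b; exact: (@rCK i.+1).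
pose z' := z - dcyc E n sigma; pose t' := incl _ z'.
have t'E : t' = t - diff E n sigma by rewrite /t' linearB.
have t'_cyc := (tensor_cycle t').1 (dout_cyc z').
have t'0 q : tensor_map (corange (dout C (bi q))) idfun ((t' : tensor_obj C D n) q) = 0.
  case: q => [[|i] j e].
    by apply: tensor_map0l => x; apply/corange_eq0.
  rewrite t'E -[X in tensor_map _ _ X]/((t : tensor_obj C D n) (bl (@Bideg (summing_to_pred n) i j e)) -
    (diff E n sigma : tensor_obj C D n) (bl (@Bideg (summing_to_pred n) i j e))).
  by rewrite linearB; apply/eqP; rewrite subr_eq0; apply/eqP; exact: (esym (sigmaE (@Bideg (summing_to_pred n) i j e))).
pose w q := tensor_map (piC (bi q)) idfun ((t' : tensor_obj C D n) q).
have wE q : tensor_map (incl _) idfun (w q) = (t' : tensor_obj C D n) q.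
  rewrite -[RHS]tensor_map_id.
  rewrite (@tensor_map_addl _ _ _ _ _ (incl _ \o piC (bi q))
     (rC (bi q) \o corange (dout C (bi q))) idfun idfun _ (@splitC (bi q))).
  rewrite -[X in _ + X](tensor_map_comp (f := corange (dout C (bi q))) (g := idfun)
     (f' := rC (bi q)) (g' := idfun)) //.
  by rewrite t'0 linear0 addr0; apply: tensor_map_comp.
have w0 q : tensor_map idfun (dout D (bj q)) (w q) = 0.
  case: q => i [|j] e; first exact: tensor_map0r.
  have e' : summing_to_pred n (i + j) by move: e; rewrite addnS.
  have tE : (t' : tensor_obj C D n) (br (Bideg e')) =
            (t' : tensor_obj C D n) (Bideg e) :> tensor (C i) (D j.+1).
    exact: (bideg_irrelevance (T := fun i j => tensor (C i) (D j)) t' (i := i) (j := j.+1)).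
  have dt'0 : tensor_map (diff C i) idfun ((t' : tensor_obj C D n) (bl (Bideg e'))) = 0.
    have := t'0 (bl (Bideg e')) => /(congr1 (tensor_map (incl _) idfun)).
    by rewrite linear0 => h0; rewrite -[RHS]h0; apply/esym/tensor_map_comp.
  have := t'_cyc (Bideg e').
  rewrite dt'0 add0r tE => /(congr1 (fun x => (-1) ^+ i *: x)).
  rewrite scalerA -exprD addnn -mul2n exprM sqrrN !expr1n scale1r scaler0 => dt0.
  exact: (piC_diff0 dt0).
have u_ex q : exists u : tensor (cyc C (bi q)) (cyc D (bj q)), tensor_map idfun (incl _) u = w q.
  apply: proj_tensor_exact (w0 q) (w0 q); first exact: cycC_proj.
  by move=> x /kernP xk _; exists (Submod xk).
pose u q := projT1 (cid (u_ex q)).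
have uE q : tensor_map idfun (incl _) (u q) = w q by exact: (projT2 (cid (u_ex q))).
exists u; have -> : hcls E n z = hcls E n z'.
  rewrite /z' linearB (_ : hcls E n (dcyc E n sigma) = 0) ?subr0 //.
  by apply/hcls_eq0; exists sigma.
congr (hcls E n _); apply: incl_inj; apply: dsum_ext => q.
rewrite -[RHS]wE -uE; apply/esym.
exact: tensor_map_comp.
Qed.

Let delta_incl_tensor i j s (y : tensor (cyc C i.+1) (D j)) :
  tensor_map (delta i) (etaD j) (- (s *: tensor_map (incl _) idfun y)) = 0.
Proof.
rewrite linearN linearZ tensor_map_comp0 /= ?scaler0 ?oppr0 // => v w.
by rewrite [X in tens X](delta_incl v) tens0l.
Qed.

(** An element of the kernel of [Tp] is lifted to v in B (x) Z. Its image in Z (x) Z has zero class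
    in Z (x) H, hence equals (1 (x) d) u. The lift of v through the left differential, in bidegree
    (i + 1, j), and u with a sign, in bidegree (i, j + 1), add up to a cycle over y. *)
Let G_surj n y : exists x, G n x = y.
Proof.
have k_ex p : exists k, th (bi p) (bj p) k = y p by exact: th_surj.
pose k p := projT1 (cid (k_ex p)).
have kE p : th (bi p) (bj p) (k p) = y p by exact: (projT2 (cid (k_ex p))).
have v_ex p : exists v : tensor (bnd C (bi p)) (cyc D (bj p)),
    tensor_map idfun (hcls D (bj p)) v = incl _ (k p).
  by apply: tensor_map_surj; [move=> b; exists b | exact: hcls_surj].
pose v p := projT1 (cid (v_ex p)).
have vE p : tensor_map idfun (hcls D (bj p)) (v p) = incl _ (k p).
  exact: (projT2 (cid (v_ex p))).
have u_ex p : exists u : tensor (cyc C (bi p)) (D (bj p).+1),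
    tensor_map idfun (dcyc D (bj p)) u = tensor_map (bcyc C (bi p)) idfun (v p).
  have v0 : tensor_map idfun (hcls D (bj p)) (tensor_map (bcyc C (bi p)) idfun (v p)) = 0.
    have /kernP := submodP (k p); rewrite -[submod_val _]/(incl _ (k p)) -vE => h0; rewrite -[RHS]h0.
    by apply: tensor_map_square.
  apply: (proj_tensor_exact _ _ v0 v0); first exact: cycC_proj.
  by move=> z /hcls_eq0.
pose u p := projT1 (cid (u_ex p)).
have uE p : tensor_map idfun (dcyc D (bj p)) (u p) = tensor_map (bcyc C (bi p)) idfun (v p).
  exact: (projT2 (cid (u_ex p))).
pose a p := tensor_map (rC (bi p).+1) (incl _) (v p).
pose b p := - ((-1) ^+ bi p *: tensor_map (incl _) idfun (u p)).
pose t : E n := asmE a b.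
have t_cyc : t \in kern (dout E n).
  apply/kernP/tensor_cycle => p; rewrite tensor_cycle_asm => [|{}p|{}p]; last first.
  - rewrite /b linearN linearZ /= tensor_map_comp0 ?scaler0 ?oppr0 // => x y'.
    by rewrite dout_cyc tens0l.
  - by rewrite tensor_map_comp0 // => x y'; rewrite dout_cyc tens0r.
  rewrite /b linearN linearZ scalerN scalerA -exprD addnn -mul2n exprM sqrrN !expr1n scale1r.
  rewrite /a (tensor_map_square (h := bcyc C (bi p)) (h' := incl _) (k := idfun) (k' := incl _)) //.
  by rewrite -uE; apply/eqP; rewrite subr_eq0; apply/eqP; apply: tensor_map_square.
exists (hcls E n (Submod t_cyc)); rewrite GE; apply: dsum_ext => p.
rewrite -[LHS]/(th (bi p) (bj p) (corestr (@G0_kern n p) (Submod t_cyc))) -kE.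
congr (th _ _ _); apply: incl_inj; rewrite corestrE G0E -vE.
rewrite -[X in tensor_map _ _ X]/(lshift (T := fun i j => tensor (C i) (D j)) a (bl p) +
  rshift (T := fun i j => tensor (C i) (D j)) b (bl p)).
have b0 : tensor_map (delta (bi p)) (etaD (bj p))
    (rshift (T := fun i j => tensor (C i) (D j)) b (bl p)) = 0.
  case: p => i [|j] e; first exact: linear0.
  exact: (delta_incl_tensor _ (u (@Bideg (summing_to_pred n) i.+1 j _))).
rewrite lshift_bl linearD b0 addr0 /a.
apply: tensor_map_comp => [x|x]; first exact: (@rCK (bi p).+1).
exact: etaD_incl.
Qed.

Lemma kunneth_split n : exists
    (f : {linear dsum (fun p : bideg (summing_to n) =>
                   tensor (homology C (bi p)) (homology D (bj p))) -> homology E n})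
    (g : {linear homology E n -> dsum (fun p : bideg (summing_to_pred n) =>
                   Tor1 (homology C (bi p)) (homology D (bj p)))}),
  short_exact f g.
Proof.
have [F [FQ F_inj]] := F_ex n; exists F, (G n); split=> // [y|y]; last exact: G_surj.
split=> [|[x <-]]; last by have [u <-] := Qfun_surj x; rewrite FQ Jcls_G.
have [z <-] := hcls_surj y; rewrite GE => /exactness[u uz].
by exists (Qfun n u); rewrite FQ.
Qed.

End Kunneth.

Theorem kunneth (K : comNzRingType) (C D : complex K) n :
  (forall n, projective (cyc C n)) -> (forall n, projective (submod (range (dout C n)))) ->
  (forall n, projective (submod (range (dout D n)))) ->
  exists
    (f : {linear dsum (fun p : bideg (summing_to n) =>
                   tensor (homology C (bi p)) (homology D (bj p))) ->
                 homology (tensor_complex C D) n})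
    (g : {linear homology (tensor_complex C D) n ->
                 dsum (fun p : bideg (summing_to_pred n) =>
                   Tor1 (homology C (bi p)) (homology D (bj p)))}),
  short_exact f g.
Proof.
move=> cycC rangeC rangeD.
pose sC n := cid (split_range (rangeC n)); pose sD n := cid (split_range (rangeD n)).
pose tC n := cid (projT2 (sC n)); pose tD n := cid (projT2 (sD n)).
apply: (@kunneth_split K C D (fun n => projT1 (sC n)) (fun n => projT1 (tC n))
  (fun n => projT1 (sD n))) => // m.
- by case: (projT2 (tC m)).
- by case: (projT2 (tC m)).
- by case: (projT2 (tC m)).
- by case: (projT2 (tD m)).
Qed.

(** * Simplices of all dimensions *)

Notation dim t := (@tag nat (fun n : nat => Choice.sort (simp _ n)) t).

Section TotalSimplices.
Variable X : sset.
Definition tot : choiceType := {n : nat & X n}.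
Implicit Types (t u v : {n : nat & X n}) (w : seq bool).

Lemma tag_tdegen i t : tag (tdegen i t) = (tag t).+1.
Proof. by []. Qed.

Lemma tag_tface i t : tag (tface i t) = (tag t).-1.
Proof. by case: t => [[|n] x]. Qed.

Lemma tfaceC i j t : (i <= j < tag t)%N -> (1 < tag t)%N ->
  tface i (tface j.+1 t) = tface j (tface i t).
Proof.
case: t => [[|[|n]] x] //= ij _.
by have [dd _ _ _ _] := sset_identities X; rewrite dd.
Qed.

(** [t] lies in the image of the i-th degeneracy; as d_i s_i = 1, the only possible preimage is the
    i-th face. *)
Definition dg t i := (i < tag t)%N && (tdegen i (tface i t) == t).

Lemma dg_lt t i : dg t i -> (i < tag t)%N.
Proof. by case/andP. Qed.

Lemma dgE t i : dg t i -> t = tdegen i (tface i t).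
Proof. by case/andP => _ /eqP. Qed.

Lemma dg_tdegen i u : (i <= tag u)%N -> dg (tdegen i u) i.
Proof. by move=> iu; rewrite /dg tag_tdegen ltnS iu tface_degen_eq ?eqxx. Qed.

Lemma dgP t i : dg t i -> exists2 u, (i <= tag u)%N & t = tdegen i u.
Proof.
move=> ti; exists (tface i t); last exact: dgE.
by rewrite tag_tface; have := dg_lt ti; case: (tag t).
Qed.

Lemma dg_tdegen_lt i j u : (i < j <= tag u)%N -> dg (tdegen j u) i = dg u i.
Proof.
case: j => [|j] /andP[] //; rewrite ltnS => ij ju; apply/idP/idP.
  move=> /dgP[v iv uv]; have tv : tag v = tag u by have [] := congr1 tag uv.
  have -> : u = tdegen i (tface j.+1 v).
    rewrite -(tface_degen_eqS ju) uv tface_degen_gt // tv.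
    by rewrite ltnS ij.
  by apply: dg_tdegen; rewrite tag_tface tv; move: (leq_ltn_trans ij ju); case: (tag u).
move=> /dgP[w iw uw]; have tw : tag u = (tag w).+1 by rewrite uw.
rewrite uw -tdegenC; last by rewrite ij -ltnS -tw.
by apply: dg_tdegen; rewrite tag_tdegen; apply: leq_trans iw _.
Qed.

Lemma dg_tdegen_ge i j u : (j <= i)%N -> (j <= tag u)%N -> dg (tdegen j u) i.+1 = dg u i.
Proof.
move=> ji ju; apply/idP/idP.
  move=> /dgP[v iv uv]; have tv : tag v = tag u by have [] := congr1 tag uv.
  have -> : u = tdegen i (tface j v).
    by rewrite -(tface_degen_eq ju) uv tface_degen_lt.
  by apply: dg_tdegen; rewrite tag_tface; case: (tag v) iv.
move=> /dgP[w iw uw]; have tw : tag u = (tag w).+1 by rewrite uw.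
rewrite uw tdegenC ?ji //; apply: dg_tdegen; exact: iw.
Qed.

Lemma dg_tface_lt i j t : (i.+1 < j <= tag t)%N -> dg t i -> dg (tface j t) i.
Proof.
case: j => [|j] /andP[] //; rewrite ltnS => ij jt /dgP[u iu tu].
move: jt; rewrite tu ltnS => ju; rewrite tface_degen_gt ?ij //.
by apply: dg_tdegen; rewrite tag_tface; move: (leq_trans ij ju); case: (tag u).
Qed.

Lemma dg_tface_ge i j t : (j <= i)%N -> dg t i.+1 -> dg (tface j t) i.
Proof.
move=> ji /dgP[u iu tu]; rewrite tu tface_degen_lt //.
by apply: dg_tdegen; rewrite tag_tface; case: (tag u) iu.
Qed.

Lemma tface_dg i t : dg t i -> tface i.+1 t = tface i t.
Proof. by move=> /dgP[u iu ->]; rewrite tface_degen_eq ?tface_degen_eqS. Qed.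

Lemma dg_tface_both i t : dg t i -> dg t i.+1 -> dg (tface i.+1 t) i.
Proof. by move=> ti ti1; rewrite tface_dg //; apply: dg_tface_ge. Qed.

Definition nd t := ~~ has (dg t) (iota 0 (tag t)).

Lemma ndP t : reflect (forall i, ~~ dg t i) (nd t).
Proof.
apply: (iffP hasPn) => [tn i|tn i _]; last exact: tn.
by apply/negP => ti; have := tn i; rewrite mem_iota ti dg_lt // => /(_ isT).
Qed.

Lemma ndPn t : ~~ nd t -> exists i, dg t i.
Proof. by move/negPn/hasP => [i _ ti]; exists i. Qed.

(* [sg p w] degenerates at the positions of [false] in [w], counted from [p]. *)
Fixpoint sg (p : nat) w t : {n : nat & X n} :=
  if w is b :: w' then sg p.+1 w' (if b then t else tdegen p t) else t.

Fixpoint ret (p : nat) w t : {n : nat & X n} :=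
  if w is b :: w' then (if b then ret p.+1 w' t else tface p (ret p.+1 w' t)) else t.

Lemma tag_sg p w t : tag (sg p w t) = (tag t + count negb w)%N.
Proof.
by elim: w p t => [|[] w IH] p t /=; rewrite ?addn0 // IH ?add0n // tag_tdegen addSn addnS.
Qed.

Lemma ret_sg p w t : (p + count id w <= tag t)%N -> ret p w (sg p w t) = t.
Proof.
elim: w p t => [|[] w IH] p t //= pw; rewrite IH ?tag_tdegen //; try lia.
by rewrite tface_degen_eq //; lia.
Qed.

Lemma dg_sg_low p w t m : (p + count id w <= tag t)%N -> (m < p)%N ->
  dg (sg p w t) m = dg t m.
Proof.
elim: w p t => [|[] w IH] p t //= pw mp; rewrite IH ?tag_tdegen //; try lia.
by rewrite dg_tdegen_lt // mp; lia.
Qed.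

Lemma dg_sg_false p w t i : (p + count id w <= tag t)%N -> (i < size w)%N ->
  ~~ nth true w i -> dg (sg p w t) (p + i)%N.
Proof.
elim: w p t i => [|b w IH] p t [|i] //= pw iw wi; last first.
  rewrite addnS -addSn; apply: IH => //.
  by case: b pw => /=; rewrite ?tag_tdegen; lia.
case: b pw wi => //= pw _; rewrite add0n in pw.
rewrite addn0 dg_sg_low ?tag_tdegen ?addSn ?ltnS //.
by apply: dg_tdegen; lia.
Qed.

Lemma dg_sg_nd p w t i : (p + count id w <= tag t)%N -> (i < size w)%N ->
  (forall j, (p <= j)%N -> ~~ dg t j) ->
  dg (sg p w t) (p + i)%N = ~~ nth true w i.
Proof.
elim: w p t i => [|b w IH] p t [|i] //= pw iw tn; last first.
  rewrite addnS -addSn; apply: IH => //.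
    by case: b pw => /=; rewrite ?tag_tdegen; lia.
  case: b pw => /= pw j pj; first by apply: tn; exact: ltnW.
  case: j pj => // j pj; rewrite dg_tdegen_ge //; first exact: tn.
  by move: pw; rewrite /=; lia.
case: b pw => /= pw.
  rewrite addn0 dg_sg_low //; first exact/negbTE/tn.
  by move: pw; rewrite /=; lia.
rewrite add0n in pw; rewrite addn0 dg_sg_low ?tag_tdegen ?addSn ?ltnS //.
by apply: dg_tdegen; lia.
Qed.

(** A degenerate direction j of t survives in [sg p w t]: each letter [false] met before it raises
    it by one, until it coincides with the position of a letter [true]. *)
Lemma dg_sg_true p w t j : tag t = (p + count id w)%N -> (p <= j)%N -> dg t j ->
  exists i, [/\ (i < size w)%N, nth true w i & dg (sg p w t) (p + i)%N].
Proof.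
elim: w p t j => [|b w IH] p t j /= tp pj tj.
  by have := dg_lt tj; rewrite tp addn0 ltnNge pj.
case: b tp => /= tp.
  rewrite add1n addnS -addSn in tp.
  have [pj1|jp] := leqP p.+1 j.
    have [i [iw wi ti]] := IH _ _ _ tp pj1 tj; exists i.+1; split=> //.
    by rewrite addnS -addSn.
  have jE : j = p by apply/eqP; rewrite eqn_leq pj -ltnS jp.
  by exists 0; split=> //; rewrite addn0 dg_sg_low ?tp // -jE.
rewrite add0n in tp.
have pt : (p <= tag t)%N by rewrite tp leq_addr.
have [|||i [iw wi ti]] := IH p.+1 (tdegen p t) j.+1.
- by rewrite tag_tdegen tp addSn.
- by rewrite ltnS.
- by rewrite dg_tdegen_ge.
by exists i.+1; split=> //; rewrite addnS -addSn.
Qed.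

Fixpoint falses (p : nat) w : seq nat :=
  if w is b :: w' then (if b then falses p.+1 w' else p :: falses p.+1 w') else [::].

Lemma sg_degen_word p w t : sg p w t = degen_word (falses p w) t.
Proof. by elim: w p t => [|[] w IH] p t //=; rewrite IH. Qed.

End TotalSimplices.

Lemma mem_falses p w i : (i \in falses p w) =
  (p <= i < p + size w)%N && ~~ nth true w (i - p).
Proof.
elim: w p => [|b w IH] p /=; first by rewrite addn0; case: leqP.
have -> : (i \in (if b then falses p.+1 w else p :: falses p.+1 w)) =
   (~~ b && (i == p)) || (i \in falses p.+1 w) by case: b; rewrite ?inE.
rewrite IH; have [->|ip] := eqVneq i p.
  by rewrite subnn leqnn addnS ltnS leq_addr ltnn /= andbT orbF.
rewrite andbF /= addnS addSn ltn_neqAle eq_sym ip /=.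
have [pi|//] := leqP p i; have : (p < i)%N by rewrite ltn_neqAle eq_sym ip.
by move=> {}pi; rewrite -[(i - p)%N]prednK ?subn_gt0 // subnS.
Qed.

Lemma sorted_falses p w : sorted ltn (falses p w).
Proof.
elim: w p => [|[] w IH] p //=; rewrite path_min_sorted //.
by apply/allP => i; rewrite mem_falses => /andP[/andP[]].
Qed.

Lemma size_falses p w : size (falses p w) = count negb w.
Proof. by elim: w p => [|[] w IH] p //=; rewrite IH. Qed.

(** The word is the characteristic function of mu. Both sequences are recovered from it because a
    sorted sequence is determined by its elements. *)
Lemma shuffle_word k l mu nu : shuffle k l mu nu -> exists w : seq bool,
  [/\ count id w = k, count negb w = l, mu = falses 0 (map negb w) & nu = falses 0 w].
Proof.
move=> sh; have [szm szn smu snu e] := sh.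
pose w := [seq i \in mu | i <- iota 0 (k + l)].
have wi i : (i < k + l)%N -> nth true w i = (i \in mu).
  by move=> ikl; rewrite (nth_map 0) ?size_iota // nth_iota.
have nwi i : (i < k + l)%N -> nth true (map negb w) i = (i \notin mu).
  by move=> ikl; rewrite (nth_map true) ?size_map ?size_iota // wi.
have sw : size w = (k + l)%N by rewrite size_map size_iota.
have eq_s (s : seq nat) v : sorted ltn s -> s =i falses 0 v -> s = falses 0 v.
  by move=> ss; apply: irr_sorted_eq ss (sorted_falses _ _); [exact: ltn_trans | exact: ltnn].
have muE : mu = falses 0 (map negb w).
  apply: eq_s => // i; rewrite mem_falses size_map sw add0n subn0 /=.
  have := e i; rewrite mem_iota /= add0n mem_cat; case: ltnP => ikl.
    by rewrite nwi // negbK.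
  by move=> /negbT/norP[/negbTE].
have nuE : nu = falses 0 w.
  apply: eq_s => // i; rewrite mem_falses sw add0n subn0 /=.
  have := e i; rewrite mem_iota /= add0n mem_cat; case: ltnP => ikl.
    rewrite wi //; case: (boolP (i \in mu)) => //= imu _; first exact/negbTE/(shuffle_disjoint sh).
  by move=> /negbT/norP[_ /negbTE].
exists w; split=> //; last by rewrite -szn nuE size_falses.
by rewrite -szm muE size_falses count_map; apply: eq_count => b /=; rewrite negbK.
Qed.

Lemma word_shuffle (w : seq bool) :
  shuffle (count id w) (count negb w) (falses 0 (map negb w)) (falses 0 w).
Proof.
split; rewrite ?size_falses ?sorted_falses ?count_map //.
  by apply: eq_count => b /=; rewrite negbK.
move=> i; rewrite mem_cat !mem_falses size_map subn0 mem_iota /= !add0n.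
have -> : (count id w + count negb w)%N = size w by rewrite -(count_predC id w).
case: ltnP => //= iw; rewrite (nth_map true) // negbK orbN //.
Qed.

Section FreeMaps.
Context {K : comNzRingType}.

Lemma linear_mem (X : choiceType) (V : lmodType K) (f : {linear {malg K[X]} -> V})
    (S : submodule V) (a : {malg K[X]}) :
  (forall x, x \in msupp a -> f << x >> \in S) -> f a \in S.
Proof.
move=> fS; rewrite [a]malg_sum linear_sum big_seq; apply: rpred_sum => x xa.
by rewrite linearZ; apply: rpredZ; exact: fS.
Qed.

Lemma mcoeff_fmapf (X Y : choiceType) (f : X -> Y) (a : {malg K[X]}) x :
  injective f -> (fmapf f a)@_(f x) = a@_x.
Proof.
move=> f_inj; apply: (free_ext (f := coef (f x) \o fmapf f) (g := coef x)) => y /=.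
by rewrite fmapfU /coef_fun !mcoeffU (inj_eq f_inj).
Qed.

Lemma fmapf_inj (X Y : choiceType) (f : X -> Y) :
  injective f -> injective (fmapf f : {malg K[X]} -> {malg K[Y]}).
Proof. by move=> f_inj a b ab; apply/malgP => x; rewrite -!(mcoeff_fmapf _ _ f_inj) ab. Qed.

End FreeMaps.

Arguments fmapf : simpl never.

(** * Faces, degeneracies and Moore chains in all degrees at once *)

Section TotalModule.
Context {K : comNzRingType} {X : sset}.
Local Notation A := {malg K[tot X]}.
Implicit Types (t u : {n : nat & X n}) (a b : A).

(* The operators vanish out of range, so that all the simplicial identities
   hold without side conditions on degrees, except [fd j \o sd j = id]. *)
Fact fd_subproof i : {f : {linear A -> A} | forall t, f << (t : tot X) >> =
  if (0 < dim t)%N && (i <= dim t)%N then << (tface i t : tot X) >> else 0}.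
Proof.
exists (flift (fun t : tot X =>
  if (0 < dim t)%N && (i <= dim t)%N then << (tface i t : tot X) >> else 0)) => t.
exact: fliftU.
Qed.
Definition fd i : {linear A -> A} := sval (fd_subproof i).

Lemma fdU i t : fd i << (t : tot X) >> =
  if (0 < dim t)%N && (i <= dim t)%N then << (tface i t : tot X) >> else 0.
Proof. exact: (svalP (fd_subproof i)). Qed.

Fact sd_subproof i : {f : {linear A -> A} | forall t, f << (t : tot X) >> =
  if (i <= dim t)%N then << (tdegen i t : tot X) >> else 0}.
Proof.
exists (flift (fun t : tot X => if (i <= dim t)%N then << (tdegen i t : tot X) >> else 0)) => t.
exact: fliftU.
Qed.
Definition sd i : {linear A -> A} := sval (sd_subproof i).

Lemma sdU i t : sd i << (t : tot X) >> =
  if (i <= dim t)%N then << (tdegen i t : tot X) >> else 0.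
Proof. exact: (svalP (sd_subproof i)). Qed.

Lemma fd_sd_lt i j a : (i <= j)%N -> fd i (sd j.+1 a) = sd j (fd i a).
Proof.
move=> ij; apply: (free_ext (f := fd i \o sd j.+1) (g := sd j \o fd i)) => t /=.
rewrite sdU [fd i << _ >>]fdU; case: ifP => [jt|/negbT jt].
  rewrite fdU tag_tdegen ifT; last by lia.
  by rewrite ifT ?sdU ?tag_tface ?tface_degen_lt // ?ifT //; lia.
by rewrite linear0; case: ifP => [it|_]; rewrite ?linear0 // sdU tag_tface ifF //; lia.
Qed.

Lemma fd_sd_gt i j a : (j < i)%N -> fd i.+1 (sd j a) = sd j (fd i a).
Proof.
move=> ji; apply: (free_ext (f := fd i.+1 \o sd j) (g := sd j \o fd i)) => t /=.
rewrite sdU [fd i << _ >>]fdU; case: (ltnP 0 (dim t)) => t0 /=; last first.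
  by rewrite linear0; case: ifP => [jt|_]; rewrite ?linear0 // fdU tag_tdegen ifF //; lia.
case: (leqP i (dim t)) => it.
  rewrite ifT; last by lia.
  by rewrite fdU sdU tag_tdegen tag_tface !ifT ?tface_degen_gt ?ji //; lia.
rewrite linear0; case: ifP => [jt|_]; rewrite ?linear0 // fdU tag_tdegen ifF //; lia.
Qed.

Lemma sd_sd i j a : (i <= j)%N -> sd i (sd j a) = sd j.+1 (sd i a).
Proof.
move=> ij; apply: (free_ext (f := sd i \o sd j) (g := sd j.+1 \o sd i)) => t /=.
rewrite !sdU; case: (leqP j (dim t)) => jt.
  rewrite (leq_trans ij jt) [sd i << _ >>]sdU [sd j.+1 << _ >>]sdU !tag_tdegen.
  rewrite ltnS.
  rewrite jt.
  rewrite ifT; last by lia.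
  by rewrite tdegenC // ij.
rewrite linear0; case: ifP => it; rewrite ?linear0 // sdU tag_tdegen ifF //; lia.
Qed.

Lemma fd_fd i j a : (i <= j)%N -> fd i (fd j.+1 a) = fd j (fd i a).
Proof.
move=> ij; apply: (free_ext (f := fd i \o fd j.+1) (g := fd j \o fd i)) => t /=.
rewrite !fdU; case: (ltnP 0 (dim t)) => t0 /=; last by rewrite !linear0.
case: (ltnP j (dim t)) => jt.
  rewrite ifT; last by lia.
  rewrite [fd i << _ >>]fdU [fd j << _ >>]fdU !tag_tface.
  case: (ltnP 1 (dim t)) => t1; last by rewrite !ifF //; lia.
  by rewrite !ifT ?tfaceC ?ij //; lia.
rewrite linear0; case: ifP => it; rewrite ?linear0 // fdU tag_tface ifF //; lia.
Qed.

Lemma fd_sd j a : fd j (sd j a) = restr (fun t : tot X => j <= dim t)%N a.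
Proof.
apply: (free_ext (f := fd j \o sd j) (g := restr _)) => t /=.
rewrite sdU restrU; case: ifP => jt; rewrite ?linear0 // fdU tag_tdegen ifT ?tface_degen_eq //; lia.
Qed.

Lemma fd_sdS j a : fd j.+1 (sd j a) = restr (fun t : tot X => j <= dim t)%N a.
Proof.
apply: (free_ext (f := fd j.+1 \o sd j) (g := restr _)) => t /=.
rewrite sdU restrU; case: ifP => jt; rewrite ?linear0 // fdU tag_tdegen ifT ?tface_degen_eqS //; lia.
Qed.

Lemma sd_fd_sd j a : sd j (fd j.+1 (sd j a)) = sd j a.
Proof.
apply: (free_ext (f := sd j \o fd j.+1 \o sd j) (g := sd j)) => t /=.
by rewrite fd_sdS restrU; case: ifP => jt //; rewrite linear0 sdU jt.
Qed.

Lemma fd_sd_fd j a : fd j.+1 (sd j (fd j.+1 a)) = fd j.+1 a.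
Proof.
apply: (free_ext (f := fd j.+1 \o sd j \o fd j.+1) (g := fd j.+1)) => t /=.
rewrite fd_sdS fdU; case: ifP => jt; last by rewrite linear0.
by rewrite restrU tag_tface ifT //; lia.
Qed.

Definition hom n : submodule A := free_on K (fun t : tot X => tag t = n).

Lemma homP n a : a \in hom n <-> forall t, (t : tot X) \in msupp a -> tag t = n.
Proof. by split=> [/asboolP|?]; last exact/asboolP. Qed.

Lemma homU t : << (t : tot X) >> \in hom (dim t).
Proof. by apply/homP => u /(fsubsetP msuppU_le); rewrite inE => /eqP ->. Qed.

Lemma hom_out n a t : a \in hom n -> tag t <> n -> a@_(t : tot X) = 0.
Proof. by move=> /homP ah tn; apply/mcoeff_outdom/negP => /ah. Qed.

Lemma fd_hom n i a : a \in hom n.+1 -> fd i a \in hom n.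
Proof.
move=> /homP ah; apply: linear_mem => t /ah tn; rewrite fdU; case: ifP => _; last exact: rpred0.
by rewrite -[n]/(n.+1.-1) -tn -(tag_tface i); exact: homU.
Qed.

Lemma sd_hom n i a : a \in hom n -> sd i a \in hom n.+1.
Proof.
move=> /homP ah; apply: linear_mem => t /ah tn; rewrite sdU; case: ifP => _; last exact: rpred0.
by rewrite -tn -(tag_tdegen i); exact: homU.
Qed.

Lemma fd_out n i a : a \in hom n -> (n < i)%N || (n == 0%N) -> fd i a = 0.
Proof.
move=> /homP ah ni; apply: etrans (_ : (\0 : {linear A -> A}) a = 0) => //.
by apply: linear_supp_eq => t /ah tn; rewrite fdU tn ifF //; lia.
Qed.

Lemma fd_sd_hom n j a : a \in hom n -> (j <= n)%N -> fd j (sd j a) = a.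
Proof.
move=> /homP ah jn; rewrite fd_sd; apply: etrans (_ : idfun a = a) => //.
by apply: (linear_supp_eq (f := restr _) (g := idfun)) => t /ah tn; rewrite restrU tn jn.
Qed.

Lemma sd_nd m a t : nd t -> (sd m a)@_(t : tot X) = 0.
Proof.
move=> /ndP tn; rewrite linear_fliftE raddf_sum big1 // => u _ /=; rewrite mcoeffZ sdU.
case: ifP => mu; last by rewrite mcoeff0 mulr0.
rewrite mcoeffU; case: eqP => [ut|]; last by rewrite mulr0.
by have := tn m; rewrite -ut dg_tdegen.
Qed.

Definition first t := find (dg t) (iota 0 (dim t)).

Lemma dg_first t : ~~ nd t -> dg t (first t).
Proof.
move=> /negPn th; have := nth_find 0 th.
have ft : (first t < dim t)%N by rewrite -[X in (_ < X)%N](size_iota 0) -has_find.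
by rewrite nth_iota.
Qed.

Lemma degenerate_sum n a : a \in hom n -> (forall t, nd t -> a@_(t : tot X) = 0) ->
  exists b : nat -> A, a = \sum_(i < n) sd i (b i).
Proof.
move=> /homP ah a0.
pose h i (t : tot X) : A := if first t == i then << (tface i t : tot X) >> else 0.
exists (fun i => flift (h i) a).
have -> : \sum_(i < n) sd i (flift (h i) a) =
    \sum_(t <- msupp a) a@_t *: \sum_(i < n) sd i (h i t).
  under [RHS]eq_bigr do rewrite scaler_sumr.
  rewrite exchange_big /=; apply: eq_bigr => i _.
  by rewrite /flift linear_sum; apply: eq_bigr => t _; rewrite linearZ.
rewrite [LHS]malg_sum; apply: eq_big_seq => t ta; congr (_ *: _).
have tdg : dg t (first t).
  by apply/dg_first/negP => /a0/eqP; rewrite mcoeff_eq0 ta.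
have tn : dim t = n by exact: ah.
have ft : (first t < n)%N by rewrite -tn; exact: dg_lt.
rewrite (bigD1 (Ordinal ft)) //= big1 ?addr0 => [|i it].
  rewrite /h eqxx sdU tag_tface ifT; last by lia.
  by rewrite -(dgE tdg).
by rewrite /h ifF ?linear0 //; apply/eqP => fi; case/eqP: it; apply: val_inj.
Qed.

(** Applying s_m d_(m+1) to the sum gives 0 on the Moore chain a, so s_m b_m is minus the image of
    the lower summands. By the simplicial identities that image is again a sum of s_i with i < m,
    and the top term is eliminated. *)
Lemma moore_sum0 m (b : nat -> A) a : (forall i, fd i.+1 a = 0) ->
  a = \sum_(i < m) sd i (b i) -> a = 0.
Proof.
elim: m b => [|m IH] b a0; first by rewrite big_ord0.
rewrite big_ord_recr /= => aE.
apply: (IH (fun i => b i - sd m.-1 (fd m (b i)))) => //.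
have -> : \sum_(i < m) sd i (b i - sd m.-1 (fd m (b i))) =
    \sum_(i < m) sd i (b i) - sd m (fd m.+1 (\sum_(i < m) sd i (b i))).
  rewrite (linear_sum (fd _)) (linear_sum (sd _)) -sumrB; apply: eq_bigr => -[i im] _ /=.
  rewrite fd_sd_gt // linearB /=; congr (_ - _).
  by rewrite (@sd_sd i m.-1) ?prednK //; lia.
have -> : \sum_(i < m) sd i (b i) = a - sd m (b m) by rewrite aE addrK.
by rewrite (linearB (fd _)) a0 sub0r (linearN (sd _)) sd_fd_sd opprK subrK.
Qed.

Lemma moore_degenerate0 n a : a \in hom n -> (forall i, fd i.+1 a = 0) ->
  (forall t, nd t -> a@_(t : tot X) = 0) -> a = 0.
Proof.
by move=> ah a0 /(degenerate_sum ah)[b ab]; exact: (moore_sum0 (m := n) (b := b)).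
Qed.

(** Passing from b to b - s_k d_(k+1) b for k = n - 1, ..., 0 kills the faces d_n, ..., d_1 in this
    order. Each step only adds degenerate simplices. *)
Lemma moore_rep n a : a \in hom n -> exists b,
  [/\ b \in hom n, forall i, fd i.+1 b = 0 & forall t, nd t -> b@_(t : tot X) = a@_t].
Proof.
move=> ah; suff H m : (m <= n)%N -> exists b, [/\ b \in hom n,
    forall i, (n - m <= i)%N -> fd i.+1 b = 0 & forall t, nd t -> b@_(t : tot X) = a@_t].
  have [b [bh b0 ba]] := H n (leqnn n); exists b; split=> // i.
  by apply: b0; rewrite subnn.
elim: m => [|m IH] mn.
  exists a; split=> // i; rewrite subn0 => ni.
  by apply: (fd_out ah); rewrite ltnS ni.
have [b [bh b0 ba]] := IH (ltnW mn); pose k := (n - m.+1)%N.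
exists (b - sd k (fd k.+1 b)); split=> [|i ki|t tn].
- rewrite rpredB //; have -> : n = n.-1.+1 by lia.
  by apply/sd_hom/fd_hom; rewrite prednK //; lia.
- rewrite linearB /=; have [->|ik] := eqVneq i k; first by rewrite fd_sd_fd subrr.
  have ki' : (k < i)%N by rewrite ltn_neqAle eq_sym ik.
  have b1 : fd i.+1 b = 0 by apply: b0; rewrite /k in ki'; lia.
  by rewrite b1 fd_sd_gt // -fd_fd // b1 (linear0 (fd _)) (linear0 (sd _)) subrr.
- by rewrite mcoeffB sd_nd // subr0 ba.
Qed.

Lemma moore_projection : exists rho : {linear A -> A}, forall a,
  [/\ forall n, a \in hom n -> rho a \in hom n, forall i, fd i.+1 (rho a) = 0
    & forall t, nd t -> (rho a)@_(t : tot X) = a@_t].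
Proof.
have [r rP] := choice (fun t : {n : nat & X n} => moore_rep (homU t)).
pose R : {linear A -> A} := flift (r : tot X -> A).
have RU t : R << (t : tot X) >> = r t by exact: fliftU.
exists R => a; split=> [n /homP ah|i|t tn].
- by apply: linear_mem => t /ah <-; rewrite RU; case: (rP t).
- apply: (free_ext (f := fd i.+1 \o R) (g := \0)) => t.
  apply: etrans (congr1 (fd i.+1) (RU t)) _; by case: (rP t) => _ ->.
- apply: (free_ext (f := coef (t : tot X) \o R) (g := coef (t : tot X))) => u.
  apply: etrans (congr1 (coef (t : tot X)) (RU u)) _.
  by rewrite !coefE; case: (rP u) => _ _ ->.
Qed.

(** Degenerate chains form a subcomplex: in the boundary of s_j b the faces j and j + 1 cancel, and
    all others remain degenerate. *)
Lemma boundary_degenerate n a : a \in hom n -> (forall t, nd t -> a@_(t : tot X) = 0) ->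
  forall t, nd t -> (\sum_(i < n.+1) (-1) ^+ i *: fd i a)@_(t : tot X) = 0.
Proof.
move=> ah a0 t tn; have [b ->] := degenerate_sum ah a0.
rewrite (_ : \sum_(i < n.+1) _ = \sum_(j < n) \sum_(i < n.+1) (-1) ^+ i *: fd i (sd j (b j))).
  rewrite raddf_sum /= big1 // => -[j jn] _ /=; rewrite raddf_sum /=.
  have g0 i : i != j -> i != j.+1 -> (fd i (sd j (b j)))@_(t : tot X) = 0.
    move=> ij ij1; have [lt_ij|le_ji] := ltnP i j.
      by rewrite -[j](@prednK) 1?fd_sd_lt ?sd_nd //; lia.
    by rewrite -[i](@prednK) 1?fd_sd_gt ?sd_nd //; lia.
  have j1 : (j < n.+1)%N by lia.
  rewrite (bigD1 (Ordinal j1)) //= (bigD1 (Ordinal (jn : j.+1 < n.+1)%N)) /=; last first.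
    by rewrite -val_eqE /=; lia.
  rewrite [X in _ + (_ + X)]big1 => [|i /andP[ij ij1]]; last by rewrite mcoeffZ g0 ?mulr0.
  by rewrite fd_sd fd_sdS exprS mulN1r scaleNr mcoeffN addr0 subrr.
rewrite exchange_big /=; apply: eq_bigr => i _.
by rewrite linear_sum scaler_sumr.
Qed.

End TotalModule.

Arguments fd {K X} i : simpl never.
Arguments sd {K X} i : simpl never.

(** * Omega as a condition on nondegenerate coefficients *)

Section OmegaTotal.
Context {K : comNzRingType} (S : path_pair).
Implicit Types (t : {n : nat & S n}).

Definition in_pp t : Prop := pp_sub (tagged t).

Definition nd_in_pp (a : {malg K[tot S]}) : Prop :=
  forall t, nd t -> a@_(t : tot S) != 0 -> in_pp t.

(* Since rho preserves the coefficients at nondegenerate simplices, membership of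
   a Moore chain in the image of K[Y] only involves these coefficients. *)
Definition Om n (a : {malg K[tot S]}) : Prop :=
  [/\ a \in hom n, forall i, fd i.+1 a = 0, nd_in_pp a & nd_in_pp (fd 0 a)].

Definition emb_pt n (x : S n) : tot S := Tagged (fun n => S n) x.

Lemma emb_pt_inj n : injective (@emb_pt n).
Proof. by move=> x y /eqP; rewrite eq_Tagged => /eqP. Qed.

Definition emb n : {linear {malg K[S n]} -> {malg K[tot S]}} := fmapf (@emb_pt n).

Lemma embU n (x : S n) : emb n << x >> = << emb_pt x >>.
Proof. exact: fmapfU. Qed.

Lemma mcoeff_emb n a (x : S n) : (emb n a)@_(emb_pt x) = a@_x.
Proof. exact: (mcoeff_fmapf _ _ (@emb_pt_inj n)). Qed.

Lemma emb_inj n : injective (emb n).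
Proof. exact: (fmapf_inj (@emb_pt_inj n)). Qed.

Lemma emb_hom n a : emb n a \in hom n.
Proof. by apply: linear_mem => x _; rewrite embU; exact: (homU (emb_pt x)). Qed.

Lemma hom_emb n a : a \in hom n -> exists b, emb n b = a.
Proof.
move=> /homP ah; apply/rangeP; apply: malg_mem => -[m x] /ah /= mn; subst m.
by apply/rangeP; exists << x >>; rewrite embU.
Qed.

Lemma nd_in_pp_emb n (a : {malg K[S n]}) :
  (forall x : S n, nd (emb_pt x) -> a@_x != 0 -> pp_sub x) <-> nd_in_pp (emb n a).
Proof.
split=> [aY [m x] tn|aY x xn ax]; last first.
  by apply: (aY (emb_pt x)); rewrite ?mcoeff_emb.
have [mn|/eqP mn] := eqVneq m n; last first.
  by rewrite (hom_out (emb_hom a)) ?eqxx // => /esym.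
by subst m; rewrite mcoeff_emb; exact: aY.
Qed.

Local Notation F := (free_smodule K S).

Lemma emb_face n (i : 'I_n.+2) a : emb n (mface F i a) = fd i (emb n.+1 a).
Proof.
apply: (free_ext (f := emb n \o mface F i) (g := fd i \o emb n.+1)) => x.
apply: etrans (congr1 (emb n) (fmapfU _ x)) _.
apply: etrans (esym (congr1 (fd i) (embU x))).
by rewrite embU fdU /= -ltnS ltn_ord /emb_pt inord_val.
Qed.

Lemma emb_degen n (i : 'I_n.+1) a : emb n.+1 (mdegen F i a) = sd i (emb n a).
Proof.
apply: (free_ext (f := emb n.+1 \o mdegen F i) (g := sd i \o emb n)) => x.
apply: etrans (congr1 (emb n.+1) (fmapfU _ x)) _.
apply: etrans (esym (congr1 (sd i) (embU x))).
by rewrite embU sdU /= -ltnS ltn_ord /emb_pt /tdegen /= inord_val.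
Qed.

Lemma degenerateP n (a : F n) :
  (a \in degenerate F n) <-> forall x : S n, nd (emb_pt x) -> a@_x = 0.
Proof.
split=> [ad x xn|a0].
  rewrite -mcoeff_emb; case: n a ad x xn => [|n] a; first by move=> /eqP -> x _; rewrite linear0 mcoeff0.
  move=> /asboolP[b ->] x xn; rewrite linear_sum raddf_sum big1 // => i _ /=.
  by rewrite emb_degen sd_nd.
apply: malg_mem => x xa; have /ndPn[i ti] : ~~ nd (emb_pt x).
  by apply/negP => /a0/eqP; rewrite mcoeff_eq0 xa.
case: n a a0 x xa ti => [|n] a a0 x xa ti; first by have := dg_lt ti.
have [y yx] : exists y : S n, x = sdegen (inord i) y.
  have := dgE ti; rewrite /emb_pt /tdegen /tface /= => e.
  by exists (sface (inord i) x); apply: emb_pt_inj.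
apply/asboolP; exists (fun j => if j == inord i then << y >> else 0).
rewrite (bigD1 (inord i)) //= eqxx big1 ?addr0 => [|j /negbTE ->]; last by rewrite linear0.
by rewrite yx; apply/esym/fmapfU.
Qed.

Lemma moore_imageP n (z : moore F n) :
  (z \in moore_image (A := F) (free_on K (@pp_sub S n))) <-> nd_in_pp (emb n (submod_val z)).
Proof.
rewrite -nd_in_pp_emb; split=> [/asboolP[b [/asboolP bY /degenerateP bz]] x xn|zY].
  have -> : (submod_val z)@_x = b@_x.
    by apply/esym/eqP; rewrite -subr_eq0 -mcoeffB; apply/eqP/bz.
  by rewrite mcoeff_neq0 => /bY.
pose b := restr (fun x : S n => `[< pp_sub x >]) (submod_val z : {malg K[S n]}).
apply/asboolP; exists b; split.
  by apply/asboolP => x; rewrite -mcoeff_neq0 mcoeff_restr; case: asboolP; rewrite ?eqxx.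
apply/degenerateP => x xn; rewrite mcoeffB mcoeff_restr; case: asboolP => [_|nY].
  by rewrite subrr.
apply/eqP; rewrite sub0r oppr_eq0; apply: contraT => zx.
by case: nY; apply: zY.
Qed.

Definition om n : {linear Omega K S n -> {malg K[tot S]}} := emb n \o incl _ \o incl _.

Lemma om_inj n : injective (om n).
Proof. by move=> x y /emb_inj/incl_inj/incl_inj. Qed.

Lemma moore_subP n (a : F n) :
  (a \in moore_sub F n) <-> forall i, fd i.+1 (emb n a) = 0.
Proof.
case: n a => [|n] a; first by split=> // _ i; apply: (fd_out (emb_hom a)).
split=> [/forallP aN i|a0]; last first.
  apply/forallP => -[[|i] lt_i]; apply/implyP => // _.
  by apply/eqP/emb_inj; rewrite linear0 emb_face a0.
have [lt_i|le_i] := ltnP i.+1 n.+2; last by apply: (fd_out (emb_hom a)); rewrite le_i.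
rewrite -[i.+1]/(val (Ordinal lt_i)) -emb_face.
by have /implyP/(_ isT)/eqP -> := aN (Ordinal lt_i); rewrite linear0.
Qed.

Lemma emb_diff n (z : moore F n.+1) :
  emb n (submod_val (diff (moore F) n z)) = fd 0 (emb n.+1 (submod_val z)).
Proof.
have /moore_subP z0 : submod_val z \in moore_sub F n.+1 by exact: submodP.
have -> : submod_val (diff (moore F) n z) = @unnorm_diff_fun K F n (submod_val z) by [].
rewrite /unnorm_diff_fun.
rewrite big_ord_recl linearD [X in _ + X]linear_sum [X in _ + X]big1 => [|i _]; last first.
  by rewrite (linearZ_LR (emb n)) emb_face [fd _ _]z0 /= scaler0.
by rewrite addr0 expr0 scale1r emb_face.
Qed.

Lemma om_diff n x : om n (diff (Omega K S) n x) = fd 0 (om n.+1 x).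
Proof. exact: emb_diff. Qed.

Lemma omP n a : (exists x, om n x = a) <-> Om n a.
Proof.
pose B n := moore_image (A := F) (free_on K (@pp_sub S n)).
have omegaE m (z : moore F m) : (z \in omega_sub B m) <->
    nd_in_pp (emb m (submod_val z)) /\ nd_in_pp (fd 0 (emb m (submod_val z))).
  (* In degree 0 [omega] imposes one condition; the second one is void here because [fd 0] vanishes
     on chains of degree 0. *)
  case: m z => [|m] z.
    split=> [zB|[zB _]]; last exact/moore_imageP.
    split; first exact/moore_imageP.
    by rewrite (fd_out (emb_hom _)) => // t _; rewrite mcoeff0 eqxx.
  rewrite -emb_diff -!moore_imageP.
  by split=> [/andP|zB]; last exact/andP.
split=> [[x <-]|[ah a0 aY daY]].
  have /omegaE[xY dxY] := submodP x; split=> //; first exact: emb_hom.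
  by apply/moore_subP; exact: submodP.
have [b ba] := hom_emb ah.
have bN : b \in moore_sub F n by apply/moore_subP; rewrite ba.
have bO : (Submod bN : moore F n) \in omega_sub B n by apply/omegaE; rewrite /= ba.
by exists (Submod bO).
Qed.

End OmegaTotal.

(** * The shuffle map *)

Section Nabla.
Context {K : comNzRingType} {U : lmodType K}.
Variables dL dR sL sR : nat -> {linear U -> U}.
Implicit Types (c : U).

(* The part of the shuffle map in left degree [k] and total degree [n], with
   degeneracies shifted by [p]: position [p] of the shuffle degenerates the right
   factor (and uses up one left degree) or the left one; in the latter case it is
   moved past [k] left positions, whence the sign. *)
Fixpoint nab (n p k : nat) (c : U) : U :=
  if n is n'.+1 then
    (if k is k'.+1 then nab n' p.+1 k' (sR p c) else 0) +
    (-1) ^+ k *: nab n' p.+1 k (sL p c)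
  else if k == 0 then c else 0.

Fact nab_is_linear n p k : linear (nab n p k).
Proof.
elim: n p k => [|n IH] p k a x y /=; first by case: eqP; rewrite ?scaler0 ?addr0.
have step : nab n p.+1 k (sL p (a *: x + y)) = a *: nab n p.+1 k (sL p x) + nab n p.+1 k (sL p y).
  by rewrite linearP IH.
rewrite step; case: k {step} => [|k].
  by rewrite !add0r scalerDr !scalerA mulrC.
by rewrite linearP IH !scalerDr !scalerA [_ * a]mulrC addrACA.
Qed.
HB.instance Definition _ n p k :=
  GRing.isLinear.Build K U U _ (nab n p k) (@nab_is_linear n p k).

Lemma nab_big n p k c : (n < k)%N -> nab n p k c = 0.
Proof.
elim: n p k c => [|n IH] p [|k] c //= nk; rewrite !IH ?scaler0 ?addr0 //.
exact: ltnW.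
Qed.

Definition dd i : {linear U -> U} := dL i \o dR i.

Lemma ddE i c : dd i c = dL i (dR i c). Proof. by []. Qed.

Hypothesis dLsR : forall i j c, dL i (sR j c) = sR j (dL i c).
Hypothesis dRsL : forall i j c, dR i (sL j c) = sL j (dR i c).
Hypothesis dLdR : forall i j c, dL i (dR j c) = dR j (dL i c).
Hypothesis dLsL_lt : forall i j c, (i <= j)%N -> dL i (sL j.+1 c) = sL j (dL i c).
Hypothesis dRsR_lt : forall i j c, (i <= j)%N -> dR i (sR j.+1 c) = sR j (dR i c).
Hypothesis dLsL_gt : forall i j c, (j < i)%N -> dL i.+1 (sL j c) = sL j (dL i c).
Hypothesis dRsR_gt : forall i j c, (j < i)%N -> dR i.+1 (sR j c) = sR j (dR i c).
Hypothesis dL0sL0 : forall c, dL 0 (sL 0 c) = c.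
Hypothesis dR0sR0 : forall c, dR 0 (sR 0 c) = c.
Variable bihom : nat -> nat -> submodule U.
Hypothesis sL_bihom : forall k l i c, c \in bihom k l -> sL i c \in bihom k.+1 l.
Hypothesis sR_bihom : forall k l i c, c \in bihom k l -> sR i c \in bihom k l.+1.
Hypothesis dLsL_id : forall k l j c, c \in bihom k l -> (j <= k)%N ->
  dL j (sL j c) = c /\ dL j.+1 (sL j c) = c.
Hypothesis dRsR_id : forall k l j c, c \in bihom k l -> (j <= l)%N ->
  dR j (sR j c) = c /\ dR j.+1 (sR j c) = c.

Lemma dd_nab_shift n p k j c : (j <= p)%N -> dd j (nab n p.+1 k c) = nab n p k (dd j c).
Proof.
elim: n p k c => [|n IH] p k c jp; first by rewrite /=; case: eqP; rewrite ?linear0.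
have jp1 : (j <= p.+1)%N by exact: leqW.
have step : dd j (nab n p.+2 k (sL p.+1 c)) = nab n p.+1 k (sL p (dd j c)).
  by rewrite IH // !ddE dRsL dLsL_lt.
rewrite [nab _ _ _ _]/= [in RHS]/= (linearD (dd j)) (linearZ_LR (dd j)) step.
case: k {step} => [|k]; first by rewrite (linear0 (dd j)).
by rewrite IH // !ddE dRsR_lt // dLsR.
Qed.

(** The differential of a Moore complex is d_0, so this is the compatibility of the shuffle map with
    the differentials: in each word d_0 cancels the first degeneracy of one factor and acts on the
    other. *)
Lemma dd0_nab n k c : dd 0 (nab n.+1 0 k c) =
  (if k is k'.+1 then nab n 0 k' (dL 0 c) else 0) + (-1) ^+ k *: nab n 0 k (dR 0 c).
Proof.
rewrite [nab _ _ _ _]/= (linearD (dd 0)) (linearZ_LR (dd 0)) dd_nab_shift // !ddE dRsL dL0sL0.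
case: k => [|k]; first by rewrite (linear0 (dR 0)) (linear0 (dL 0)).
by rewrite -ddE dd_nab_shift // ddE dR0sR0.
Qed.

(** The diagonal faces i > 0 of a shuffle product of Moore chains vanish. By induction on the
    position only i = p + 1 matters, where the first two letters decide: if they are equal, the face
    acts as d_(p+1) on the undegenerated factor; if they differ, the face undoes both degeneracies,
    and the two orders occur with opposite signs. *)
Lemma dd_nab n p k c i : (p < i <= p + n)%N -> (k <= n)%N ->
  c \in bihom (p + k) (p + (n - k)) ->
  (forall j, (p < j)%N -> dL j c = 0) -> (forall j, (p < j)%N -> dR j c = 0) ->
  dd i (nab n p k c) = 0.
Proof.
elim: n p k c i => [|n IH] p k c i pi kn ch cL cR; first by lia.
have sRL j : (p.+1 < j)%N -> dL j (sR p c) = 0 by move=> pj; rewrite dLsR cL ?linear0 //; lia.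
have sRR j : (p.+1 < j)%N -> dR j (sR p c) = 0.
  by case: j => // j pj; rewrite dRsR_gt // cR ?linear0.
have sLL j : (p.+1 < j)%N -> dL j (sL p c) = 0.
  by case: j => // j pj; rewrite dLsL_gt // cL ?linear0.
have sLR j : (p.+1 < j)%N -> dR j (sL p c) = 0 by move=> pj; rewrite dRsL cR ?linear0 //; lia.
have [pi1|ip1] := ltnP p.+1 i.
  rewrite [nab _ _ _ _]/= (linearD (dd i)) (linearZ_LR (dd i)).
  have -> : dd i (nab n p.+1 k (sL p c)) = 0.
    have [kn'|nk] := leqP k n; last by rewrite nab_big ?linear0.
    apply: IH => //; first by lia.
    have -> : (p.+1 + (n - k) = p + (n.+1 - k))%N by lia.
    by rewrite addSn; exact: sL_bihom.
  rewrite scaler0 addr0; case: k kn ch => [|k] kn ch; first exact: linear0.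
  apply: IH => //; first by lia.
  have -> : (p.+1 + k = p + k.+1)%N by lia.
  by rewrite addSn; apply: sR_bihom; move: ch; rewrite subSS.
have -> : i = p.+1 by lia.
case: n {IH} pi kn ch => [|n] pi kn ch.
  case: k kn ch => [|[|k]] //= kn ch.
    by rewrite add0r expr0 scale1r ?ddE dRsL cR // !linear0.
  by rewrite scaler0 addr0 ?ddE dLdR dLsR cL // !linear0.
have sh m e : dd p.+1 (nab n p.+2 m e) = nab n p.+1 m (dd p.+1 e) by exact: dd_nab_shift.
have LL : dd p.+1 (sL p.+1 (sL p c)) = 0 by rewrite ddE !dRsL cR // !linear0.
have RR : dd p.+1 (sR p.+1 (sR p c)) = 0 by rewrite ddE dLdR !dLsR cL // !linear0.
have nabS m q j e : nab m.+1 q j e =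
  (if j is j'.+1 then nab m q.+1 j' (sR q e) else 0) + (-1) ^+ j *: nab m q.+1 j (sL q e) by [].
have step2 m x : dd p.+1 (nab n.+1 p.+1 m x) =
    (if m is m'.+1 then nab n p.+1 m' (dd p.+1 (sR p.+1 x)) else 0) +
    (-1) ^+ m *: nab n p.+1 m (dd p.+1 (sL p.+1 x)).
  rewrite nabS (linearD (dd p.+1)) (linearZ_LR (dd p.+1)) sh.
  by case: m => [|m]; rewrite ?sh ?(linear0 (dd p.+1)).
rewrite nabS (linearD (dd p.+1)) (linearZ_LR (dd p.+1)) step2 LL linear0 scaler0 addr0.
case: k kn ch => [|k] kn ch; first by rewrite (linear0 (dd p.+1)) scaler0 addr0.
rewrite step2 (_ : (if k is m'.+1 then _ else 0) = 0); last first.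
  by case: (k) => // k'; rewrite RR linear0.
rewrite add0r exprS mulN1r scaleNr.
have [kn'|nk] := leqP k n; last by rewrite !nab_big // subrr.
have pk : (p.+1 <= p + k.+1)%N by rewrite addnS ltnS leq_addr.
have pl : (p.+1 <= p + (n.+2 - k.+1))%N by lia.
have -> : dd p.+1 (sL p.+1 (sR p c)) = c.
  rewrite ddE dRsL (dRsR_id ch _).2; last by lia.
  by rewrite (dLsL_id ch pk).1.
have -> : dd p.+1 (sR p.+1 (sL p c)) = c.
  rewrite ddE dLdR dLsR (dLsL_id ch _).2; last by lia.
  by rewrite (dRsR_id ch pl).1.
by rewrite subrr.
Qed.

End Nabla.

(** * Operators acting on one factor of a product *)

Section BiMaps.
Context {K : comNzRingType}.

Section MapLeft.
Variables (X Y X' : choiceType) (f : {linear {malg K[X]} -> {malg K[Y]}}).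

Fact mapL_subproof : {F : {linear {malg K[(X * X')%type]} -> {malg K[(Y * X')%type]}} |
  forall a b, F (mext a b) = mext (f a) b}.
Proof.
pose F : {linear {malg K[(X * X')%type]} -> {malg K[(Y * X')%type]}} :=
  flift (fun p => mext (f << p.1 >>) << p.2 >>).
exists F => a b.
apply: (free_ext (f := F \o mextl b) (g := mextl b \o f)) => x.
apply: (free_ext (f := F \o mext << x >>) (g := mext (f << x >>))) => x'.
by apply: etrans (congr1 F (mextUU x x')) _; exact: fliftU.
Qed.
Definition mapL : {linear {malg K[(X * X')%type]} -> {malg K[(Y * X')%type]}} :=
  sval mapL_subproof.
Lemma mapL_mext a b : mapL (mext a b) = mext (f a) b.
Proof. exact: (svalP mapL_subproof). Qed.
End MapLeft.
Arguments mapL {X Y X'} f : simpl never.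

Section MapRight.
Variables (X X' Y' : choiceType) (g : {linear {malg K[X']} -> {malg K[Y']}}).

Fact mapR_subproof : {G : {linear {malg K[(X * X')%type]} -> {malg K[(X * Y')%type]}} |
  forall a b, G (mext a b) = mext a (g b)}.
Proof.
pose G : {linear {malg K[(X * X')%type]} -> {malg K[(X * Y')%type]}} :=
  flift (fun p => mext << p.1 >> (g << p.2 >>)).
exists G => a b.
apply: (free_ext (f := G \o mextl b) (g := mextl (g b))) => x.
apply: (free_ext (f := G \o mext << x >>) (g := mext << x >> \o g)) => x'.
by apply: etrans (congr1 G (mextUU x x')) _; exact: fliftU.
Qed.
Definition mapR : {linear {malg K[(X * X')%type]} -> {malg K[(X * Y')%type]}} :=
  sval mapR_subproof.
Lemma mapR_mext a b : mapR (mext a b) = mext a (g b).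
Proof. exact: (svalP mapR_subproof). Qed.
End MapRight.
Arguments mapR {X X' Y'} g : simpl never.

Lemma mext_ext (X X' : choiceType) (V : lmodType K)
    (f g : {linear {malg K[(X * X')%type]} -> V}) :
  (forall a b, f (mext a b) = g (mext a b)) -> f =1 g.
Proof. by move=> fg; apply: free_ext => -[x x']; rewrite -mextUU. Qed.

Variables (X X' : choiceType).
Local Notation A := {malg K[X]}.
Local Notation A' := {malg K[X']}.
Implicit Types (c : {malg K[(X * X')%type]}) (f : {linear A -> A}) (g : {linear A' -> A'}).

Lemma mapL_mext2 f1 f2 a (b : A') : mapL f1 (mapL f2 (mext a b)) = mext (f1 (f2 a)) b.
Proof. exact: etrans (congr1 (mapL f1) (mapL_mext f2 a b)) (mapL_mext f1 _ b). Qed.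

Lemma mapR_mext2 g1 g2 (a : A) b : mapR g1 (mapR g2 (mext a b)) = mext a (g1 (g2 b)).
Proof. exact: etrans (congr1 (mapR g1) (mapR_mext g2 a b)) (mapR_mext g1 a _). Qed.

Lemma mapLR_mext f g a b : mapL f (mapR g (mext a b)) = mext (f a) (g b).
Proof. exact: etrans (congr1 (mapL f) (mapR_mext g a b)) (mapL_mext f a _). Qed.

Lemma mapRL_mext f g a b : mapR g (mapL f (mext a b)) = mext (f a) (g b).
Proof. exact: etrans (congr1 (mapR g) (mapL_mext f a b)) (mapR_mext g _ b). Qed.

Lemma mapLR f g c : mapL f (mapR g c) = mapR g (mapL f c).
Proof.
apply: (mext_ext (f := mapL f \o mapR g) (g := mapR g \o mapL f)) => a b.
exact: etrans (mapLR_mext f g a b) (esym (mapRL_mext f g a b)).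
Qed.

Lemma mapL_comp f1 f2 f3 f4 c : (forall a, f1 (f2 a) = f3 (f4 a)) ->
  mapL f1 (mapL f2 c) = mapL f3 (mapL f4 c).
Proof.
move=> ff; apply: (mext_ext (f := mapL f1 \o mapL f2) (g := mapL f3 \o mapL f4)) => a b.
apply: etrans (mapL_mext2 f1 f2 a b) (etrans _ (esym (mapL_mext2 f3 f4 a b))).
by rewrite ff.
Qed.

Lemma mapR_comp g1 g2 g3 g4 c : (forall a, g1 (g2 a) = g3 (g4 a)) ->
  mapR g1 (mapR g2 c) = mapR g3 (mapR g4 c).
Proof.
move=> gg; apply: (mext_ext (f := mapR g1 \o mapR g2) (g := mapR g3 \o mapR g4)) => a b.
apply: etrans (mapR_mext2 g1 g2 a b) (etrans _ (esym (mapR_mext2 g3 g4 a b))).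
by rewrite gg.
Qed.

Lemma colslice_mapL f c x' : colslice x' (mapL f c) = f (colslice x' c).
Proof.
apply: (mext_ext (f := colslice x' \o mapL f) (g := f \o colslice x')) => a b.
apply: etrans (congr1 (colslice x') (mapL_mext _ _ _)) _.
by rewrite colslice_mext -linearZ; apply: congr1; rewrite colslice_mext.
Qed.

Lemma rowslice_mapR g c x : rowslice x (mapR g c) = g (rowslice x c).
Proof.
apply: (mext_ext (f := rowslice x \o mapR g) (g := g \o rowslice x)) => a b.
apply: etrans (congr1 (rowslice x) (mapR_mext _ _ _)) _.
by rewrite rowslice_mext -linearZ; apply: congr1; rewrite rowslice_mext.
Qed.

Lemma malg_colslice0 c : (forall x', colslice x' c = 0) -> c = 0.
Proof. by move=> c0; apply/malgP => -[x x']; rewrite -mcoeff_colslice c0 !mcoeff0. Qed.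

End BiMaps.

Arguments mapL {K X Y X'} f : simpl never.
Arguments mapR {K X X' Y'} g : simpl never.

Section BiOperators.
Context {K : comNzRingType} {X X' : sset}.
Local Notation U := {malg K[(tot X * tot X')%type]}.
Implicit Types (c : U) (w : seq bool).

Definition dL i : {linear U -> U} := mapL (fd i).
Definition dR i : {linear U -> U} := mapR (fd i).
Definition sL i : {linear U -> U} := mapL (sd i).
Definition sR i : {linear U -> U} := mapR (sd i).
Lemma dLsR i j c : dL i (sR j c) = sR j (dL i c). Proof. exact: mapLR. Qed.
Lemma dRsL i j c : dR i (sL j c) = sL j (dR i c). Proof. exact/esym/mapLR. Qed.
Lemma dLdR i j c : dL i (dR j c) = dR j (dL i c). Proof. exact: mapLR. Qed.

Lemma dLsL_lt i j c : (i <= j)%N -> dL i (sL j.+1 c) = sL j (dL i c).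
Proof. by move=> ij; apply: mapL_comp => a; exact: fd_sd_lt. Qed.
Lemma dRsR_lt i j c : (i <= j)%N -> dR i (sR j.+1 c) = sR j (dR i c).
Proof. by move=> ij; apply: mapR_comp => a; exact: fd_sd_lt. Qed.
Lemma dLsL_gt i j c : (j < i)%N -> dL i.+1 (sL j c) = sL j (dL i c).
Proof. by move=> ij; apply: mapL_comp => a; exact: fd_sd_gt. Qed.
Lemma dRsR_gt i j c : (j < i)%N -> dR i.+1 (sR j c) = sR j (dR i c).
Proof. by move=> ij; apply: mapR_comp => a; exact: fd_sd_gt. Qed.

Definition bihom k l : submodule U := free_on K
  (fun p : (tot X * tot X')%type => dim p.1 = k /\ dim p.2 = l).

Lemma bihomP k l c : c \in bihom k l <->
  forall p, p \in msupp c -> dim p.1 = k /\ dim p.2 = l.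
Proof. by split=> [/asboolP|?]; last exact/asboolP. Qed.

Lemma bihom_mext k l a b : a \in hom k -> b \in hom l -> mext a b \in bihom k l.
Proof.
move=> ah bh; apply/bihomP => -[t t']; rewrite -mcoeff_neq0 mcoeff_mext => ab.
have [/eqP tk|/eqP tk] := boolP (dim t == k); last by rewrite (hom_out ah) ?mul0r ?eqxx in ab.
have [/eqP tl|/eqP tl] := boolP (dim t' == l); last by rewrite (hom_out bh) ?mulr0 ?eqxx in ab.
by [].
Qed.

Lemma bihomU k l t t' : dim t = k -> dim t' = l ->
  << ((t, t') : tot X * tot X') >> \in bihom k l.
Proof. by move=> <- <-; rewrite -mextUU; apply: bihom_mext; exact: homU. Qed.

Lemma bihom_ind (V : lmodType K) k l (f g : {linear U -> V}) c : c \in bihom k l ->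
  (forall t t', dim t = k -> dim t' = l ->
     f (mext << t >> << t' >>) = g (mext << t >> << t' >>)) -> f c = g c.
Proof.
move=> /bihomP ch fg; apply: linear_supp_eq => -[t t'] /ch[/= tk tl].
by rewrite -mextUU; exact: fg.
Qed.

Lemma sL_bihom k l i c : c \in bihom k l -> sL i c \in bihom k.+1 l.
Proof.
move=> /bihomP ch; apply: linear_mem => -[t t'] /ch[/= tk tl].
by rewrite -mextUU mapL_mext; apply: bihom_mext; rewrite -?tk -?tl; [apply: sd_hom|]; exact: homU.
Qed.

Lemma sR_bihom k l i c : c \in bihom k l -> sR i c \in bihom k l.+1.
Proof.
move=> /bihomP ch; apply: linear_mem => -[t t'] /ch[/= tk tl].
by rewrite -mextUU mapR_mext; apply: bihom_mext; rewrite -?tk -?tl; [|apply: sd_hom]; exact: homU.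
Qed.

Lemma dL_bihom k l i c : c \in bihom k.+1 l -> dL i c \in bihom k l.
Proof.
move=> /bihomP ch; apply: linear_mem => -[t t'] /ch[/= tk tl].
by rewrite -mextUU mapL_mext; apply: bihom_mext; rewrite -?tk -?tl; [apply: fd_hom; rewrite -tk|]; exact: homU.
Qed.

Lemma dR_bihom k l i c : c \in bihom k l.+1 -> dR i c \in bihom k l.
Proof.
move=> /bihomP ch; apply: linear_mem => -[t t'] /ch[/= tk tl].
by rewrite -mextUU mapR_mext; apply: bihom_mext; rewrite -?tk -?tl; [|apply: fd_hom; rewrite -tl]; exact: homU.
Qed.

Lemma dLsL_id k l j c : c \in bihom k l -> (j <= k)%N -> dL j (sL j c) = c /\ dL j.+1 (sL j c) = c.
Proof.
move=> ch jk; split.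
  apply: (bihom_ind (f := dL j \o sL j) (g := idfun) ch) => t t' tk tl.
  apply: etrans (mapL_mext2 _ _ _ _) _.
  by rewrite (fd_sd_hom (homU t)) ?tk.
apply: (bihom_ind (f := dL j.+1 \o sL j) (g := idfun) ch) => t t' tk tl.
apply: etrans (mapL_mext2 _ _ _ _) _.
by rewrite fd_sdS -fd_sd (fd_sd_hom (homU t)) ?tk.
Qed.

Lemma dRsR_id k l j c : c \in bihom k l -> (j <= l)%N -> dR j (sR j c) = c /\ dR j.+1 (sR j c) = c.
Proof.
move=> ch jk; split.
  apply: (bihom_ind (f := dR j \o sR j) (g := idfun) ch) => t t' tk tl.
  apply: etrans (mapR_mext2 _ _ _ _) _.
  by rewrite (fd_sd_hom (homU t')) ?tl.
apply: (bihom_ind (f := dR j.+1 \o sR j) (g := idfun) ch) => t t' tk tl.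
apply: etrans (mapR_mext2 _ _ _ _) _.
by rewrite fd_sdS -fd_sd (fd_sd_hom (homU t')) ?tl.
Qed.

Lemma fd0_sd0 (Y : sset) (a : {malg K[tot Y]}) : fd 0 (sd 0 a) = a.
Proof. by rewrite fd_sd; apply/malgP => t; rewrite mcoeff_restr. Qed.

Lemma dL0sL0 c : dL 0 (sL 0 c) = c.
Proof.
apply: (mext_ext (f := dL 0 \o sL 0) (g := idfun)) => a b.
by apply: etrans (mapL_mext2 _ _ _ _) _; rewrite fd0_sd0.
Qed.

Lemma dR0sR0 c : dR 0 (sR 0 c) = c.
Proof.
apply: (mext_ext (f := dR 0 \o sR 0) (g := idfun)) => a b.
by apply: etrans (mapR_mext2 _ _ _ _) _; rewrite fd0_sd0.
Qed.

End BiOperators.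

(** * Words in two letters and the sign of a shuffle *)

Section Words.

Fixpoint words (n k : nat) : seq (seq bool) :=
  if n is n'.+1 then
    (if k is k'.+1 then map (cons true) (words n' k') else [::]) ++
    map (cons false) (words n' k)
  else if k == 0%N then [:: [::]] else [::].

Lemma mem_words n k w : (w \in words n k) = (size w == n) && (count id w == k).
Proof.
elim: n k w => [|n IH] k w; first by case: w => [|b w]; case: k => [|k]; rewrite /= ?inE.
have inj c : injective (cons c : seq bool -> seq bool) by move=> u v [].
have nilF (c : bool) (s : seq (seq bool)) : ([::] \in map (cons c) s) = false by elim: s.
have mapF (b : bool) v c s : (b :: v \in map (cons c) s) = (b == c) && (v \in s).
  have [->|bc] := eqVneq b c; first by rewrite (mem_map (@inj c)).
  by apply/negbTE/mapP => -[v' _ [/eqP]]; rewrite (negbTE bc).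
rewrite [words _ _]/= mem_cat; case: w => [|b w].
  by rewrite nilF orbF; case: k => [|k]; rewrite ?nilF.
rewrite mapF IH; case: k => [|k]; rewrite ?mapF ?IH; case: b => //=; rewrite ?orbF ?add0n ?add1n ?eqSS ?andbF //.
Qed.

Lemma words_uniq n k : uniq (words n k).
Proof.
have inj c : injective (cons c : seq bool -> seq bool) by move=> u v [].
elim: n k => [|n IH] [|k] //=; first by rewrite map_inj_uniq.
rewrite cat_uniq !map_inj_uniq // !IH /= andbT.
by apply/hasPn => u /mapP[v _ ->]; apply/mapP => -[v' _].
Qed.

(** The number of inversions, that is of pairs formed by a letter [false] and a later letter [true];
    its parity is the sign of the shuffle. *)
Fixpoint inv w : nat := if w is b :: w' then (if b then inv w' else count id w' + inv w')%N else 0.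

Lemma count_negbE w : count negb w = (size w - count id w)%N.
Proof. by rewrite -(count_predC id w) addKn. Qed.

(** Each [false] is moved past the letters [true] behind it, once the rest of the word has been
    sorted. The prefix [u], left untouched, carries the induction. *)
Lemma alternating_word (V : zmodType) (f : seq bool -> V) u w :
  (forall u v, f (u ++ false :: true :: v) = - f (u ++ true :: false :: v)) ->
  f (u ++ w) = f (u ++ nseq (count id w) true ++ nseq (count negb w) false) *~ ((-1) ^+ inv w).
Proof.
move=> falt; elim: w u => [|b w IH] u /=; first by rewrite mulr1z.
rewrite -cat_rcons IH; case: b => /=; first by rewrite cat_rcons.
rewrite cat_rcons add0n exprD; set k := count id w; set v := nseq _ false.
suff -> : f (u ++ false :: nseq k true ++ v) = f (u ++ nseq k true ++ false :: v) *~ (-1) ^+ k.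
  by rewrite -mulrzA.
elim: k u v => [|k IHk] u v; first by rewrite mulr1z.
by rewrite /= falt -cat_rcons IHk cat_rcons /= exprS mulN1r mulrNz.
Qed.

End Words.

(** * Pairs of simplices arising from shuffles *)

Section Pairs.
Context {X X' : sset}.
Local Notation TT := (tot X * tot X')%type.
Implicit Types (q r : TT) (w : seq bool).

(* For [mu] and [nu] the positions of [true] and [false] in the word [w],
   [psg 0 w (y, y')] is the pair [(s_nu y, s_mu y')]. *)
Definition psg p w q : TT := (sg p w q.1, sg p (map negb w) q.2).
Definition valid w q := dim q.1 = count id w /\ dim q.2 = count negb w.
Definition comp q := dim q.1 = dim q.2 /\ forall i, (i < dim q.1)%N -> dg q.1 i = ~~ dg q.2 i.
Definition ndp q := forall i, ~~ (dg q.1 i && dg q.2 i).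

Lemma count_map_negb w : count id (map negb w) = count negb w.
Proof. by rewrite count_map. Qed.

Lemma count_map_negbN w : count negb (map negb w) = count id w.
Proof. by rewrite count_map; apply: eq_count => b /=; rewrite negbK. Qed.

Lemma nth_map_negb w i : (i < size w)%N -> nth true (map negb w) i = ~~ nth true w i.
Proof. by move=> iw; rewrite (nth_map true). Qed.

Lemma psg_dim w q : valid w q -> dim (psg 0 w q).1 = size w /\ dim (psg 0 w q).2 = size w.
Proof.
move=> [v1 v2]; rewrite /psg /= !tag_sg v1 v2 count_map_negbN [(count negb w + _)%N]addnC.
by rewrite (count_predC id w).
Qed.

Lemma psg_cover w q i : valid w q -> (i < size w)%N ->
  (~~ nth true w i -> dg (psg 0 w q).1 i) /\ (nth true w i -> dg (psg 0 w q).2 i).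
Proof.
move=> [v1 v2] iw; split=> wi; rewrite -[i]add0n; apply: dg_sg_false => //.
- by rewrite add0n v1.
- by rewrite add0n count_map_negb v2.
- by rewrite size_map.
- by rewrite nth_map_negb // wi.
Qed.

Lemma comp_ndp q : comp q -> ndp q.
Proof.
move=> [_ qc] i; apply/negP => /andP[q1 q2].
by have := qc i (dg_lt q1); rewrite q1 q2.
Qed.

Lemma psg_ndp_comp w q : valid w q -> ndp (psg 0 w q) -> comp (psg 0 w q).
Proof.
move=> v nq; have [d1 d2] := psg_dim v; split=> [|i]; first by rewrite d1 d2.
rewrite d1 => iw; have [c1 c2] := psg_cover v iw; have := nq i.
have [wi|wi] := boolP (nth true w i); first by rewrite c2 // andbT => /negbTE.
by rewrite c1 //= => /negbTE ->.
Qed.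

Lemma psg_nd_comp w q : valid w q -> nd q.1 -> nd q.2 -> comp (psg 0 w q).
Proof.
move=> v /ndP n1 /ndP n2; have [d1 d2] := psg_dim v; split=> [|i]; first by rewrite d1 d2.
case: v => v1 v2; rewrite d1 => iw; rewrite -[i]add0n /psg /=.
have -> : dg (sg 0 w q.1) (0 + i) = ~~ nth true w i.
  by apply: dg_sg_nd => //; rewrite add0n v1.
have -> : dg (sg 0 (map negb w) q.2) (0 + i) = ~~ nth true (map negb w) i.
  by apply: dg_sg_nd => //; rewrite ?size_map // add0n count_map_negb v2.
by rewrite nth_map_negb // negbK.
Qed.

Lemma ndp_psg w q : valid w q -> ndp (psg 0 w q) -> nd q.1 /\ nd q.2.
Proof.
move=> v nq; have [v1 v2] := v; split; apply/ndP => j; apply/negP => qj.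
  have [//|i [iw wi qi]] := @dg_sg_true _ 0 w q.1 j v1 _ qj.
  by have := nq i; rewrite -[i in dg _ i]add0n qi (psg_cover v iw).2.
have [||i [iw wi qi]] := @dg_sg_true _ 0 (map negb w) q.2 j _ _ qj => //.
  by rewrite count_map_negb v2.
rewrite size_map in iw; rewrite nth_map_negb // in wi.
by have := nq i; rewrite (psg_cover v iw).1 // -[i]add0n qi.
Qed.

Lemma psg_mask w q i : valid w q -> comp (psg 0 w q) -> (i < size w)%N ->
  nth true w i = ~~ dg (psg 0 w q).1 i.
Proof.
move=> v [_ qc] iw; have [c1 c2] := psg_cover v iw.
have [wi|wi] := boolP (nth true w i); last by rewrite c1.
by rewrite qc ?negbK ?c2 // (psg_dim v).1.
Qed.

Lemma psg_inj_word w q q' : valid w q -> valid w q' -> psg 0 w q = psg 0 w q' -> q = q'.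
Proof.
move=> [v1 v2] [v1' v2'] e; rewrite [q]surjective_pairing [q']surjective_pairing.
case: e => e e'; congr pair.
  by rewrite -(@ret_sg _ 0 w q.1) ?v1 // e ret_sg ?v1'.
rewrite -(@ret_sg _ 0 (map negb w) q.2) ?count_map_negb ?v2 // e'.
by rewrite ret_sg ?count_map_negb ?v2'.
Qed.

Lemma psg_inj w q w' q' : valid w q -> valid w' q' -> comp (psg 0 w q) ->
  psg 0 w q = psg 0 w' q' -> w = w' /\ q = q'.
Proof.
move=> v v' qc e.
have sw : size w = size w' by rewrite -(psg_dim v).1 e (psg_dim v').1.
have ww : w = w'.
  apply: (@eq_from_nth _ true) => // i iw.
  by rewrite (psg_mask v) // e (psg_mask v') -?e // -sw.
by split=> //; subst w'; exact: psg_inj_word e.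
Qed.

(** In each of the directions i and i + 1 one component of q is degenerate. A face with j > i + 1
    preserves direction i, and one with j <= i turns direction i + 1 into i, so either would leave a
    component degenerate in direction i. The face i + 1 avoids this exactly when the two directions
    belong to different components. *)
Lemma diagonal_face q j i : comp q -> (j <= dim q.1)%N -> (i.+1 < dim q.1)%N ->
  ~~ dg (tface j q.1) i -> ~~ dg (tface j q.2) i ->
  j = i.+1 /\ (q = (tdegen i (tface j q.1), tdegen i.+1 (tface j q.2)) \/
               q = (tdegen i.+1 (tface j q.1), tdegen i (tface j q.2))).
Proof.
move=> [d12 qc] jn ilt n1 n2.
have qi := qc i (ltnW ilt); have qi1 := qc _ ilt.
have [ij|ji] := ltnP i.+1 j.
  have b1 := contra (@dg_tface_lt _ i j q.1 _) n1; have b2 := contra (@dg_tface_lt _ i j q.2 _) n2.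
  by move: qi; rewrite (negbTE (b1 _)) ?(negbTE (b2 _)) // ij // -d12.
have [ji'|ij] := leqP j i.
  by move: qi1; rewrite (negbTE (contra (dg_tface_ge ji') n1)) (negbTE (contra (dg_tface_ge ji') n2)).
have jE : j = i.+1 by lia.
subst j; split=> //; case: (boolP (dg q.1 i)) => q1i.
  left; have q1i1 : ~~ dg q.1 i.+1 by apply: contra n1; exact: dg_tface_both.
  have q2i1 : dg q.2 i.+1 by rewrite -[dg q.2 i.+1]negbK -qi1.
  by rewrite -(dgE q2i1) (tface_dg q1i) -(dgE q1i); case: (q).
right; have q2i : dg q.2 i by rewrite -[dg q.2 i]negbK -qi.
have q2i1 : ~~ dg q.2 i.+1 by apply: contra n2; exact: dg_tface_both.
have q1i1 : dg q.1 i.+1 by rewrite qi1.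
by rewrite -(dgE q1i1) (tface_dg q2i) -(dgE q2i); case: (q).
Qed.

End Pairs.

Section SgInsert.
Variable X : sset.
Implicit Types (t : {n : nat & X n}).

Lemma sg_shift p q w t : (p <= q)%N -> (q + count id w <= tag t)%N ->
  tdegen p (sg q w t) = sg q.+1 w (tdegen p t).
Proof.
elim: w q t => [|b w IH] q t //= pq qt; rewrite IH ?leqW //; last first.
  by case: b qt => /=; rewrite ?tag_tdegen; lia.
by case: b qt => //= qt; rewrite tdegenC // pq; lia.
Qed.

Lemma sg_insert p u v t : (p + size u + count id v <= tag t + count negb u)%N ->
  tdegen (p + size u) (sg p (u ++ v) t) = sg p (u ++ false :: v) t.
Proof.
elim: u p t => [|b u IH] p t /=.
  by rewrite !addn0 => pt; apply: sg_shift.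
move=> pt; rewrite addnS -addSn IH //.
by case: b pt => /=; rewrite ?tag_tdegen; lia.
Qed.
End SgInsert.

(** * Coefficients of the shuffle map *)

Section ShuffleMap.
Context {K : comNzRingType} {X X' : sset}.
Local Notation TT := (tot X * tot X')%type.
Local Notation U := {malg K[TT]}.
Implicit Types (c u : U) (q : TT) (w : seq bool).

Definition ddU i : {linear U -> U} := dd dL dR i.
Definition nabU n k : {linear U -> U} := nab sL sR n 0 k.

Lemma nab_bihom n p k a b c : (k <= n)%N -> c \in bihom a b ->
  nab sL sR n p k c \in bihom (a + (n - k)) (b + k).
Proof.
elim: n p k a b c => [|n IH] p k a b c; first by rewrite leqn0 => /eqP -> /=; rewrite !addn0.
move=> kn ch; rewrite [nab _ _ _ _ _ _]/=; apply: rpredD; last apply: rpredZ.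
  case: k kn => [|k] kn; first exact: rpred0.
  by rewrite subSS addnS -addSn; apply: IH => //; exact: sR_bihom.
have [kn'|nk] := leqP k n; last by rewrite nab_big // rpred0.
by rewrite subSn // addnS -addSn; apply: IH => //; exact: sL_bihom.
Qed.

Lemma nabU_bihom n k c : (k <= n)%N -> c \in bihom k (n - k) -> nabU n k c \in bihom n n.
Proof. by move=> kn /(nab_bihom 0 kn); rewrite subnKC // subnK. Qed.

Lemma dd0_nabU n k c : ddU 0 (nabU n.+1 k c) =
  (if k is k'.+1 then nabU n k' (dL 0 c) else 0) + (-1) ^+ k *: nabU n k (dR 0 c).
Proof.
exact: (dd0_nab dLsR dRsL dLsL_lt dRsR_lt dL0sL0 dR0sR0).
Qed.

Lemma dL_out n l i c : c \in bihom n l -> (n < i)%N -> dL i c = 0.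
Proof.
move=> ch ni; apply: (bihom_ind (f := dL i) (g := \0) ch) => t t' tn tl.
by rewrite mapL_mext (fd_out (homU t)) ?tn ?ni // mext0l.
Qed.

Lemma dd_nabU n k c i : (k <= n)%N -> c \in bihom k (n - k) ->
  (forall j, dL j.+1 c = 0) -> (forall j, dR j.+1 c = 0) -> ddU i.+1 (nabU n k c) = 0.
Proof.
move=> kn ch cL cR; have [ile|ni] := leqP i.+1 n; last first.
  by rewrite /ddU ddE dLdR (dL_out (nabU_bihom kn ch)) ?linear0.
apply: (dd_nab dLsR dRsL dLdR dLsL_lt dRsR_lt dLsL_gt dRsR_gt sL_bihom sR_bihom
  dLsL_id dRsR_id (p := 0) (n := n)) => //.
- by case.
- by case.
Qed.

Lemma sL_pt p (t : tot X) (t' : tot X') : (p <= dim t)%N ->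
  sL p << (t, t') >> = << ((tdegen p t : tot X), t') >> :> U.
Proof. by move=> pt; rewrite -!mextUU mapL_mext sdU pt. Qed.

Lemma sR_pt p (t : tot X) (t' : tot X') : (p <= dim t')%N ->
  sR p << (t, t') >> = << (t, (tdegen p t' : tot X')) >> :> U.
Proof. by move=> pt; rewrite -!mextUU mapR_mext sdU pt. Qed.

Lemma nab_pt n p k q : (k <= n)%N -> dim q.1 = (p + k)%N -> dim q.2 = (p + (n - k))%N ->
  nab sL sR n p k << q >> = \sum_(w <- words n k) (-1) ^+ inv w *: << psg p w q >> :> U.
Proof.
elim: n p k q => [|n IH] p k [t t'] /=.
  by rewrite leqn0 => /eqP -> _ _ /=; rewrite big_seq1 expr0 scale1r.
move=> kn tk tl; rewrite big_cat /=; congr (_ + _).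
  case: k kn tk tl => [|k] kn tk tl; first by rewrite big_nil.
  rewrite sR_pt; last by rewrite tl leq_addr.
  rewrite IH; [by rewrite big_map | exact: kn | by rewrite tk addnS addSn |].
  by rewrite tag_tdegen tl subSS addSn.
rewrite big_map; have [kn'|nk] := leqP k n; last first.
  rewrite nab_big // scaler0 big_seq big1 // => w.
  rewrite mem_words => /andP[/eqP sw /eqP cw].
  by have := count_size id w; rewrite sw cw leqNgt nk.
rewrite sL_pt; last by rewrite tk leq_addr.
rewrite IH; [|exact: kn'| by rewrite tag_tdegen tk addSn | by rewrite tl; lia].
rewrite scaler_sumr; apply: eq_big_seq => w.
by rewrite mem_words => /andP[_ /eqP cw]; rewrite scalerA -exprD /= cw.
Qed.

Lemma bihom_valid n k c q w : (k <= n)%N -> c \in bihom k (n - k) -> q \in msupp c ->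
  w \in words n k -> valid w q.
Proof.
move=> kn /bihomP ch /ch[q1 q2]; rewrite mem_words => /andP[/eqP sw /eqP cw].
by split; rewrite ?q1 ?q2 // count_negbE sw cw.
Qed.

Lemma nabU_coef0 n k c r : (k <= n)%N -> c \in bihom k (n - k) ->
  (forall q w, q \in msupp c -> w \in words n k -> psg 0 w q <> r) -> (nabU n k c)@_r = 0.
Proof.
move=> kn ch H; rewrite linear_fliftE raddf_sum big_seq big1 //= => q qc.
have /bihomP/(_ _ qc)[q1 q2] := ch.
rewrite mcoeffZ nab_pt // raddf_sum big_seq big1 ?mulr0 //= => w ww.
by rewrite mcoeffZ mcoeffU (introF eqP (H q w qc ww)) mulr0.
Qed.

Lemma nabU_coef n k c q w : (k <= n)%N -> c \in bihom k (n - k) -> valid w q ->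
  w \in words n k -> comp (psg 0 w q) ->
  (nabU n k c)@_(psg 0 w q) = (-1) ^+ inv w * c@_q.
Proof.
move=> kn ch v ww qc.
transitivity (\sum_(r <- msupp c) c@_r * ((-1) ^+ inv w * (r == q)%:R)).
  rewrite linear_fliftE raddf_sum; apply: eq_big_seq => r rc /=.
  have /bihomP/(_ _ rc)[r1 r2] := ch.
  rewrite mcoeffZ nab_pt // raddf_sum /= (bigD1_seq w) ?words_uniq //=.
  rewrite big_seq_cond big1 ?addr0 => [|w' /andP[ww' w'w]]; last first.
    rewrite mcoeffZ mcoeffU; case: eqP => [e|]; last by rewrite mulr0.
    have [ww0 _] := psg_inj v (bihom_valid kn ch rc ww') qc (esym e).
    by rewrite ww0 eqxx in w'w.
  rewrite mcoeffZ mcoeffU; congr (_ * (_ * _%:R)); congr nat_of_bool.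
  apply/eqP/eqP => [e|->//].
  by have [_] := psg_inj v (bihom_valid kn ch rc ww) qc (esym e).
have [qin|qout] := boolP (q \in msupp c).
  rewrite (big_fsetD1 q) //= eqxx mulr1 mulrC big1_seq ?addr0 // => r /andP[_].
  by rewrite !inE => /andP[/negbTE -> _]; rewrite !mulr0.
rewrite (mcoeff_outdom qout) mulr0 big1_seq // => r /andP[_ rc].
by case: eqVneq rc => [->|_ _]; rewrite ?(negbTE qout) // !mulr0.
Qed.

Local Notation XX := (prod_sset X X').

(** A simplex of the product as a pair of simplices of equal dimension. The embedding [J] carries
    chains of X x X' to the module in which the two factors can be moved separately. *)
Definition jpt (t : tot XX) : TT :=
  (Tagged (fun n => X n) (tagged t).1, Tagged (fun n => X' n) (tagged t).2).

Lemma jpt_inj : injective jpt.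
Proof.
move=> [n [x x']] [m [y y']] /= e; have e0 : n = m := congr1 (fun q : TT => dim q.1) e.
subst m; congr (existT _ n _); congr pair.
  by have /eqP := congr1 fst e; rewrite /= eq_Tagged => /eqP.
by have /eqP := congr1 snd e; rewrite /= eq_Tagged => /eqP.
Qed.

Definition J : {linear {malg K[tot XX]} -> U} := fmapf jpt.

Lemma JU t : J << t >> = << jpt t >>. Proof. exact: fmapfU. Qed.
Lemma J_inj : injective J. Proof. exact: (fmapf_inj jpt_inj). Qed.
Lemma mcoeff_J a t : (J a)@_(jpt t) = a@_t. Proof. exact: (mcoeff_fmapf _ _ jpt_inj). Qed.

Lemma ddU_pt i q : dim q.1 = dim q.2 -> ddU i << q >> =
  if (0 < dim q.1)%N && (i <= dim q.1)%N
  then << ((tface i q.1 : tot X), (tface i q.2 : tot X')) >> else 0.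
Proof.
case: q => t t' /= tt; rewrite -mextUU [LHS]mapLR_mext !fdU -tt.
by case: ifP => _; rewrite ?mextUU ?mext0l.
Qed.

Lemma J_fd i a : J (fd i a) = ddU i (J a).
Proof.
apply: (free_ext (f := J \o fd i) (g := ddU i \o J)) => t.
apply: etrans (congr1 J (fdU i t)) _; apply: etrans _ (esym (congr1 (ddU i) (JU t))).
rewrite ddU_pt //.
case: t => [[|n] x]; first by rewrite linear0.
by rewrite /=; case: ifP => _; rewrite ?linear0 // JU.
Qed.

Lemma dg_jpt t i : dg t i = dg (jpt t).1 i && dg (jpt t).2 i.
Proof.
case: t => [[|n] [x x']] //; rewrite /dg /= ltnS.
case: leqP => //= _.
by rewrite /jpt /tdegen /= !eq_Tagged xpair_eqE.
Qed.

Lemma nd_jpt t : nd t <-> ndp (jpt t).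
Proof. by split=> [/ndP tn i|tn]; [rewrite -dg_jpt | apply/ndP => i; rewrite dg_jpt]. Qed.

Lemma jpt_surj q : dim q.1 = dim q.2 -> exists t, jpt t = q.
Proof.
by case: q => [[n x] [m x']] /= e; subst m; exists (existT (fun n => XX n) n (x, x')).
Qed.

Lemma J_bihom n a : (J a \in bihom n n) <-> a \in hom n.
Proof.
split=> [/bihomP Ja|/homP ah].
  apply/homP => t ta; have /Ja[] // : jpt t \in msupp (J a).
  by rewrite -mcoeff_neq0 mcoeff_J mcoeff_neq0.
by apply: linear_mem => t /ah tn; rewrite JU; apply: bihomU.
Qed.

Lemma bihom_J n u : u \in bihom n n -> exists a, J a = u.
Proof.
move=> /bihomP uh; apply/rangeP; apply: malg_mem => q /uh[q1 q2].
by have [|t <-] := jpt_surj (q := q); [rewrite q1 q2 | apply/rangeP; exists << t >>; rewrite JU].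
Qed.

Lemma mooreU_degenerate0 n u : u \in bihom n n -> (forall i, ddU i.+1 u = 0) ->
  (forall q, ndp q -> u@_q = 0) -> u = 0.
Proof.
move=> uh u0 und; have [a aE] := bihom_J uh; subst u.
rewrite (@moore_degenerate0 _ _ n a) ?linear0 //; first exact/J_bihom.
  by move=> i; apply: J_inj; rewrite J_fd u0 linear0.
by move=> t /nd_jpt tn; rewrite -mcoeff_J und.
Qed.

Lemma boundaryU_degenerate n u : u \in bihom n n -> (forall q, ndp q -> u@_q = 0) ->
  forall q, ndp q -> dim q.1 = dim q.2 -> (\sum_(i < n.+1) (-1) ^+ i *: ddU i u)@_q = 0.
Proof.
move=> uh und q qn qd; have [a aE] := bihom_J uh; subst u.
have [t tq] := jpt_surj qd; subst q.
have -> : \sum_(i < n.+1) (-1) ^+ i *: ddU i (J a) = J (\sum_(i < n.+1) (-1) ^+ i *: fd i a).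
  by rewrite (linear_sum J); apply: eq_bigr => i _; rewrite (linearZ_LR J) J_fd.
rewrite mcoeff_J; apply: boundary_degenerate; [exact/J_bihom | | exact/nd_jpt].
by move=> t' /nd_jpt tn; rewrite -mcoeff_J und.
Qed.

End ShuffleMap.

(** * The shuffle map on path chains *)

Section BoxSubset.
Context {S S' : path_pair}.
Local Notation TT := (tot S * tot S')%type.
Implicit Types (q r : TT) (w : seq bool).

Definition pairs_in_pp q := in_pp q.1 /\ in_pp q.2.

Definition shuffled q := exists w r, [/\ valid w r, psg 0 w r = q & pairs_in_pp r].

Lemma shuffled_box (t : {n : nat & prod_sset S S' n}) :
  in_pp (S := box S S') t <-> shuffled (jpt t).
Proof.
split=> [[k [l [mu [nu [y [y' [kl sh [Yy Yy'] e e']]]]]]]|[w [[r r'] [[/= rw rw'] e [/= Yr Yr']]]]].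
  have [w [wk wl muE nuE]] := shuffle_word sh.
  exists w, (Tagged (fun n => S n) y, Tagged (fun n => S' n) y'); split=> //.
  by rewrite /psg /jpt !sg_degen_word -nuE -muE -e -e'.
case: r r' rw rw' e Yr Yr' => [k y] [l y'] /= rw rw' [e e'] Yr Yr'.
exists k, l, (falses 0 (map negb w)), (falses 0 w), y, y'; split=> //.
- have := congr1 (fun t : tot S => dim t) e.
  by rewrite tag_sg /= => <-; rewrite rw' .
- by rewrite rw rw'; exact: word_shuffle.
- by rewrite -sg_degen_word -e.
- by rewrite -sg_degen_word -e'.
Qed.

End BoxSubset.

Section ShuffleOmega.
Context {K : comNzRingType} {S S' : path_pair}.
Local Notation TT := (tot S * tot S')%type.
Local Notation U := {malg K[TT]}.
Implicit Types (c u e : U) (q r : TT) (w : seq bool).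

(** Supplies the functionals required by [tmul_im]: the four conditions in [Om] all say that certain
    coefficients of b or of its faces are zero. *)
Lemma Om_functionals (Z : path_pair) l :
  exists Psi : set {linear {malg K[tot Z]} -> K^o},
    forall b, Om l b <-> forall psi, Psi psi -> psi b = 0.
Proof.
exists (fun psi => exists t : tot Z, [\/ dim t <> l /\ psi = coef t,
  exists i, psi = coef t \o fd i.+1, [/\ nd t, ~ in_pp t & psi = coef t] |
  [/\ nd t, ~ in_pp t & psi = coef t \o fd 0]]) => b.
split=> [[bh b0 bY dbY] psi [t] [[tl ->]|[i ->]|[tn tY ->]|[tn tY ->]]|bpsi] /=.
- by rewrite coefE (hom_out bh).
- by rewrite b0 linear0.
- by rewrite coefE; apply/eqP; apply: contraT => /(bY t tn).
- by apply/eqP; apply: contraT => /(dbY t tn).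
split.
- apply/homP => t; rewrite -mcoeff_neq0 => bt; apply/eqP; apply: contraNT bt => /eqP tl.
  by rewrite -coefE bpsi //; exists t; apply: Or41.
- move=> i; apply/malgP => t; rewrite mcoeff0 -coefE -[coef t _]/((coef t \o fd i.+1) b).
  by apply: bpsi; exists t; apply: Or42; exists i.
- move=> t tn bt; apply: contrapT => tY; case/eqP: bt.
  by rewrite -coefE bpsi //; exists t; apply: Or43.
- move=> t tn bt; apply: contrapT => tY; case/eqP: bt.
  rewrite -coefE -[coef t _]/((coef t \o fd 0) b).
  by apply: bpsi; exists t; apply: Or44.
Qed.

Lemma mcoeff_Om_neq0 (a : {malg K[tot S]}) (b : {malg K[tot S']}) q :
  nd_in_pp a -> nd_in_pp b -> nd q.1 -> nd q.2 -> (mext a b)@_q != 0 -> pairs_in_pp q.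
Proof.
case: q => t t' aY bY tn tn'; rewrite mcoeff_mext => ab.
by split; [apply: aY tn _|apply: bY tn' _]; apply: contraNneq ab => /= ->; rewrite ?mul0r ?mulr0.
Qed.

Lemma nabU_shuffled n k e : (k <= n)%N -> e \in bihom k (n - k) ->
  (forall q, nd q.1 -> nd q.2 -> e@_q != 0 -> pairs_in_pp q) ->
  forall r, ndp r -> (nabU n k e)@_r != 0 -> shuffled r.
Proof.
move=> kn eh eY r rn er; apply: contrapT => rY; case/eqP: er.
apply: nabU_coef0 => // q w qe ww qr; apply: rY; exists w, q.
have v := bihom_valid kn eh qe ww; subst r.
have [q1 q2] := ndp_psg v rn; split=> //; apply: eY => //.
by rewrite mcoeff_neq0.
Qed.

(** The conditions [Om] for the box product, carried over by [J]. *)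
Definition OmU n u : Prop :=
  [/\ u \in bihom n n, forall i, ddU i.+1 u = 0,
      forall q, ndp q -> u@_q != 0 -> shuffled q
    & forall q, ndp q -> (ddU 0 u)@_q != 0 -> shuffled q].

Lemma nd_in_pp_J (a : {malg K[tot (box S S')]}) m : a \in hom m ->
  nd_in_pp a <-> forall q, ndp q -> (J a)@_q != 0 -> shuffled q.
Proof.
move=> am; split=> aY.
  move=> q qn aq; have /J_bihom/bihomP/(_ q) := am; rewrite -mcoeff_neq0 aq.
  move=> /(_ isT)[q1 q2]; have [|t tq] := jpt_surj (q := q); first by rewrite q1 q2.
  subst q; apply/shuffled_box; apply: aY; first exact/nd_jpt.
  by rewrite -mcoeff_J.
by move=> t /nd_jpt tn at0; apply/shuffled_box; apply: aY => //; rewrite mcoeff_J.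
Qed.

Definition omU n : {linear Omega K (box S S') n -> U} := J \o @om K (box S S') n.

Lemma omU_inj n : injective (omU n).
Proof. by move=> x y /J_inj xy; exact: (@om_inj K (box S S') n x y xy). Qed.

Lemma omU_diff n x : omU n (diff (Omega K (box S S')) n x) = ddU 0 (omU n.+1 x).
Proof. exact: etrans (congr1 J (@om_diff K (box S S') n x)) (J_fd 0 _). Qed.

Lemma Om_J n a : Om (S := box S S') n a <-> OmU n (J a).
Proof.
have dh : a \in hom n -> exists m, fd 0 a \in hom m.
  move=> ah; case: n ah => [|n] ah; last by exists n; exact: fd_hom.
  by exists 0%N; rewrite (fd_out ah) ?rpred0.
split=> [[ah a0 aY daY]|[/J_bihom ah a0 aY daY]]; have [m dah] := dh ah; split=> //.
- exact/J_bihom.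
- by move=> i; rewrite -J_fd a0 linear0.
- exact/(nd_in_pp_J ah).
- by rewrite -J_fd; exact/(nd_in_pp_J dah).
- by move=> i; apply: J_inj; rewrite J_fd a0 linear0.
- exact/(nd_in_pp_J ah).
- by apply/(nd_in_pp_J dah); rewrite J_fd.
Qed.

Lemma omUP n u : (exists x, omU n x = u) <-> OmU n u.
Proof.
split=> [[x <-]|uO]; first by apply/Om_J/omP; exists x.
have [uh _ _ _] := uO; have [a ua] := bihom_J uh; subst u.
by have /omP[x <-] := (Om_J n a).2 uO; exists x.
Qed.

Lemma ddU0_degree0 u : u \in bihom 0 0 -> ddU 0 u = 0.
Proof.
move=> uh; apply: (bihom_ind (f := ddU 0) (g := \0) uh) => t t' t0 t0'.
by apply: etrans (mapLR_mext _ _ _ _) _; rewrite (fd_out (homU t)) ?t0 // mext0l.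
Qed.

Lemma nabU_mext_shuffled n k (a : {malg K[tot S]}) (b : {malg K[tot S']}) : (k <= n)%N -> a \in hom k -> b \in hom (n - k)%N ->
  nd_in_pp a -> nd_in_pp b -> forall r, ndp r -> (nabU n k (mext a b))@_r != 0 -> shuffled r.
Proof.
move=> kn ah bh aY bY; apply: nabU_shuffled kn (bihom_mext ah bh) _.
by move=> q; exact: mcoeff_Om_neq0 aY bY.
Qed.

Lemma nabU_Om n k a b : (k <= n)%N -> Om k a -> Om (n - k)%N b -> OmU n (nabU n k (mext a b)).
Proof.
move=> kn [ah a0 aY daY] [bh b0 bY dbY].
have abh := bihom_mext ah bh; have nh := nabU_bihom kn abh.
split=> //.
- move=> i; apply: dd_nabU => // j.
    by rewrite [LHS]mapL_mext a0 mext0l.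
  by rewrite [LHS]mapR_mext b0 linear0.
- exact: nabU_mext_shuffled.
case: n kn bh abh nh => [|n] kn bh abh nh r rn.
  by rewrite ddU0_degree0 // mcoeff0 eqxx.
rewrite dd0_nabU mcoeffD mcoeffZ => er.
have nz (x y s : K) : x + s * y != 0 -> x != 0 \/ y != 0.
  have [->|] := eqVneq x 0; last by left.
  by rewrite add0r => sy; right; apply: contraNneq sy => ->; rewrite mulr0.
case/nz: er => er.
- case: k kn ah bh abh er {nh a0 b0} => [|k]; first by rewrite mcoeff0 eqxx.
  rewrite ltnS subSS => kn ah bh _ er.
  apply: (nabU_mext_shuffled kn (fd_hom 0 ah) bh daY bY rn).
  by rewrite -mapL_mext; exact: er.
- move: er; have -> : dR 0 (mext a b) = mext a (fd 0 b) by exact: mapR_mext.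
  have [kn'|nk] := leqP k n.
    move: bh; rewrite subSn // => bh.
    exact: (nabU_mext_shuffled kn' ah (fd_hom 0 bh) aY dbY rn).
  rewrite (fd_out bh); last by apply/orP; right; apply/eqP; lia.
  by rewrite linear0 linear0 mcoeff0 eqxx.
Qed.

(** The word, and with it the number k of its letters [true], is determined by the pair, so the
    other summands do not contribute. *)
Lemma sum_nabU_coef n k (c : nat -> U) w q : (k <= n)%N ->
  (forall i, (i <= n)%N -> c i \in bihom i (n - i)) -> valid w q ->
  w \in words n k -> comp (psg 0 w q) ->
  (\sum_(i < n.+1) nabU n i (c i))@_(psg 0 w q) = (-1) ^+ inv w * (c k)@_q.
Proof.
move=> kn ch v ww qc; have kn' : (k < n.+1)%N by [].
rewrite raddf_sum (bigD1 (Ordinal kn')) //= nabU_coef ?ch // big1 ?addr0 // => i ik.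
have iln : (i <= n)%N by rewrite -ltnS ltn_ord.
apply: (nabU_coef0 iln (ch _ iln)) => q' w' qc' ww' e.
have [ww0 _] := psg_inj v (bihom_valid iln (ch _ iln) qc' ww') qc (esym e).
move: ww ww' ik; rewrite -ww0 !mem_words => /andP[_ /eqP wk] /andP[_ /eqP wi] /eqP[].
by apply: val_inj; rewrite /= -wk -wi.
Qed.

Definition bimoore k l c := [/\ c \in bihom k l, forall i, dL i.+1 c = 0
  & forall i, dR i.+1 c = 0].

Lemma colslice_hom k l c x' : c \in bihom k l -> colslice x' c \in hom k.
Proof.
move=> /bihomP ch; apply/homP => t; rewrite -mcoeff_neq0 mcoeff_colslice mcoeff_neq0.
by move=> /ch[].
Qed.

Lemma rowslice_hom k l c x : c \in bihom k l -> rowslice x c \in hom l.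
Proof.
move=> /bihomP ch; apply/homP => t; rewrite -mcoeff_neq0 mcoeff_rowslice mcoeff_neq0.
by move=> /ch[].
Qed.

(** [moore_degenerate0] is used twice: on the columns, and then on the rows that contain the entries
    of a column at nondegenerate x. *)
Lemma bimoore0 k l c : bimoore k l c ->
  (forall q, nd q.1 -> nd q.2 -> c@_q = 0) -> c = 0.
Proof.
move=> [ch cL cR] c0; apply: malg_colslice0 => x'.
apply: (moore_degenerate0 (colslice_hom x' ch)) => [i|x xn].
  by rewrite -colslice_mapL [mapL _ _]cL linear0.
have <- : (rowslice x c)@_x' = (colslice x' c)@_x by rewrite mcoeff_rowslice mcoeff_colslice.
rewrite (moore_degenerate0 (rowslice_hom x ch)) ?mcoeff0 // => [i|y' yn].
  by rewrite -rowslice_mapR [mapR _ _]cR linear0.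
by rewrite mcoeff_rowslice c0.
Qed.

Definition sorted_word k l := nseq k true ++ nseq l false.

Lemma count_sorted_word k l : count id (sorted_word k l) = k /\ count negb (sorted_word k l) = l.
Proof. by rewrite !count_cat !count_nseq /= !mul0n !mul1n addn0. Qed.

Lemma size_sorted_word k l : size (sorted_word k l) = (k + l)%N.
Proof. by rewrite size_cat !size_nseq. Qed.

Lemma sorted_word_in n k : (k <= n)%N -> sorted_word k (n - k) \in words n k.
Proof.
move=> kn; rewrite mem_words size_sorted_word subnKC // eqxx /=.
by have [-> _] := count_sorted_word k (n - k).
Qed.

Lemma sum_nabU_inj n (c : nat -> U) : (forall i, (i <= n)%N -> bimoore i (n - i)%N (c i)) ->
  \sum_(i < n.+1) nabU n i (c i) = 0 -> forall k, (k <= n)%N -> c k = 0.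
Proof.
move=> cm c0 k kn; have ch i : (i <= n)%N -> c i \in bihom i (n - i) by move=> /cm[].
apply: (bimoore0 (cm k kn)) => q q1 q2; apply/eqP; apply: contraT => cq.
have /bihomP/(_ q) := ch k kn; rewrite -mcoeff_neq0 cq => /(_ isT)[d1 d2].
pose w := sorted_word k (n - k).
have [w1 w2] := count_sorted_word k (n - k).
have v : valid w q by split; rewrite ?w1 ?w2.
have := sum_nabU_coef kn ch v (sorted_word_in kn) (psg_nd_comp v q1 q2).
rewrite c0 mcoeff0 => /(congr1 ( *%R ((-1) ^+ inv w))).
by rewrite mulr0 mulrA -exprD addnn -mul2n exprM sqrrN !expr1n mul1r => /esym/eqP; rewrite (negbTE cq).
Qed.

End ShuffleOmega.

Section SumLinear.
Context {K : comNzRingType}.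
Variables (V W : lmodType K) (I : finType) (f : I -> {linear V -> W}).

Definition sumlin_fun x := \sum_i f i x.
Fact sumlin_is_linear : linear sumlin_fun.
Proof.
move=> a x y; rewrite /sumlin_fun scaler_sumr -big_split; apply: eq_bigr => i _ /=.
exact: linearP.
Qed.
HB.instance Definition _ := GRing.isLinear.Build K V W _ sumlin_fun sumlin_is_linear.
Definition sumlin : {linear V -> W} := sumlin_fun.
End SumLinear.

Section AlternatingSum.
Context {K : comNzRingType}.
Variables (V W : lmodType K) (f : nat -> {linear V -> W}).

Definition altsum n : {linear V -> W} := sumlin (fun i : 'I_n => (-1) ^+ i \*: f i).

Lemma altsum_first n x : (forall i, f i.+1 x = 0) -> altsum n.+1 x = f 0 x.
Proof.
move=> fx; rewrite /= /sumlin_fun big_ord_recl /= expr0 scale1r big1 ?addr0 // => i _.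
by rewrite fx scaler0.
Qed.
End AlternatingSum.

Lemma sg_insert0 (X : sset) a b (t : {n : nat & X n}) :
  (size a + count id b <= dim t + count negb a)%N ->
  tdegen (size a) (sg 0 (a ++ b) t) = sg 0 (a ++ false :: b) t.
Proof. by move=> ab; rewrite -[in LHS](add0n (size a)) sg_insert // add0n. Qed.

(** * Antisymmetry of the coefficients in the shuffle *)

Section Antisymmetry.
Context {K : comNzRingType} {X X' : sset}.
Local Notation TT := (tot X * tot X')%type.
Local Notation U := {malg K[TT]}.
Implicit Types (c u z : U) (q r : TT) (w : seq bool).

(** In x and x' the two transposed letters are merged into one that degenerates neither factor; (x,
    x') is the common inner face of the two pairs. *)
Lemma psg_transposed a b q : let p := size a in
  let x := sg 0 (a ++ true :: b) q.1 in
  let x' := sg 0 (map negb a ++ true :: map negb b) q.2 in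
  valid (a ++ false :: true :: b) q ->
  [/\ psg 0 (a ++ false :: true :: b) q = (tdegen p x, tdegen p.+1 x'),
      psg 0 (a ++ true :: false :: b) q = (tdegen p.+1 x, tdegen p x'),
      dim x = (size a + size b).+1 & dim x' = (size a + size b).+1].
Proof.
move=> p x x' []; rewrite !count_cat /= => v1 v2.
have ca := count_predC id a; have cb := count_predC id b.
have ca' : count (predC id) a = count negb a by []; have cb' : count (predC id) b = count negb b by [].
have na : count negb (map negb a) = count id a by rewrite count_map_negbN.
have nb : count negb (map negb b) = count id b by rewrite count_map_negbN.
have nb' := count_map_negb b.
rewrite /p /psg !map_cat /=; split.
- congr pair; first by apply/esym/sg_insert0; rewrite v1 /=; lia.
  have := @sg_insert0 X' (rcons (map negb a) true) (map negb b) q.2.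
  rewrite size_rcons size_map !cat_rcons => -> //.
  by rewrite -cats1 count_cat na v2 nb' /=; lia.
- congr pair; last first.
    have := @sg_insert0 X' (map negb a) (true :: map negb b) q.2.
    by rewrite size_map => -> //; rewrite na v2 /= nb'; lia.
  have := @sg_insert0 X (rcons a true) b q.1; rewrite size_rcons !cat_rcons => -> //.
  by rewrite -cats1 count_cat v1 /=; lia.
- by rewrite tag_sg v1 count_cat /=; lia.
- by rewrite tag_sg v2 count_cat /= na nb; lia.
Qed.

Variables (n : nat) (u : U).
Hypothesis uh : u \in bihom n n.
Hypothesis u_moore : forall i, ddU i.+1 u = 0.
Hypothesis u_comp : forall q, ndp q -> u@_q != 0 -> comp q.
Hypothesis du_comp : forall q, ndp q -> (ddU 0 u)@_q != 0 -> comp q.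

Definition ndpart : U := restr (fun q => `[< ndp q >]) u.

Lemma mcoeff_ndpart q : ndpart@_q = if `[< ndp q >] then u@_q else 0.
Proof. exact: mcoeff_restr. Qed.

(** [ndpart] need not be a Moore chain, so its full alternating boundary is taken. It differs from
    the boundary d_0 u of u by the boundary of a degenerate chain, which has no coefficient at
    nondegenerate pairs. *)
Lemma ndpart_boundary q : ndp q -> ~ comp q -> dim q.1 = dim q.2 ->
  (altsum ddU n.+1 ndpart)@_q = 0.
Proof.
move=> qn qc qd.
have zh : ndpart \in bihom n n.
  apply/bihomP => r; rewrite -mcoeff_neq0 mcoeff_ndpart.
  case: asboolP => [_|_]; last by rewrite eqxx.
  by rewrite mcoeff_neq0; have /bihomP := uh; apply.
have dh : ndpart - u \in bihom n n by rewrite rpredB.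
have dn r : ndp r -> (ndpart - u)@_r = 0.
  by move=> rn; rewrite mcoeffB mcoeff_ndpart; case: asboolP => //; rewrite subrr.
have /eqP := boundaryU_degenerate dh dn qn qd.
rewrite -[\sum_(i < n.+1) _]/(altsum ddU n.+1 _) linearB mcoeffB subr_eq0 => /eqP ->.
rewrite altsum_first //.
by apply/eqP; apply: contraT => /(du_comp qn).
Qed.

(* The pair [(x, x')] below has no common degeneracy but is not of the form
   [psg], so that it does not occur in the boundary of [u]; the two pairs of the
   statement are the only ones in the support of [u] having it as a face, in both
   cases as their face of index [size a + 1]. *)
Lemma ndpart_transposed a b q : valid (a ++ false :: true :: b) q ->
  (size a + size b).+2 = n -> nd q.1 -> nd q.2 ->
  ndpart@_(psg 0 (a ++ false :: true :: b) q) = - ndpart@_(psg 0 (a ++ true :: false :: b) q).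
Proof.
move=> v sab n1 n2; have [e1 e2 d1 d2] := psg_transposed v.
set R1 := psg _ _ q in e1 *; set R2 := psg _ _ q in e2 *.
set x := sg _ _ q.1 in e1 e2 d1; set x' := sg _ _ q.2 in e1 e2 d2.
set p := size a in e1 e2.
have c1 : comp R1 by exact: psg_nd_comp.
have R12 : R1 != R2.
  apply/eqP => e; have v2 : valid (a ++ true :: false :: b) q.
    by move: v; rewrite /valid !count_cat.
  have [/eqP] := psg_inj v v2 c1 e; rewrite eqseq_cat // => /andP[_ /eqP] //.
have [v1 v2] := v.
have xE i : (i < n.-1)%N -> dg x i = ~~ nth true (a ++ true :: b) i.
  move=> lti; rewrite -[in dg x i](add0n i); apply: dg_sg_nd => //.
  - by rewrite v1 !count_cat /=; lia.
  - by rewrite size_cat /=; lia.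
  - by move=> j _; have /ndP := n1; apply.
have x'E i : (i < n.-1)%N -> dg x' i = ~~ nth true (map negb a ++ true :: map negb b) i.
  move=> lti; rewrite -[in dg x' i](add0n i); apply: dg_sg_nd => //.
  - by rewrite v2 !count_cat /= !count_map_negb; lia.
  - by rewrite size_cat /= !size_map; lia.
  - by move=> j _; have /ndP := n2; apply.
have pn : (p < n.-1)%N by rewrite /p; lia.
have xp : ~~ dg x p by rewrite xE // nth_cat ltnn subnn.
have x'p : ~~ dg x' p by rewrite x'E // nth_cat size_map ltnn subnn.
have xn : ndp (x, x').
  move=> i; apply/negP => /= /andP[xi x'i].
  have lti : (i < n.-1)%N by have := dg_lt xi; rewrite d1; lia.
  move: xi x'i; rewrite xE // x'E // !nth_cat size_map.
  case: ltnP => ia; first by rewrite (nth_map true) // negbK => /negbTE ->.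
  case ib: (i - size a)%N => [|j] //=.
  by rewrite (nth_map true) ?negbK => [/negbTE ->|] //; lia.
have xc : ~ comp (x, x').
  by move=> [_ /(_ p)] /=; rewrite d1 (negbTE xp) (negbTE x'p) ltnS leq_addr => /(_ isT).
have := ndpart_boundary xn xc (etrans d1 (esym d2)).
have Rdim r : r = R1 \/ r = R2 -> dim r.1 = n /\ dim r.2 = n.
  by case=> ->; rewrite ?e1 ?e2 /= d1 d2 sab.
have face r j : comp r -> dim r.1 = n -> (j < n.+1)%N ->
    (tface j r.1, tface j r.2) = (x, x') -> j = p.+1 /\ (r = R1 \/ r = R2).
  move=> rc rn jn [ex ex'].
  have [|||| jE r12] := @diagonal_face _ _ r j p rc.
  - by rewrite rn.
  - by rewrite rn; lia.
  - by rewrite ex.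
  - by rewrite ex'.
  - by subst j; split=> //; rewrite e1 e2 -ex -ex'.
have R_face r : r = R1 \/ r = R2 -> (tface p.+1 r.1, tface p.+1 r.2) = (x, x').
  have px : (p <= dim x)%N by rewrite d1; lia.
  have px' : (p <= dim x')%N by rewrite d2; lia.
  have px1 : (p.+1 <= dim x)%N by rewrite d1; lia.
  have px1' : (p.+1 <= dim x')%N by rewrite d2; lia.
  case=> ->; rewrite ?e1 ?e2 [fst _]/= [snd _]/=; congr pair;
    by [exact: tface_degen_eq|exact: tface_degen_eqS].
have psupp r : r \in msupp ndpart -> comp r /\ dim r.1 = n /\ dim r.2 = n.
  rewrite -mcoeff_neq0 mcoeff_ndpart; case: asboolP => [rn ru|_]; last by rewrite eqxx.
  by split; [exact: u_comp | move: ru; rewrite mcoeff_neq0; have /bihomP := uh; apply].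
pose psi : {linear U -> K^o} := (-1) ^+ p.+1 \*: (coef R1 \+ coef R2).
have -> : (altsum ddU n.+1 ndpart)@_((x, x') : TT) = psi ndpart.
  apply: (linear_supp_eq (f := coef ((x, x') : TT) \o altsum ddU n.+1)) => r.
  move=> /psupp[rc [r1 r2]]; rewrite /= coefE raddf_sum /=.
  have term (i : 'I_n.+1) : ((-1) ^+ i *: ddU i << r >>)@_((x, x') : TT) =
      (-1) ^+ i * ((i == p.+1 :> nat) && ((r == R1) || (r == R2)))%:R.
    have iln : (i <= n)%N by rewrite -ltnS.
    have n0 : (0 < n)%N by rewrite -sab.
    rewrite mcoeffZ ddU_pt ?r1 ?r2 // n0 iln mcoeffU; congr (_ * _); congr (nat_of_bool _)%:R; apply/eqP/andP => [/(face _ _ rc r1)|].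
      by case=> // -> [] ->; rewrite !eqxx ?orbT.
    by case=> /eqP -> /orP rR; apply: R_face; case: rR => /eqP; [left|right].
  have pn1 : (p.+1 < n.+1)%N by rewrite /p; lia.
  under eq_bigr => i _ do rewrite term.
  rewrite (bigD1 (Ordinal pn1)) //= big1 => [|i ip]; last first.
    by rewrite -val_eqE /= in ip; rewrite (negbTE ip) mulr0.
  rewrite addr0 eqxx /=; rewrite -[RHS]/((-1) ^+ p.+1 * ((<< r >> : U)@_R1 + (<< r >> : U)@_R2)).
  rewrite !mcoeffU; congr (_ * _); case: (eqVneq r R1) => [->|_]; last by rewrite add0r.
  by rewrite (negbTE R12) addr0.
move=> /(congr1 ( *%R ((-1) ^+ p.+1))).
rewrite -[psi _]/((-1) ^+ p.+1 * (ndpart@_R1 + ndpart@_R2)) mulr0 mulrA -exprD addnn.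
rewrite -mul2n exprM sqrrN !expr1n mul1r => /eqP.
by rewrite addr_eq0 => /eqP.
Qed.
Lemma ndpart_sorted w q : valid w q -> size w = n ->
  ndpart@_(psg 0 w q) =
  (-1) ^+ inv w * ndpart@_(psg 0 (nseq (count id w) true ++ nseq (count negb w) false) q).
Proof.
move=> v wn.
have [[n1 n2]|nq] := pselect (nd q.1 /\ nd q.2); last first.
  have z0 w' : valid w' q -> ndpart@_(psg 0 w' q) = 0.
    by move=> v'; rewrite mcoeff_ndpart; case: asboolP => // /(ndp_psg v').
  rewrite !z0 ?mulr0 //; case: v => v1 v2.
  by split; rewrite count_cat !count_nseq /= !(mul0n, mul1n, addn0, add0n).
(* [alternating_word] quantifies over all words, whereas q fits only those with the letter counts of
   w; f is extended by 0 to the others, which transpositions preserve. *)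
pose f w' := if (count id w' == count id w) && (count negb w' == count negb w)
  then ndpart@_(psg 0 w' q) else 0.
have falt a b : f (a ++ false :: true :: b) = - f (a ++ true :: false :: b).
  rewrite /f !count_cat /=; case: ifP => [/andP[/eqP c1 /eqP c2]|_]; last by rewrite oppr0.
  have [v1 v2] := v; apply: ndpart_transposed => //.
    by split; rewrite !count_cat /= ?c1 ?c2.
  by rewrite -wn -(count_predC id w) -[count (predC id) w]/(count negb w) -c1 -c2
    -(count_predC id a) -(count_predC id b) -![count (predC id) _]/(count negb _); lia.
have := alternating_word [::] w falt; rewrite /= /f !eqxx /= => ->.
rewrite !count_cat !count_nseq /= !mul1n !mul0n addn0 add0n !eqxx /=.
by rewrite -mulrzl rmorphXn rmorphN1.
Qed.

End Antisymmetry.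

(** * Surjectivity of the shuffle map onto Omega of the box product *)

Section Preimage.
Context {K : comNzRingType} {S S' : path_pair}.
Local Notation TT := (tot S * tot S')%type.
Local Notation U := {malg K[TT]}.
Implicit Types (c u e : U) (q r : TT) (w : seq bool).

Lemma shuffled_comp q : ndp q -> shuffled q -> comp q.
Proof. by move=> qn [w [r [v rq _]]]; subst q; exact: psg_ndp_comp. Qed.

Lemma shuffled_pairs w q : valid w q -> nd q.1 -> nd q.2 -> shuffled (psg 0 w q) ->
  pairs_in_pp q.
Proof.
move=> v n1 n2 [w' [r [v' rq rY]]].
by have [_ ->] := psg_inj v v' (psg_nd_comp v n1 n2) (esym rq).
Qed.

Lemma sorted_word_valid n k q : (k <= n)%N -> dim q.1 = k -> dim q.2 = (n - k)%N ->
  valid (sorted_word k (n - k)) q.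
Proof. by move=> kn d1 d2; have [w1 w2] := count_sorted_word k (n - k); split; rewrite ?w1 ?w2. Qed.

Lemma bimoore_projection : exists R : {linear U -> U}, forall k l c, c \in bihom k l ->
  bimoore k l (R c) /\ forall q, nd q.1 -> nd q.2 -> (R c)@_q = c@_q.
Proof.
have [rho rhoP] := @moore_projection K S; have [rho' rhoP'] := @moore_projection K S'.
exists (mapL rho \o mapR rho') => k l c /bihomP ch; split; last first.
  move=> [t t'] /= tn tn'; rewrite -mcoeff_colslice colslice_mapL.
  have [_ _ -> //] := rhoP (colslice t' (mapR rho' c)).
  rewrite mcoeff_colslice -mcoeff_rowslice rowslice_mapR.
  by have [_ _ -> //] := rhoP' (rowslice t c); rewrite mcoeff_rowslice.
split.
- apply: linear_mem => -[t t'] /ch[/= tk tl]; rewrite -mextUU /= mapLR_mext.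
  have [H _ _] := rhoP << t >>; have [H' _ _] := rhoP' << t' >>.
  by apply: bihom_mext; [apply: H; rewrite -tk|apply: H'; rewrite -tl]; exact: homU.
- move=> i; apply: (mext_ext (f := dL i.+1 \o (mapL rho \o mapR rho')) (g := \0)) => a b.
  apply: etrans (congr1 (dL i.+1) (mapLR_mext rho rho' a b)) _.
  apply: etrans (mapL_mext _ _ _) _.
  by have [_ -> _] := rhoP a; rewrite mext0l.
- move=> i; apply: (mext_ext (f := dR i.+1 \o (mapL rho \o mapR rho')) (g := \0)) => a b.
  apply: etrans (congr1 (dR i.+1) (mapLR_mext rho rho' a b)) _.
  apply: etrans (mapR_mext _ _ _) _.
  by have [_ -> _] := rhoP' b; rewrite linear0.
Qed.

Lemma nabU_nd0 n k c r : (k <= n)%N -> c \in bihom k (n - k) ->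
  (forall q, nd q.1 -> nd q.2 -> c@_q = 0) -> ndp r -> (nabU n k c)@_r = 0.
Proof.
move=> kn ch c0 rn; apply: nabU_coef0 => // q w qc ww qr; subst r.
have v := bihom_valid kn ch qc ww; have [q1 q2] := ndp_psg v rn.
by move: qc; rewrite -mcoeff_neq0 c0 ?eqxx.
Qed.

Lemma sum_nabU_bihom n (c : nat -> U) : (forall i, (i <= n)%N -> c i \in bihom i (n - i)) ->
  \sum_(i < n.+1) nabU n i (c i) \in bihom n n.
Proof.
by move=> ch; apply: rpred_sum => i _; apply: nabU_bihom; rewrite ?ch // -ltnS.
Qed.

(** The chains [b] take their coefficients from u at sorted words, and by antisymmetry their shuffle
    image agrees with u at all nondegenerate pairs. Replacing b by its Moore projection keeps these
    coefficients and makes both sides Moore chains, hence equal. *)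
Lemma OmU_moore_preimage n u : OmU n u -> exists c : nat -> U,
  [/\ forall k, (k <= n)%N -> bimoore k (n - k)%N (c k),
      forall k q, (k <= n)%N -> nd q.1 -> nd q.2 -> (c k)@_q != 0 -> pairs_in_pp q
    & \sum_(i < n.+1) nabU n i (c i) = u].
Proof.
move=> [uh u0 uY duY].
have ucomp q : ndp q -> u@_q != 0 -> comp q by move=> qn /(uY _ qn); exact: shuffled_comp.
have ducomp q : ndp q -> (ddU 0 u)@_q != 0 -> comp q.
  by move=> qn /(duY _ qn); exact: shuffled_comp.
pose z := ndpart u.
pose D k : {pred TT} := fun q => (dim q.1 == k) && (dim q.2 == n - k)%N.
have D_inj k : (k <= n)%N -> {in D k &, injective (psg 0 (sorted_word k (n - k)))}.
  move=> kn q q' /andP[/eqP d1 /eqP d2] /andP[/eqP d1' /eqP d2'].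
  by apply: psg_inj_word; exact: sorted_word_valid.
(* Restricting to the bidegree (k, n - k) makes [psg] injective for the fixed sorted word, so the
   coefficients can be pulled back. *)
have [b bE] : exists b : nat -> U, forall k, (k <= n)%N -> forall q, (b k)@_q =
    if q \in D k then z@_(psg 0 (sorted_word k (n - k)) q) else 0.
  have H k : exists bk : U, (k <= n)%N -> forall q, bk@_q =
      if q \in D k then z@_(psg 0 (sorted_word k (n - k)) q) else 0.
    have [kn|kn] := leqP k n; last by exists 0.
    by have [bk bkE] := mcoeff_pullback z (D_inj k kn); exists bk.
  by have [b bE] := choice H; exists b.
have bh k : (k <= n)%N -> b k \in bihom k (n - k).
  move=> kn; apply/bihomP => q; rewrite -mcoeff_neq0 (bE _ kn).
  by case: ifP => [/andP[/eqP -> /eqP ->]|]; rewrite ?eqxx.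
have bY k q : (k <= n)%N -> nd q.1 -> nd q.2 -> (b k)@_q != 0 -> pairs_in_pp q.
  move=> kn n1 n2; rewrite (bE _ kn); case: ifP => [/andP[/eqP d1 /eqP d2]|]; last by rewrite eqxx.
  rewrite mcoeff_ndpart; case: asboolP => [qn uq|_]; last by rewrite eqxx.
  exact: (shuffled_pairs (sorted_word_valid kn d1 d2) n1 n2 (uY _ qn uq)).
(* At a pair given by a word w, both sides are (-1)^(inv w) times the coefficient at the sorted
   word; at a nondegenerate pair not given by any word of length n, both are 0. *)
have bu r : ndp r -> (\sum_(i < n.+1) nabU n i (b i))@_r = u@_r.
  move=> rn; have [[w [q [v qr wn]]]|H] :=
    pselect (exists w q, [/\ valid w q, psg 0 w q = r & size w = n]); last first.
    transitivity (0 : K); last first.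
      apply/esym/eqP; apply: contraT => ur; case: H.
      have [w [q [v qr _]]] := uY _ rn ur; exists w, q; split=> //.
      by rewrite -(psg_dim v).1 qr; move/bihomP: uh => /(_ r); rewrite -mcoeff_neq0 ur => /(_ isT)[].
    rewrite raddf_sum big1 // => i _.
    have iln : (i <= n)%N by rewrite -ltnS.
    apply: (nabU_coef0 iln (bh _ iln)) => q w qb ww qr; apply: H; exists w, q; split=> //.
      exact: bihom_valid iln (bh _ iln) qb ww.
    by move: ww; rewrite mem_words => /andP[/eqP].
  subst r; have kn : (count id w <= n)%N by rewrite -wn count_size.
  have ww : w \in words n (count id w) by rewrite mem_words wn !eqxx.
  rewrite (sum_nabU_coef kn bh v ww (psg_ndp_comp v rn)) (bE _ kn).
  have [d1 d2] := v; have nw : (n - count id w)%N = count negb w by rewrite -wn count_negbE.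
  rewrite unfold_in /D d1 d2 nw !eqxx /=.
  transitivity (z@_(psg 0 w q)); last by rewrite mcoeff_ndpart; case: asboolP.
  by rewrite /z (ndpart_sorted uh u0 ucomp ducomp v wn).
have [R RP] := bimoore_projection.
exists (fun k => R (b k)); split=> [k kn|k q kn n1 n2|].
- by case: (RP _ _ _ (bh k kn)).
- by case: (RP _ _ _ (bh k kn)) => _ -> //; exact: bY.
have Rm i : (i <= n)%N -> bimoore i (n - i)%N (R (b i)).
  by move=> iln; case: (RP _ _ _ (bh i iln)).
have Rh i : (i <= n)%N -> R (b i) \in bihom i (n - i) by move=> /Rm[].
apply/eqP; rewrite -subr_eq0; apply/eqP; apply: (mooreU_degenerate0 (n := n)).
- exact: rpredB (sum_nabU_bihom (c := fun k => R (b k)) Rh) uh.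
- move=> i; rewrite linearB u0 subr0 linear_sum big1 // => j _.
  have jn : (j <= n)%N by rewrite -ltnS.
  by have [h1 h2 h3] := Rm j jn; exact: dd_nabU.
move=> r rn; rewrite mcoeffB -(bu r rn) -mcoeffB -sumrB raddf_sum big1 // => i _ /=.
have iln : (i <= n)%N by rewrite -ltnS.
rewrite -linearB; apply: nabU_nd0 => //; first by rewrite rpredB ?Rh ?bh.
move=> q q1 q2; rewrite mcoeffB; have [_ -> //] := RP _ _ _ (bh i iln).
by rewrite subrr.
Qed.

Lemma bimoore_rowslice0 k l c x : bimoore k l c ->
  (forall x', nd x' -> c@_(x, x') = 0) -> rowslice x c = 0.
Proof.
move=> [ch _ cR] c0; apply: (moore_degenerate0 (rowslice_hom x ch)) => [i|x' xn].
  by rewrite -rowslice_mapR [mapR _ _]cR linear0.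
by rewrite mcoeff_rowslice c0.
Qed.

Lemma bimoore_colslice0 k l c x' : bimoore k l c ->
  (forall x, nd x -> c@_(x, x') = 0) -> colslice x' c = 0.
Proof.
move=> [ch cL _] c0; apply: (moore_degenerate0 (colslice_hom x' ch)) => [i|x xn].
  by rewrite -colslice_mapL [mapL _ _]cL linear0.
by rewrite mcoeff_colslice c0.
Qed.

Lemma bimoore_dL0 k l c : bimoore k.+1 l c -> bimoore k l (dL 0 c).
Proof.
move=> [ch cL cR]; split=> [|i|i]; first exact: dL_bihom.
  have -> : dL i.+1 (dL 0 c) = dL 0 (dL i.+2 c).
    by apply: mapL_comp => a; exact/esym/fd_fd.
  exact: etrans (congr1 (dL 0) (cL i.+1)) (linear0 (dL 0)).
by apply: etrans (esym (dLdR _ _ _)) _; exact: etrans (congr1 (dL 0) (cR i)) (linear0 (dL 0)).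
Qed.

Lemma bimoore_dR0 k l c : bimoore k l.+1 c -> bimoore k l (dR 0 c).
Proof.
move=> [ch cL cR]; split=> [|i|i]; first exact: dR_bihom.
  by apply: etrans (dLdR _ _ _) _; exact: etrans (congr1 (dR 0) (cL i)) (linear0 (dR 0)).
have -> : dR i.+1 (dR 0 c) = dR 0 (dR i.+2 c).
  by apply: mapR_comp => a; exact/esym/fd_fd.
exact: etrans (congr1 (dR 0) (cR i.+1)) (linear0 (dR 0)).
Qed.

Lemma ddU0_sum n (c : nat -> U) : c n.+1 \in bihom n.+1 0 ->
  ddU 0 (\sum_(i < n.+2) nabU n.+1 i (c i)) =
  \sum_(i < n.+1) nabU n i (dL 0 (c i.+1) + (-1) ^+ i *: dR 0 (c i)).
Proof.
move=> cn; rewrite (linear_sum (ddU 0)).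
rewrite (eq_bigr _ (fun (i : 'I_n.+2) _ => dd0_nabU n i (c i))).
rewrite big_split big_ord_recl /= add0r [X in _ + X]big_ord_recr /=.
have -> : dR 0 (c n.+1) = 0.
  apply: (bihom_ind (f := dR 0) (g := \0) cn) => t t' tn t0.
  by apply: etrans (mapR_mext _ _ _) _; rewrite (fd_out (homU t')) ?t0 // linear0.
rewrite linear0 scaler0 addr0 -big_split; apply: eq_bigr => i _ /=.
by rewrite linearD (linearZ_LR (nabU n i)).
Qed.

Lemma boundary_pairs n u (c : nat -> U) i q : OmU n u ->
  (forall k, (k <= n)%N -> bimoore k (n - k)%N (c k)) ->
  \sum_(k < n.+1) nabU n k (c k) = u -> (i < n)%N -> nd q.1 -> nd q.2 ->
  (dL 0 (c i.+1) + (-1) ^+ i *: dR 0 (c i))@_q != 0 -> pairs_in_pp q.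
Proof.
case: n => // n [_ _ _ duY] cm cu; rewrite ltnS => lin n1 n2 eq0.
pose e k : U := dL 0 (c k.+1) + (-1) ^+ k *: dR 0 (c k).
have eh k : (k <= n)%N -> e k \in bihom k (n - k).
  move=> kn; apply: rpredD; last apply: rpredZ.
    by apply: dL_bihom; have [] := cm k.+1 kn.
  by apply: dR_bihom; rewrite -subSn //; have [] := cm k (leqW kn).
have /bihomP/(_ q) := eh i lin; rewrite -mcoeff_neq0 eq0 => /(_ isT)[d1 d2].
have v := sorted_word_valid lin d1 d2; have qc := psg_nd_comp v n1 n2.
apply: (shuffled_pairs v n1 n2); apply: (duY _ (comp_ndp qc)).
have [cn _ _] := cm n.+1 (leqnn _); rewrite subnn in cn.
rewrite -cu (ddU0_sum cn) (sum_nabU_coef (c := e) lin eh v (sorted_word_in lin) qc).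
apply: contraNneq eq0 => /(congr1 ( *%R ((-1) ^+ inv (sorted_word i (n - i))))).
by rewrite mulr0 mulrA -exprD addnn -mul2n exprM sqrrN !expr1n mul1r => ->.
Qed.

Definition biOm k l c := (forall x', Om k (colslice x' c)) /\ (forall x, Om l (rowslice x c)).

(** The boundary of u only controls the sum d_0 (x) 1 on c_(i+1) plus, up to sign, 1 (x) d_0 on c_i.
    Rows and columns separate the two terms: for x nondegenerate and outside the path subset, row x
    of c_i vanishes, hence also its face, and the condition bears on row x of the first term alone;
    symmetrically for columns. *)
Lemma OmU_preimage n u : OmU n u -> exists c : nat -> U,
  (forall k, (k <= n)%N -> biOm k (n - k)%N (c k)) /\
  \sum_(i < n.+1) nabU n i (c i) = u.
Proof.
move=> uO; have [c [cm cY cu]] := OmU_moore_preimage uO; exists c; split=> // k kn.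
have row0 i x : (i <= n)%N -> nd x -> ~ in_pp x -> rowslice x (c i) = 0.
  move=> iln xn xY; apply: (bimoore_rowslice0 (cm i iln)) => x' xn'.
  by apply/eqP; apply: contraT => /(cY i (x, x') iln xn xn')[].
have col0 i x' : (i <= n)%N -> nd x' -> ~ in_pp x' -> colslice x' (c i) = 0.
  move=> iln xn' xY; apply: (bimoore_colslice0 (cm i iln)) => x xn.
  by apply/eqP; apply: contraT => /(cY i (x, x') iln xn xn')[].
have [ch cL cR] := cm k kn.
have colE x' i : colslice x' (dL i (c k)) = fd i (colslice x' (c k)) by exact: colslice_mapL.
have rowE x i : rowslice x (dR i (c k)) = fd i (rowslice x (c k)) by exact: rowslice_mapR.
have drow i x : (i < n)%N -> nd x -> ~ in_pp x -> rowslice x (dL 0 (c i.+1)) = 0.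
  move=> lin xn xY; have m := cm i.+1 lin.
  apply: (bimoore_rowslice0 (bimoore_dL0 m)) => x' xn'; apply/eqP; apply: contraT => d0.
  have [] := boundary_pairs uO cm cu lin (q := (x, x')) xn xn'; last by move/xY.
  rewrite mcoeffD mcoeffZ -[(dR 0 _)@__]mcoeff_rowslice [rowslice _ _]rowslice_mapR.
  by rewrite row0 // ?(ltnW lin) // linear0 mcoeff0 mulr0 addr0.
have dcol i x' : (i < n)%N -> nd x' -> ~ in_pp x' -> colslice x' (dR 0 (c i)) = 0.
  move=> lin xn' xY; have := cm i (ltnW lin); rewrite -[(n - i)%N]prednK ?subn_gt0 // => m.
  apply: (bimoore_colslice0 (bimoore_dR0 m)) => x xn; apply/eqP; apply: contraT => d0.
  have [] := boundary_pairs uO cm cu lin (q := (x, x')) xn xn'; last by move=> _ /xY.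
  rewrite mcoeffD mcoeffZ -[(dL 0 _)@__]mcoeff_colslice [colslice _ _]colslice_mapL.
  rewrite col0 // linear0 mcoeff0 add0r; apply: contraNneq d0 => /(congr1 ( *%R ((-1) ^+ i))).
  by rewrite mulr0 mulrA -exprD addnn -mul2n exprM sqrrN !expr1n mul1r => ->.
split=> [x'|x]; split.
- exact: colslice_hom ch.
- by move=> i; rewrite -colE cL linear0.
- move=> x xn; rewrite mcoeff_colslice -mcoeff_rowslice => cx.
  by apply: contrapT => xY; case/eqP: cx; rewrite row0 ?mcoeff0.
- move=> x xn; rewrite -colE mcoeff_colslice -mcoeff_rowslice => cx.
  apply: contrapT => xY; case/eqP: cx.
  case: k kn ch {cL cR colE rowE} => [|k] kn ch; last by rewrite drow ?mcoeff0.
  rewrite mcoeff_rowslice -mcoeff_colslice [colslice _ _]colslice_mapL.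
  by rewrite (fd_out (colslice_hom _ ch)) ?mcoeff0.
- exact: rowslice_hom ch.
- by move=> i; rewrite -rowE cR linear0.
- move=> x' xn; rewrite mcoeff_rowslice -mcoeff_colslice => cx.
  by apply: contrapT => xY; case/eqP: cx; rewrite col0 ?mcoeff0.
- move=> x' xn; rewrite -rowE mcoeff_rowslice -mcoeff_colslice => cx.
  apply: contrapT => xY; case/eqP: cx.
  have [kn'|nk] := ltnP k n; first by rewrite dcol ?mcoeff0.
  rewrite mcoeff_colslice -mcoeff_rowslice [rowslice _ _]rowslice_mapR.
  by rewrite (fd_out (rowslice_hom _ ch)) ?mcoeff0.
Qed.

End Preimage.

Lemma linear_lift (K : comNzRingType) (V V' W : lmodType K)
    (f : {linear V -> W}) (i : {linear V' -> W}) :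
  injective i -> (forall v, exists v', i v' = f v) ->
  exists g : {linear V -> V'}, forall v, i (g v) = f v.
Proof.
move=> i_inj fi; apply: (@linear_of_graph _ _ _ (fun v v' => i v' = f v)) => //.
- by move=> v w w' iw iw'; apply: i_inj; rewrite iw iw'.
- by move=> a v v' w w' iw iw'; rewrite !linearP iw iw'.
Qed.

Lemma tensor_linear_mem (K : comNzRingType) (V W Z : lmodType K)
    (f : {linear tensor V W -> Z}) (P : submodule Z) t :
  (forall v w, f (tens v w) \in P) -> f t \in P.
Proof.
move=> fP; apply/qproj_eq0; apply: (@tensor_ext _ _ _ _ (qproj P \o f) \0) => v w.
exact/qproj_eq0.
Qed.

(** * The shuffle map as an isomorphism of complexes *)

Section ShuffleIsomorphism.
Context {K : comNzRingType} {S S' : path_pair}.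
Local Notation U := {malg K[(tot S * tot S')%type]}.
(** The three Omega complexes are known here only through their embeddings in the modules of
    simplices and the description of the images by [Om] and [OmU]. *)
Variables (C D E : complex K).
Variables (i : forall n, {linear C n -> {malg K[tot S]}}).
Variables (j : forall n, {linear D n -> {malg K[tot S']}}).
Variables (h : forall n, {linear E n -> U}).
Hypothesis i_diff : forall n x, i n (diff C n x) = fd 0 (i n.+1 x).
Hypothesis j_diff : forall n x, j n (diff D n x) = fd 0 (j n.+1 x).
Hypothesis h_diff : forall n x, h n (diff E n x) = ddU 0 (h n.+1 x).
Hypothesis i_inj : forall n, injective (i n).
Hypothesis j_inj : forall n, injective (j n).
Hypothesis h_inj : forall n, injective (h n).
Hypothesis iP : forall n a, (exists x, i n x = a) <-> Om n a.
Hypothesis jP : forall n b, (exists x, j n x = b) <-> Om n b.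
Hypothesis hP : forall n u, (exists x, h n x = u) <-> OmU n u.
Hypothesis C_proj : forall n, projective (C n).

Local Notation T := (tensor_complex C D).

Let i_eq0 n x : i n x = 0 -> x = 0.
Proof. by move=> ix; apply: i_inj; rewrite ix linear0. Qed.
Let j_eq0 n x : j n x = 0 -> x = 0.
Proof. by move=> jx; apply: j_inj; rewrite jx linear0. Qed.

Definition mulij k l : {linear tensor (C k) (D l) -> U} := tmul (i k) (j l).

Lemma mulij_tens k l v w : mulij k l (tens v w) = mext (i k v) (j l w).
Proof. exact: tmul_tens. Qed.

Lemma mulij_eq0 k l t : mulij k l t = 0 -> t = 0.
Proof. by apply: (tmul_inj (C_proj k)); [exact: i_eq0 | exact: j_eq0]. Qed.

Lemma mulij_biOm k l c : biOm k l c -> exists t, mulij k l t = c.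
Proof.
move=> [cC cR]; have [Psi PsiP] := @Om_functionals K S' l.
apply: (tmul_im (C_proj k) (Psi := Psi)) => [|b /PsiP/jP//|x'|x psi Ppsi].
- exact: i_eq0.
- by apply/iP.
- by have /PsiP := cR x; apply.
Qed.

Lemma mulij_bimoore k l t : bimoore k l (mulij k l t).
Proof.
have im v : Om k (i k v) by apply/iP; exists v.
have jm w : Om l (j l w) by apply/jP; exists w.
split=> [|m|m].
- apply: tensor_linear_mem => v w; rewrite mulij_tens.
  by have [vh _ _ _] := im v; have [wh _ _ _] := jm w; exact: bihom_mext.
- apply: (@tensor_ext _ _ _ _ (dL m.+1 \o mulij k l) \0) => v w.
  apply: etrans (congr1 (dL m.+1) (mulij_tens v w)) _.
  apply: etrans (mapL_mext _ _ _) _.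
  by have [_ -> _ _] := im v; exact: mext0l.
- apply: (@tensor_ext _ _ _ _ (dR m.+1 \o mulij k l) \0) => v w.
  apply: etrans (congr1 (dR m.+1) (mulij_tens v w)) _.
  apply: etrans (mapR_mext _ _ _) _.
  by have [_ -> _ _] := jm w; exact: linear0.
Qed.

Lemma mulij_diff_l k l t :
  mulij k l (tensor_map (diff C k) idfun t) = dL 0 (mulij k.+1 l t).
Proof.
apply: (@tensor_ext _ _ _ _ (mulij k l \o tensor_map (diff C k) idfun)
  (dL 0 \o mulij k.+1 l)) => v w.
apply: etrans (congr1 (mulij k l) (tensor_map_tens _ _ v w)) _.
apply: etrans (mulij_tens _ _) _.
apply: etrans _ (esym (congr1 (dL 0) (mulij_tens v w))).
apply: etrans _ (esym (mapL_mext _ _ _)).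
exact: (congr1 (fun a => mext a (j l w)) (i_diff v)).
Qed.

Lemma mulij_diff_r k l t :
  mulij k l (tensor_map idfun (diff D l) t) = dR 0 (mulij k l.+1 t).
Proof.
apply: (@tensor_ext _ _ _ _ (mulij k l \o tensor_map idfun (diff D l))
  (dR 0 \o mulij k l.+1)) => v w.
apply: etrans (congr1 (mulij k l) (tensor_map_tens _ _ v w)) _.
apply: etrans (mulij_tens _ _) _.
apply: etrans _ (esym (congr1 (dR 0) (mulij_tens v w))).
apply: etrans _ (esym (mapR_mext _ _ _)).
exact: (congr1 (mext (i k v)) (j_diff w)).
Qed.

Fact bd_subproof n (k : 'I_n.+1) : summing_to n (k + (n - k))%N.
Proof. by rewrite /summing_to subnKC // -ltnS. Qed.
Definition bd n (k : 'I_n.+1) : bideg (summing_to n) := Bideg (bd_subproof k).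

Lemma bideg_sum n (p : bideg (summing_to n)) : (bi p + bj p)%N = n.
Proof. exact: (eqP (bidegP p)). Qed.

Lemma bd_surj n (p : bideg (summing_to n)) : exists k, p = bd k.
Proof.
have pn := bideg_sum p; have lt_pn : (bi p < n.+1)%N by lia.
by exists (Ordinal lt_pn); apply: bideg_eq => //=; lia.
Qed.

Definition comp_mul n (t : T n) (p : bideg (summing_to n)) : U := mulij _ _ (t p).

Definition shuffle_map n : {linear T n -> U} :=
  sumlin (fun k : 'I_n.+1 => nabU n k \o mulij _ _ \o dproj (bd k)).

Lemma shuffle_mapE n (t : T n) :
  shuffle_map n t = \sum_(k < n.+1) nabU n k (comp_mul t (bd k)).
Proof. by []. Qed.

Lemma shuffle_map_OmU n (t : T n) : OmU n (shuffle_map n t).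
Proof.
apply/hP/rangeP; rewrite shuffle_mapE; apply: rpred_sum => k _.
apply: (tensor_linear_mem (f := nabU n k \o mulij _ _)) => v w.
apply/rangeP/hP; rewrite /= mulij_tens.
by apply: nabU_Om; [rewrite -ltnS | apply/iP; exists v | apply/jP; exists w].
Qed.

Lemma ord_extend (V : zmodType) n (f : 'I_n.+1 -> V) :
  exists g : nat -> V, forall k : 'I_n.+1, g k = f k.
Proof.
by exists (fun m => if insub m is Some k then f k else 0) => k; rewrite valK.
Qed.

Lemma shuffle_map_eq0 n (t : T n) : shuffle_map n t = 0 -> t = 0.
Proof.
move=> t0; have [c cE] := ord_extend (fun k : 'I_n.+1 => comp_mul t (bd k)).
have cm m : (m <= n)%N -> bimoore m (n - m)%N (c m).
  by move=> mn; rewrite (cE (Ordinal (mn : (m < n.+1)%N))); exact: mulij_bimoore.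
have c0 : \sum_(k < n.+1) nabU n k (c k) = 0.
  by rewrite -[RHS]t0 shuffle_mapE; apply: eq_bigr => k _; rewrite cE.
apply: dsum_ext => p; have [k ->] := bd_surj p.
have kn : (k <= n)%N by rewrite -ltnS.
by apply: mulij_eq0; have := sum_nabU_inj cm c0 kn; rewrite cE.
Qed.

Lemma shuffle_map_surj n u : OmU n u -> exists t, shuffle_map n t = u.
Proof.
move=> /OmU_preimage[c [cO cu]].
have ct (p : bideg (summing_to n)) : {t | mulij (bi p) (bj p) t = c (bi p)}.
  apply: cid; apply: mulij_biOm; have pn := bideg_sum p.
  have -> : bj p = (n - bi p)%N by lia.
  by apply: cO; lia.
exists (fun p => sval (ct p)); rewrite shuffle_mapE -cu; apply: eq_bigr => k _.
by rewrite /comp_mul (svalP (ct (bd k))).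
Qed.

Lemma shuffle_map_diff n (t : T n.+1) :
  shuffle_map n (diff T n t) = ddU 0 (shuffle_map n.+1 t).
Proof.
have [c cE] := ord_extend (fun k : 'I_n.+2 => comp_mul t (bd k)).
have cm m : (m <= n.+1)%N -> bimoore m (n.+1 - m)%N (c m).
  by move=> mn; rewrite (cE (Ordinal (mn : (m < n.+2)%N))); exact: mulij_bimoore.
have -> : shuffle_map n.+1 t = \sum_(k < n.+2) nabU n.+1 k (c k).
  by rewrite shuffle_mapE; apply: eq_bigr => k _; rewrite cE.
rewrite ddU0_sum; last by have [] := cm n.+1 (leqnn _); rewrite subnn.
rewrite shuffle_mapE; apply: eq_bigr => k _; congr (nabU n k _).
have kn : (k < n.+1)%N by [].
have e1 : c k.+1 = comp_mul t (bisl (bd k)).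
  rewrite -[k.+1]/(val (lift ord0 k)) cE; congr (comp_mul t _).
  by apply: bideg_eq.
have e2 : c k = comp_mul t (bisr (bd k)).
  rewrite -[val k]/(val (widen_ord (leqnSn _) k)) cE; congr (comp_mul t _).
  by apply: bideg_eq => //=; rewrite subSn.
rewrite e1 e2 /comp_mul -mulij_diff_l -mulij_diff_r.
rewrite -(linearZ_LR (mulij _ _)) -linearD.
by [].
Qed.

Lemma shuffle_iso : exists (f : forall n, {linear T n -> E n}) (g : forall n, {linear E n -> T n}),
  [/\ forall n x, g n (f n x) = x, forall n y, f n (g n y) = y
    & forall n x, f n (diff T n x) = diff E n (f n.+1 x)].
Proof.
have H n : {f : {linear T n -> E n} | forall t, h n (f t) = shuffle_map n t}.
  by apply: cid; apply: linear_lift => [|t]; [exact: h_inj | exact/hP/shuffle_map_OmU].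
pose f n : {linear T n -> E n} := sval (H n); have fE n t : h n (f n t) = shuffle_map n t.
  exact: (svalP (H n)).
have G n : {g : {linear E n -> T n} | (forall x, g (f n x) = x) /\ forall y, f n (g y) = y}.
  apply: cid; apply: linear_inv => [x fx|y].
    by apply: shuffle_map_eq0; rewrite -fE fx linear0.
  have [|t tE] := @shuffle_map_surj n (h n y); first by apply/hP; exists y.
  by exists t; apply: h_inj; rewrite fE.
exists f, (fun n => sval (G n)); split=> [n x|n y|n x].
- by case: (svalP (G n)).
- by case: (svalP (G n)).
- by apply: h_inj; rewrite h_diff !fE shuffle_map_diff.
Qed.

End ShuffleIsomorphism.

(** * Transport of the exact sequence along the isomorphism *)

Section HomologyMap.
Context {K : comNzRingType}.

Section Map.
Variables (C D : complex K) (f : forall n, {linear C n -> D n}).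
Hypothesis f_diff : forall n x, f n (diff C n x) = diff D n (f n.+1 x).

Lemma chain_map_cyc n (z : cyc C n) : f n (incl _ z) \in kern (dout D n).
Proof.
apply/kernP; case: n z => // n z.
apply: etrans (esym (f_diff _)) _.
exact: etrans (congr1 (f n) (dout_cyc z)) (linear0 (f n)).
Qed.

Lemma homology_map n : exists h : {linear homology C n -> homology D n},
  forall z z', incl _ z' = f n (incl _ z) -> h (hcls C n z) = hcls D n z'.
Proof.
pose fc : {linear cyc C n -> cyc D n} := corestr (f := f n \o incl _) (@chain_map_cyc n).
have [z z0|h hE] := @qlift _ _ _ (bound (diff C n) (dout C n)) (hcls D n \o fc).
  apply/hcls_eq0; have /hcls_eq0[x xz] : hcls C n z = 0 by exact/qproj_eq0.
  exists (f n.+1 x); apply: incl_inj; rewrite -xz.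
  exact: esym (f_diff x).
exists h => z z' zz'; apply: etrans (hE z) _; congr (hcls D n _).
by apply: incl_inj; exact: esym zz'.
Qed.
End Map.

Lemma homology_iso (C D : complex K)
    (f : forall n, {linear C n -> D n}) (g : forall n, {linear D n -> C n}) n :
  (forall n x, g n (f n x) = x) -> (forall n y, f n (g n y) = y) ->
  (forall n x, f n (diff C n x) = diff D n (f n.+1 x)) ->
  exists (p : {linear homology C n -> homology D n}) (q : {linear homology D n -> homology C n}),
    (forall x, q (p x) = x) /\ (forall y, p (q y) = y).
Proof.
move=> gf fg f_diff.
have g_diff m x : g m (diff D m x) = diff C m (g m.+1 x).
  by rewrite -[x in LHS]fg -f_diff gf.
have [p pE] := homology_map f_diff n; have [q qE] := homology_map g_diff n.
exists p, q; split=> x; have [z <-] := hcls_surj x.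
  rewrite (pE z (Submod (chain_map_cyc f_diff z))) //; apply: qE.
  exact: esym (gf _ _).
rewrite (qE z (Submod (chain_map_cyc g_diff z))) //; apply: pE.
exact: esym (fg _ _).
Qed.

Lemma short_exact_transport (U V V' W : lmodType K) (p : {linear V -> V'}) (q : {linear V' -> V})
    (f : {linear U -> V}) (g : {linear V -> W}) :
  (forall x, q (p x) = x) -> (forall y, p (q y) = y) -> short_exact f g ->
  short_exact (p \o f) (g \o q).
Proof.
move=> qp pq [f_inj fg g_surj]; split=> [x y /= xy|y|z].
- by apply: f_inj; rewrite -[LHS]qp xy qp.
- split=> [/fg[x xy]|[x <-]]; first by exists x; rewrite /= xy pq.
  by rewrite /= qp; apply/fg; exists x.
- by have [y yz] := g_surj z; exists (p y); rewrite /= qp.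
Qed.

End HomologyMap.

Theorem theorem9p5 (K : idomainType) (K_pid : is_pid K) (S S' : path_pair) :
  complex_iso (Omega K (box S S')) (tensor_complex (Omega K S) (Omega K S')) /\
  forall n : nat,
    exists (f : {linear
                   dsum (fun p : bideg (summing_to n) =>
                           tensor (Hpp K S (bi p)) (Hpp K S' (bj p))) ->
                   Hpp K (box S S') n})
           (g : {linear
                   Hpp K (box S S') n ->
                   dsum (fun p : bideg (summing_to_pred n) =>
                           Tor1 (Hpp K S (bi p)) (Hpp K S' (bj p)))}),
      short_exact f g.
Proof.
(* Omega Z itself, its cycles and its boundaries all embed in the free module on the simplices of
   Z. *)
have proj (Z : path_pair) n (V : lmodType K) (i : {linear V -> Omega K Z n}) :
    injective i -> projective V.
  move=> i_inj; apply: (proj_of_inj (i := om Z n \o i) K_pid).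
  by move=> x y /= /(@om_inj _ Z n) /i_inj.
have O_proj n : projective (Omega K S n) by exact: (@proj S n _ idfun).
have [f [g [gf fg f_diff]]] := shuffle_iso (@om_diff K S) (@om_diff K S')
  (@omU_diff K S S') (@om_inj K S) (@om_inj K S') (@omU_inj K S S')
  (@omP K S) (@omP K S') (@omUP K S S') O_proj.
split.
  (* The isomorphism is required to start from the box product, so it is the inverse of the shuffle
     map. *)
  exists g; split=> n; first by exists (f n) => x; [exact: fg | exact: gf].
  by move=> x; rewrite -[in LHS](fg _ x) -f_diff gf.
move=> n; have [p [q [qp pq]]] := homology_iso n gf fg f_diff.
have [||| f0 [g0 fg0]] := @kunneth K (Omega K S) (Omega K S') n.
- by move=> m; apply: (@proj S m _ (incl _)); exact: incl_inj.
(* The map [dout] lowers m to [m.-1], so its range lies in that degree; for m = 0 it is the zero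
   submodule in degree 0. *)
- by move=> m; apply: (@proj S m.-1 _ (incl _)); exact: incl_inj.
- by move=> m; apply: (@proj S' m.-1 _ (incl _)); exact: incl_inj.
exists (p \o f0), (g0 \o q); exact: short_exact_transport.
Qed.
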